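(* Consider the Wishart prior $\Pi=\mathcal{W}_p(I,p+b-1)$ on $\Omega$ with integer $b=O(1)$. Let $1\le i,j\le p$. Assume $\|\Sigma^*\|\vee\|\Omega^*\|=O(1)$ and $p/n=o(1)$. Then $$P_{\Sigma^*}^n\sup_{t\in\mathbb{R}}\left|\Pi\left(\frac{\sqrt n(\sigma_{ij}-\hat\sigma_{ij})}{\sqrt{\sigma_{ii}^*\sigma_{jj}^*+\sigma_{ij}^{*2}}}\le t\,\Big|\,X^n\right)-\mathbb{P}(Z\le t)\right|\to0,$$ where $\hat\sigma_{ij}$ is the $(i,j)$-th element of the sample covariance $\hat\Sigma$. If additionally $p^2/n=o(1)$, then $$P_{\Sigma^*}^n\sup_{t\in\mathbb{R}}\left|\Pi\left(\frac{\sqrt n(\omega_{ij}-\hat\omega_{ij})}{\sqrt{\omega_{ii}^*\omega_{jj}^*+\omega_{ij}^{*2}}}\le t\,\Big|\,X^n\right)-\mathbb{P}(Z\le t)\right|\to0,$$ where $\hat\omega_{ij}$ is the $(i,j)$-th element of $\hat\Sigma^{-1}$. Here $Z\sim N(0,1)$.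
   Context: $X^n=(X_1,\dots,X_n)$ are i.i.d. $N(0,\Sigma^* )$ in $\mathbb{R}^p$, $\Omega^*=(\Sigma^* )^{-1}$, $\hat\Sigma=\frac1n\sum_{i=1}^nX_iX_i^T$. For a precision matrix $\Omega$, write $\Sigma=\Omega^{-1}$. Entries of $\Sigma,\Omega,\Sigma^*,\Omega^*$ are denoted $\sigma_{ij},\omega_{ij},\sigma^*_{ij},\omega^*_{ij}$. The Wishart prior $\mathcal{W}_p(I,p+b-1)$ has density on symmetric positive semi-definite matrices (with respect to Lebesgue measure) $$\frac{d\Pi(\Omega)}{d\Omega}\propto\exp\Big(\frac{b-2}{2}\log\det(\Omega)-\frac12\mathrm{tr}(\Omega)\Big)$$ (well defined for integers $b\ge1$). The posterior is $\Pi(B|X^n)=\int_B e^{l_n(\Omega)}d\Pi(\Omega)/\int e^{l_n(\Omega)}d\Pi(\Omega)$ with $l_n(\Omega)=\frac n2\log\det(\Omega)-\frac n2\mathrm{tr}(\Omega\hat\Sigma)$. Asymptotics are as $n,p\to\infty$ jointly; $P_{\Sigma^*}^n$ applied to a random variable denotes expectation under the sampling distribution. $\|\cdot\|$ is the spectral norm, $a\vee b=\max(a,b)$. *)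

(* Defs.v *)
From HB Require Import structures.
From mathcomp Require Import all_boot all_order all_algebra.
From mathcomp Require Import all_classical all_reals all_analysis.
From mathcomp Require Import measurable_realfun ring.

Set Implicit Arguments.
Unset Strict Implicit.
Unset Printing Implicit Defensive.

Import Order.TTheory GRing.Theory Num.Theory.
Import numFieldNormedType.Exports.

Local Open Scope classical_set_scope.
Local Open Scope ring_scope.

Section power_measure.
Context d (T : measurableType d) (R : realType).
Local Open Scope ereal_scope.

Definition tcons n (z : T * n.-tuple T) : n.+1.-tuple T := [tuple of z.1 :: z.2].

Lemma measurable_tcons n : measurable_fun setT (@tcons n).
Proof. by apply: measurable_cons => //; exact: measurable_snd. Qed.

HB.instance Definition _ n :=
  isMeasurableFun.Build _ _ _ _ (@tcons n) (@measurable_tcons n).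

Section step.
Variables (n : nat) (m : {sigma_finite_measure set T -> \bar R}).
Variable (mn : {sigma_finite_measure set (n.-tuple T) -> \bar R}).

Definition power_step : set (n.+1.-tuple T) -> \bar R :=
  pushforward (m \x mn) (@tcons n).

Let power_step0 : power_step set0 = 0.
Proof. exact: measure0. Qed.

Let power_step_ge0 A : 0 <= power_step A.
Proof. exact: measure_ge0. Qed.

Let power_step_sigma_additive : semi_sigma_additive power_step.
Proof. exact: measure_semi_sigma_additive. Qed.

HB.instance Definition _ := isMeasure.Build _ _ _ power_step
  power_step0 power_step_ge0 power_step_sigma_additive.

Let power_step_sigma_finite : sigma_finite setT power_step.
Proof.
have /sigma_finiteP[F [TF ndF Foo]] := sigma_finiteT m.
have /sigma_finiteP[G [TG ndG Goo]] := sigma_finiteT mn.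
pose u (t : n.+1.-tuple T) : T * n.-tuple T := (thead t, [tuple of behead t]).
have uK z : u (tcons z) = z.
  by case: z => x t; congr pair; apply/val_inj.
have mu : measurable_fun setT u.
  by apply/measurable_fun_pair; [exact: measurable_tnth|exact: measurable_behead].
exists (fun k => u @^-1` (F k `*` G k)).
  apply/seteqP; split=> // t _.
  have [k _ Fk] : (\bigcup_k F k) (u t).1 by rewrite -TF.
  have [l _ Gl] : (\bigcup_k G k) (u t).2 by rewrite -TG.
  exists (maxn k l) => //; split.
  - by move: Fk; apply/subsetPset/ndF/leq_maxl.
  - by move: Gl; apply/subsetPset/ndG/leq_maxr.
move=> k; have [mF Fk] := Foo k; have [mG Gk] := Goo k; split.
  by rewrite -[X in measurable X]setTI; apply: mu => //; exact: measurableX.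
rewrite /power_step /pushforward.
rewrite [X in (_ \x _) X](_ : _ = F k `*` G k); last first.
  apply/seteqP; split=> z h; first by rewrite -(uK z).
  by change ((F k `*` G k) (u (tcons z))); rewrite uK.
by rewrite product_measure1E// lte_mul_pinfty// ge0_fin_numE.
Qed.

HB.instance Definition _ :=
  Measure_isSigmaFinite.Build _ _ _ power_step power_step_sigma_finite.
End step.

(* The n-fold product measure m \x ... \x m on T^n. *)
Fixpoint power_measure (m : {sigma_finite_measure set T -> \bar R}) n :
    {sigma_finite_measure set (n.-tuple T) -> \bar R} :=
  match n with
  | 0 => [the {sigma_finite_measure set (0.-tuple T) -> \bar R} of dirac [tuple]]
  | n'.+1 => [the {sigma_finite_measure set (n'.+1.-tuple T) -> \bar R} of
              power_step m (power_measure m n')]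
  end.
End power_measure.

Section density.
Context d (T : measurableType d) (R : realType).
Variables (mu : {measure set T -> \bar R}) (D : set T) (f : T -> R).
Hypotheses (mD : measurable D) (mf : measurable_fun setT f).
Hypothesis f0 : forall x, 0 <= f x.
Local Open Scope ereal_scope.

(* The measure with density f on D (and 0 off D) with respect to mu. *)
Definition density_measure of measurable D & measurable_fun setT f
    & (forall x, 0 <= f x)%R : set T -> \bar R :=
  fun A => \int[mu]_(x in A `&` D) (f x)%:E.

Local Notation nu := (density_measure mD mf f0).

Let nu0 : nu set0 = 0.
Proof. by rewrite /density_measure set0I integral_set0. Qed.

Let nu_ge0 A : 0 <= nu A.
Proof. by apply: integral_ge0 => x _; rewrite lee_fin. Qed.

Let nu_sigma_additive : semi_sigma_additive nu.
Proof.
move=> F mF tF mUF; rewrite /density_measure setI_bigcupl ge0_integral_bigcup//.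
- by apply: is_cvg_ereal_nneg_natsum_cond => n _ _; exact: nu_ge0.
- by move=> k; exact: measurableI.
- by apply/measurable_EFinP; exact: measurable_funTS.
- by move=> x _; rewrite lee_fin.
- by apply: trivIset_setIr.
Qed.

HB.instance Definition _ := isMeasure.Build _ _ _ nu
  nu0 nu_ge0 nu_sigma_additive.
End density.

Section matrices.
Context {R : realType} {p : nat}.
Implicit Types (A : 'M[R]_p) (v : 'C(p.+1, 2).-tuple R).

Definition posdefmx A : Prop :=
  A^T = A /\ forall u : 'cV[R]_p, u != 0 -> 0 < (u^T *m A *m u) 0 0.

Definition l2norm (u : 'cV[R]_p) : R := Num.sqrt (\sum_i u i 0 ^+ 2).

Definition spectral_norm A : R :=
  sup [set l2norm (A *m u) | u in [set u : 'cV[R]_p | l2norm u <= 1]].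

(* Symmetric matrices in packed form: entry (i, j), i <= j (0-based), is
   coordinate j (j + 1) / 2 + i of v. This is a linear bijection from
   R^(p (p + 1) / 2) to the symmetric p x p matrices; "Lebesgue measure on
   symmetric matrices" is Lebesgue measure on these coordinates. *)
Definition sym_mx v : 'M[R]_p :=
  \matrix_(i, j) nth 0 v ('C((maxn i j).+1, 2) + minn i j).

Lemma tr_sym_mx v : (sym_mx v)^T = sym_mx v.
Proof. by apply/matrixP => i j; rewrite !mxE maxnC minnC. Qed.

Lemma measurable_sym_mx i j : measurable_fun setT (fun v => sym_mx v i j).
Proof.
under eq_fun do rewrite mxE.
set k := ('C((maxn i j).+1, 2) + minn i j)%N; have [lk|kl] := ltnP k 'C(p.+1, 2).
  under eq_fun do rewrite -[k]/(nat_of_ord (Ordinal lk)) -tnth_nth.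
  exact: measurable_tnth.
by under eq_fun do rewrite nth_default ?size_tuple//; exact: measurable_cst.
Qed.

Lemma measurable_det_sym_mx : measurable_fun setT (fun v => \det (sym_mx v)).
Proof.
apply: measurable_sum => s; apply: measurable_funM => //.
by apply: measurable_prod => i _; exact: measurable_sym_mx.
Qed.

Lemma measurable_tr_sym_mx : measurable_fun setT (fun v => \tr (sym_mx v)).
Proof. by apply: measurable_sum => i; exact: measurable_sym_mx. Qed.

Let qf A (u : 'cV[R]_p) := (u^T *m A *m u) 0 0.

Let qfE A u : qf A u = \sum_i \sum_j u j 0 * A j i * u i 0.
Proof.
rewrite /qf mxE; apply: eq_bigr => i _; rewrite mxE mulr_suml.
by apply: eq_bigr => j _; rewrite mxE.
Qed.

Let qf_rat A : (forall u : 'cV[rat]_p, 0 <= qf A (map_mx ratr u)) ->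
  forall u, 0 <= qf A u.
Proof.
move=> h u.
have /choice[q qP] (k : nat) : exists q : 'cV[rat]_p,
    forall i, u i 0 <= ratr (q i 0) <= u i 0 + k.+1%:R^-1.
  have /choice[q qP] i : exists q, ratr q \in `]u i 0, (u i 0 + k.+1%:R^-1)[.
    by apply: rat_in_itvoo; rewrite ltrDl invr_gt0.
  exists (\col_i q i) => i; rewrite mxE.
  by have := qP i; rewrite in_itv/= => /andP[/ltW -> /ltW ->].
have cq i : (ratr (q k i 0) : R) @[k --> \oo] --> u i 0.
  apply: (@squeeze_cvgr _ _ _ _ (fun=> u i 0) (fun k => u i 0 + k.+1%:R^-1)).
  - by near=> k; exact: qP.
  - exact: cvg_cst.
  - rewrite -[X in _ --> X]addr0; apply: cvgD; first exact: cvg_cst.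
    exact: cvg_harmonic.
have cqf : qf A (map_mx ratr (q k)) @[k --> \oo] --> qf A u.
  rewrite qfE; under eq_fun do rewrite qfE.
  apply: cvg_big => [|i _]; first exact: add_continuous.
  apply: cvg_big => [|j _]; first exact: add_continuous.
  under eq_fun do rewrite !mxE.
  by apply: cvgM => //; apply: cvgM => //; exact: cvg_cst.
rewrite -(cvg_lim _ cqf)//; apply: limr_ge; first by apply/cvg_ex; exists (qf A u).
exact: nearW.
Unshelve. all: by end_near. Qed.

Let posdefmxE A : A^T = A -> posdefmx A <->
  (forall u : 'cV[rat]_p, 0 <= qf A (map_mx ratr u)) /\ \det A != 0.
Proof.
move=> trA; split=> [[_ pdA]|[psdA dA]].
  have psdA u : 0 <= qf A u.
    have [->|/pdA/ltW//] := eqVneq u 0.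
    by rewrite /qf mulmx0 mxE.
  split=> [u|]; first exact: psdA.
  apply/det0P => -[w w0 wA]; have := pdA w^T; rewrite trmxK wA mul0mx mxE ltxx.
  by move=> /(_ _)/negP; apply => //; rewrite trmx_eq0.
split=> // u u0; have /qf_rat {}psdA := psdA.
rewrite lt_neqAle psdA andbT eq_sym; apply/negP => /eqP qu0.
have Au0 : A *m u != 0.
  apply: contra dA => /eqP Au; apply/det0P; exists u^T; rewrite ?trmx_eq0//.
  by rewrite -[in LHS]trA -trmx_mul Au trmx0.
pose w := A *m u; pose b := \sum_i w i 0 ^+ 2; pose c := qf A w.
have b0 : 0 < b.
  have [i wi] : exists i, w i 0 != 0.
    apply: contrapT => h; move/negP: Au0; apply; apply/eqP/matrixP => i j.
    rewrite [RHS]mxE ord1 -/w.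
    by apply: contrapT => wi; apply: h; exists i; apply/eqP.
  rewrite /b (bigD1 i)//= ltr_pwDl ?sumr_ge0 ?exprn_even_gt0//.
  by move=> j _; exact: sqr_ge0.
have c0 : 0 <= c by exact: psdA.
have wAu : (w^T *m A *m u) 0 0 = b.
  by rewrite -mulmxA mxE; apply: eq_bigr => i _; rewrite mxE expr2.
have uAw : (u^T *m A *m w) 0 0 = b.
  rewrite -wAu -[u^T *m A *m w]trmxK mxE !trmx_mul trmxK trA mulmxA.
  by [].
have key t : qf A (u + t *: w) = t * b + t * b + t ^+ 2 * c.
  rewrite /qf [(_ + _)^T]linearD/= linearZ/= !mulmxDl !mulmxDr -!scalemxAl -!scalemxAr.
  move: qu0; rewrite /c /qf => qu0.
  do !rewrite mxE in qu0 *; move: wAu uAw qu0.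
  by rewrite !mxE => -> -> ->; rewrite expr2; ring.
have := psdA (u + (- (b / (c + 1))) *: w).
have c1 : 0 < c + 1 by rewrite ltr_wpDl.
rewrite key (_ : _ + _ = - (b ^+ 2 * (c + 2) / (c + 1) ^+ 2)).
  by rewrite oppr_ge0 leNgt divr_gt0 ?mulr_gt0 ?exprn_gt0// ltr_wpDl.
by field; rewrite gt_eqF.
Qed.

Lemma measurable_posdef_sym_mx :
  measurable [set v : 'C(p.+1, 2).-tuple R | posdefmx (sym_mx v)].
Proof.
pose F (k : nat) := [set v | if unpickle k is Some u
  then 0 <= qf (sym_mx v) (map_mx ratr (u : 'cV[rat]_p)) else True].
rewrite (_ : [set v | _] = \bigcap_k F k `&` [set v | \det (sym_mx v) != 0]).
  have mb (g : 'C(p.+1, 2).-tuple R -> bool) : measurable_fun setT g -> measurable [set v | g v].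
    move=> mg; rewrite -[X in measurable X]setTI.
    by have := mg measurableT [set true]; apply.
  apply: measurableI.
    apply: bigcapT_measurable => k; rewrite /F.
    case: unpickle => [u|]; last first.
      by rewrite (_ : mkset _ = setT)//; apply/seteqP.
    have mq : measurable_fun setT
        (fun v : 'C(p.+1, 2).-tuple R => qf (sym_mx v) (map_mx ratr u)).
      under eq_fun do rewrite qfE.
      apply: measurable_sum => i; apply: measurable_sum => j.
      apply: measurable_funM => //; apply: measurable_funM => //.
      exact: measurable_sym_mx.
    by have m0 := measurable_fun_ler (measurable_cst (0 : R)) mq; exact: mb.
  rewrite (_ : mkset _ = ~` [set v | \det (sym_mx v) == 0]).
    have m0 := measurable_fun_eqr measurable_det_sym_mx
      (measurable_cst (0 : R)).
    by apply: measurableC; exact: mb.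
  by apply/seteqP; split=> v /= /negP.
apply/seteqP; split=> v /=.
- move=> /(posdefmxE (tr_sym_mx v))[psdv dv]; split=> // k _.
  by rewrite /F /=; case: unpickle.
- move=> [Fv dv]; apply/(posdefmxE (tr_sym_mx v)); split=> // u.
  by have := Fv (pickle u) I; rewrite /F /= pickleK.
Qed.
End matrices.

Section wishart.
Context {R : realType}.
Variables (p b : nat).

(* Up to the normalizing constant, the density of W_p(I, p + b - 1) with
   respect to Lebesgue measure. *)
Definition wishart_weight (v : 'C(p.+1, 2).-tuple R) : R :=
  expR ((b%:R - 2) / 2 * ln (\det (sym_mx v)) - \tr (sym_mx v) / 2).

Lemma measurable_wishart_weight : measurable_fun setT wishart_weight.
Proof.
apply: measurableT_comp => //; apply: measurable_funB.
  apply: measurable_funM => //; apply: measurableT_comp => //.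
  exact: measurable_det_sym_mx.
by apply: measurable_funM => //; exact: measurable_tr_sym_mx.
Qed.

Lemma wishart_weight_ge0 v : 0 <= wishart_weight v.
Proof. exact: expR_ge0. Qed.

(* The Wishart prior, as a law on packed coordinates. The density lives on
   positive definite matrices: the singular positive semi-definite ones, where
   log det and the inverse are undefined, are Lebesgue-null. For b >= 1 the
   total mass is positive and finite, so that the default [dirac point] of
   [mnormalize] is not used. *)
Definition wishart :=
  mnormalize
    (density_measure
       (power_measure lebesgue_measure 'C(p.+1, 2))
       measurable_posdef_sym_mx measurable_wishart_weight wishart_weight_ge0)
    (dirac point).

HB.instance Definition _ := Probability.on wishart.
End wishart.
Arguments wishart {R} p b.

Section posterior.
Context {R : realType} {n p : nat}.
Variables (b : nat) (x : 'I_n -> p.-tuple R).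

Definition colv (y : p.-tuple R) : 'cV[R]_p := \col_j tnth y j.

Definition sample_cov : 'M[R]_p :=
  n%:R^-1 *: \sum_(k < n) (colv (x k) *m (colv (x k))^T).

Definition loglik (Om : 'M[R]_p) : R :=
  n%:R / 2 * ln (\det Om) - n%:R / 2 * \tr (Om *m sample_cov).

(* Posterior probability of the event B for the precision matrix, given the
   observations x. *)
Definition posterior (B : set 'M[R]_p) : R :=
  fine (\int[wishart p b]_(v in sym_mx @^-1` B) (expR (loglik (sym_mx v)))%:E)
  / fine (\int[wishart p b]_v (expR (loglik (sym_mx v)))%:E).

(* sup_t |Pi(f(Omega) <= t | x) - P(Z <= t)| with Z ~ N(0, 1). *)
Definition kolmogorov_gap (f : 'M[R]_p -> R) : \bar R :=
  ereal_sup [set `|posterior [set Om | f Om <= t]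
                   - fine (normal_prob 0 1 `]-oo, t])|%:E | t in [set: R]].
End posterior.

Section sampling.
Context {d} {T : measurableType d} {R : realType} (P : probability T R).
Context {n p : nat}.

(* X ~ N(0, S) for S positive definite: every nonzero linear form u^T X has law
   N(0, u^T S u). The case u = 0 is left out because [normal_prob 0 0] is not
   the Dirac mass at 0. Beware that the second parameter of [normal_prob] is
   the standard deviation. *)
Definition centered_gaussian (X : {RV P >-> p.-tuple R}) (S : 'M[R]_p) : Prop :=
  forall u : 'cV[R]_p, u != 0 -> forall A : set R, measurable A ->
    P [set w | A ((u^T *m colv (X w)) 0 0)] =
    normal_prob 0 (Num.sqrt ((u^T *m S *m u) 0 0)) A.

Definition mutually_independent (X : 'I_n -> {RV P >-> p.-tuple R}) : Prop :=
  forall A : 'I_n -> set (p.-tuple R), (forall k, measurable (A k)) ->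
    P (\bigcap_k (X k @^-1` A k)) = (\prod_(k < n) P (X k @^-1` A k))%E.

Definition gaussian_sample (X : 'I_n -> {RV P >-> p.-tuple R}) (S : 'M[R]_p) :=
  mutually_independent X /\ forall k, centered_gaussian (X k) S.
End sampling.

(* Main.v *)
Require Import Defs.
From HB Require Import structures.
From mathcomp Require Import all_boot all_order fingroup perm all_algebra.
From mathcomp Require Import all_classical all_reals all_analysis.
From mathcomp Require Import measurable_realfun ring lra.
From mathcomp Require Import zify.

(** The posterior is explicit: prior times likelihood is, up to a constant,
det(Om)^a exp(- tr(A Om) / 2) on positive definite matrices, where
a = (n + b - 2) / 2 and A = n Shat + 1 for the sample covariance Shat. It is a
Wishart law, and the law of a single entry of Om or of Om^-1 can be computed
exactly before any limit is taken.

Cutting the first row off Om = [d, c; c^T, M + c^T c / d] makes the weight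
split: the Schur complement M carries the same Wishart weight for the lower
right block of A, independently of (d, c) ([wint_schur]). This is used in two
ways. The lower right block of Om^-1 is M^-1, so coordinates can be removed
one after the other until two are left, which after a relabelling are any i
and j: the law of (sigma_ij, sigma_jj) depends on A only through its entries
at i and j, and it is made of a Student-type and an independent gamma variable
([wint_inv_pair]). And the law of (d, c) gives that of (omega_ii, omega_ij):
a gamma variable and, given it, a Gaussian one ([wint_row_pair]). The diagonal
entries are read off the same pairs.

Centred and scaled, these gamma and Student densities converge to the Gaussian
one and stay below a multiple of the Cauchy density, hence converge in L^1. In
the standardized variables (x, y) the statistic of the theorem converges
pointwise to a linear form u x + v y with u^2 + v^2 = 1, where u and v may
depend on n and on the data; the uniformity in t is then the total variation
convergence together with the boundedness of the Gaussian density
([wprob_limit]). What remains to be known about the data is that the scale of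
the statistic, computed from A, has ratio tending to 1 to the true one, and
that the centring is right up to o(1 / sqrt n). The precision has exponent
n + b + p - 3 where the covariance has n + b - 2: this shifts its centre by
a relative p / n, which must be small against 1 / sqrt n, that is p^2 / n
must tend to 0.

Both properties of the data hold on events of probability close to one. The
entries of Shat have mean square error O(1 / n), by a fourth moment bound for
Gaussian forms and polarization ([sample_cov_mse]). The covariance part only
involves three entries of Shat. For the precision, the Frobenius norm of
Shat - Sigma has mean square O(p^2 / n), and an entry of the inverse moves by
at most a constant times that norm ([perturb_inv]). Finally the Kolmogorov gap
lies in [0, 1] and is small as soon as the deviation of the data is, so its
mean is at most epsilon plus a Markov bound ([mean_gap_cvg]). *)

Set Implicit Arguments.
Unset Strict Implicit.
Unset Printing Implicit Defensive.

Import Order.TTheory GRing.Theory Num.Theory.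
Import numFieldNormedType.Exports.

Local Open Scope classical_set_scope.
Local Open Scope ring_scope.

(** * Affine changes of variable and iterated integrals *)

Section affine.
Context {R : realType}.
Local Notation mu := (@lebesgue_measure R).

Definition aff (a b : R) : measurableTypeR R -> measurableTypeR R :=
  fun x => a * x + b.

Lemma measurable_aff a b : measurable_fun setT (aff a b).
Proof. by apply: measurable_funD => //; exact: measurable_funM. Qed.

Lemma lebesgue_measure_affine (a b : R) (A : set R) : a != 0 -> measurable A ->
  mu A = (`|a|%:E * mu [set x | A (a * x + b)%R])%E.
Proof.
move=> a0 mA.
pose m := mscale (NngNum (normr_ge0 a)) (pushforward mu (aff a b)).
rewrite -[RHS]/(m (measurable_aff a b) A); apply: lebesgue_measure_unique => //= _ [[x y]/= xy <-].
rewrite /m/= /mscale/= /pushforward.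
have [ap|an|a00] := ltgtP 0 a; last by rewrite a00 eqxx in a0.
- rewrite (_ : _ @^-1` _ = `](x - b) / a, (y - b) / a]%classic); last first.
    apply/seteqP; split=> z /=; rewrite /aff !in_itv/= ltr_pdivrMr// ler_pdivlMr//
      ltrBlDr lerBrDr ![z * a]mulrC//.
  rewrite !lebesgue_measure_itv/= !lte_fin ltr_pM2r ?invr_gt0// ltrD2r.
  case: ifP; rewrite ?mule0// -EFinM gtr0_norm// -EFinB => _.
  by congr EFin; field; rewrite gt_eqF.
- rewrite (_ : _ @^-1` _ = `[(y - b) / a, (x - b) / a[%classic); last first.
    apply/seteqP; split=> z /=; rewrite /aff !in_itv/= ler_ndivrMr// ltr_ndivlMr//
      ltrBlDr lerBrDr ![z * a]mulrC => /andP[-> ->]//.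
  rewrite !lebesgue_measure_itv/= !lte_fin ltr_nM2r ?invr_lt0// ltrD2r.
  case: ifP; rewrite ?mule0// -EFinM ltr0_norm// -EFinB => _.
  by congr EFin; field; rewrite lt_eqF.
Qed.

Lemma ge0_integral_affine (a b : R) (f : R -> \bar R) : a != 0 ->
  measurable_fun setT f -> (forall x, 0 <= f x)%E ->
  (\int[mu]_x f x = `|a|%:E * \int[mu]_x f (a * x + b)%R)%E.
Proof.
move=> a0 mf f0.
have := @ge0_integral_pushforward _ _ _ _ R _ (measurable_aff a b) mu setT f
  measurableT mf (fun x _ => f0 x).
rewrite preimage_setT /comp /aff /= => <-.
pose m := mscale (NngNum (normr_ge0 a)) (pushforward mu (aff a b)).
transitivity (\int[m (measurable_aff a b)]_x f x)%E.
  apply: eq_measure_integral => A mA _.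
  exact: (lebesgue_measure_affine b a0 mA).
by rewrite /m ge0_integral_mscale.
Qed.

Lemma ge0_integral_shift (b : R) (f : R -> \bar R) :
  measurable_fun setT f -> (forall x, 0 <= f x)%E ->
  (\int[mu]_x f x = \int[mu]_x f (x + b)%R)%E.
Proof.
move=> mf f0; rewrite (ge0_integral_affine b (oner_neq0 R))// normr1 mul1e.
by under eq_integral do rewrite mul1r.
Qed.
End affine.

Section sequences_integral.
Context {R : realType}.
Local Notation mu := (@lebesgue_measure R).
Implicit Types F : seq R -> \bar R.
Local Open Scope ereal_scope.

Definition leb n := power_measure mu n.

(** Integrands take plain sequences, not tuples: splitting off or permuting
coordinates then needs no cast between tuple types. *)
Definition seqint n F := \int[leb n]_t F (tval t).

(** Measurability of a function of sequences of length n, stated through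
measurable families of coordinates since sequences have no sigma-algebra; the
composition with any coordinate map then comes for free. *)
Definition seqmeas n F := forall d (T : measurableType d) (f : T -> seq R),
  (forall t, size (f t) = n) ->
  (forall i, measurable_fun setT (fun t => nth 0%R (f t) i)) ->
  measurable_fun setT (fun t => F (f t)).

Lemma measurable_nth_tuple n i :
  measurable_fun setT (fun t : n.-tuple R => nth 0%R t i).
Proof.
have [lk|kl] := ltnP i n.
  rewrite (_ : (fun _ => _) = (@tnth n R ^~ (Ordinal lk))); last first.
    by apply/funext => t; rewrite (tnth_nth 0%R).
  exact: measurable_tnth.
by under eq_fun do rewrite nth_default ?size_tuple//; exact: measurable_cst.
Qed.

Lemma seqmeas_tuple n F : seqmeas n F ->
  measurable_fun setT (fun t : n.-tuple R => F t).
Proof. by apply => [t|i]; [rewrite size_tuple|exact: measurable_nth_tuple]. Qed.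

Lemma seqmeas_cons n F x : seqmeas n.+1 F -> seqmeas n (fun s => F (x :: s)).
Proof.
move=> mF d T f sf mf; apply: mF => [t|i]; first by rewrite /= sf.
by case: i => [|i] /=; [exact: measurable_cst|exact: mf].
Qed.

Lemma seqint_ge0 n F : (forall s, 0 <= F s) -> 0 <= seqint n F.
Proof. by move=> F0; apply: integral_ge0. Qed.

Lemma seqint0 F : seqmeas 0 F -> seqint 0 F = F [::].
Proof.
move=> mF; rewrite /seqint /leb /= integral_dirac//; last exact: seqmeas_tuple.
by rewrite diracT mul1e.
Qed.

Lemma seqint_cons n F : seqmeas n.+1 F -> (forall s, 0 <= F s) ->
  seqint n.+1 F = \int[mu]_x seqint n (fun s => F (x :: s)).
Proof.
move=> mF F0; rewrite /seqint /leb /=.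
have := @ge0_integral_pushforward _ _ _ _ R _ (@measurable_tcons _ _ n)
  (mu \x power_measure mu n) setT (fun t => F (tval t)) measurableT
  (seqmeas_tuple mF) (fun x _ => F0 _).
rewrite preimage_setT => h; rewrite [LHS]h fubini_tonelli1//=.
by apply: measurableT_comp; [exact: seqmeas_tuple|exact: measurable_tcons].
Qed.

Lemma measurable_seqint n d (T : measurableType d) (F : T -> seq R -> \bar R) :
  measurable_fun setT (fun z : T * n.-tuple R => F z.1 z.2) ->
  (forall z s, 0 <= F z s) ->
  measurable_fun setT (fun z => seqint n (F z)).
Proof.
move=> mF F0.
exact: (@measurable_fun_fubini_tonelli_F _ _ _ _ R (leb n)
  (fun z => F z.1 (tval z.2)) mF (fun z => F0 _ _)).
Qed.

Definition insert k x (s : seq R) := take k s ++ x :: drop k s.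

Lemma nth_insert k x s i : (k <= size s)%N -> nth 0%R (insert k x s) i =
  if (i < k)%N then nth 0%R s i else if i == k then x else nth 0%R s i.-1.
Proof.
move=> ks; rewrite /insert nth_cat size_takel//; case: ltnP => [ik|ki].
  by rewrite nth_take.
have [->|ne] := eqVneq i k; first by rewrite subnn.
have {ne}ki : (k < i)%N by rewrite ltn_neqAle eq_sym ne.
by case: i ki => // i ki; rewrite subSn//= nth_drop subnKC.
Qed.

Lemma size_insert k x s : size (insert k x s) = (size s).+1.
Proof. by rewrite /insert size_cat/= addnS -size_cat cat_take_drop. Qed.

(** Tonelli with the k-th coordinate moved to the front; the induction swaps it
past one coordinate at a time. *)
Lemma seqint_insert n k F : seqmeas n.+1 F -> (forall s, 0 <= F s) ->
  (k <= n)%N ->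
  seqint n.+1 F = \int[mu]_x seqint n (fun s => F (insert k x s)).
Proof.
elim: k n F => [|k IH] n F mF F0 kn.
  by rewrite seqint_cons//; apply: eq_integral => x _; under [RHS]eq_integral do
    rewrite /insert take0 drop0.
case: n kn mF => // n kn mF; rewrite seqint_cons//.
have mG : measurable_fun setT (fun z : (R * R) * n.-tuple R =>
    F (z.1.1 :: insert k z.1.2 z.2)).
  apply: mF => [z|[|i]] /=.
  - by rewrite size_insert size_tuple.
  - exact: measurableT_comp measurable_fst measurable_fst.
  - under eq_fun do rewrite nth_insert ?size_tuple//.
    case: ltnP => _; last case: eqP => _.
    + exact: (measurableT_comp (@measurable_nth_tuple n i) measurable_snd).
    + exact: measurableT_comp measurable_snd measurable_fst.
    + exact: (measurableT_comp (@measurable_nth_tuple n i.-1) measurable_snd).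
transitivity (\int[mu]_y \int[mu]_x seqint n (fun s => F (y :: insert k x s))).
  by apply: eq_integral => y _; apply: IH => //; exact: seqmeas_cons.
rewrite (@fubini_tonelli _ _ _ _ R mu mu
  (fun z => seqint n (fun s => F (z.1 :: insert k z.2 s))))//; last 2 first.
- exact: (@measurable_seqint n _ _
    (fun z : R * R => fun s => F (z.1 :: insert k z.2 s))).
- by move=> z; exact: seqint_ge0.
apply: eq_integral => x _; rewrite [RHS]seqint_cons//.
move=> d T f sf mf; apply: mF => [t|i]; first by rewrite size_insert sf.
under eq_fun do rewrite nth_insert ?sf//.
by case: ltnP => _; [exact: mf|case: eqP => _; [exact: measurable_cst|exact: mf]].
Qed.

Lemma seqmeas_perm n F s : size s = n -> seqmeas n F ->
  seqmeas n (fun v => F [seq nth 0%R v i | i <- s]).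
Proof.
move=> ss mF d T f sf mf; apply: mF => [t|i]; first by rewrite size_map.
have [il|li] := ltnP i (size s); last first.
  by under eq_fun do rewrite nth_default ?size_map//; exact: measurable_cst.
by under eq_fun do rewrite (nth_map 0%N)//; exact: mf.
Qed.

(** Permutation invariance of Lebesgue measure. The coordinate that comes first
after the permutation is integrated first by [seqint_insert], and [unbump]
renumbers the others for the induction. *)
Lemma seqint_perm n F s : seqmeas n F -> (forall v, 0 <= F v) ->
  perm_eq s (iota 0 n) ->
  seqint n (fun v => F [seq nth 0%R v i | i <- s]) = seqint n F.
Proof.
elim: n F s => [|n IH] F s mF F0 ps.
  rewrite !seqint0//; last first.
    by apply: seqmeas_perm => //; rewrite (perm_size ps).
  by move: ps => /perm_size; case: s.
have ss := perm_size ps; rewrite size_iota in ss.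
case: s ss ps => // k s [ss] ps.
have us : uniq (k :: s) by rewrite (perm_uniq ps) iota_uniq.
have ls i : i \in k :: s -> (i <= n)%N.
  by rewrite (perm_mem ps) mem_iota/= add0n ltnS.
have kn : (k <= n)%N by apply: ls; rewrite inE eqxx.
rewrite (@seqint_insert n k)//; last first.
  by apply: seqmeas_perm => //=; rewrite ss.
rewrite seqint_cons//; apply: eq_integral => x _ /=.
pose s' := [seq unbump k i | i <- s].
have ps' : perm_eq s' (iota 0 n).
  have us' : uniq s'.
    rewrite map_inj_in_uniq; first by case/andP : us.
    move=> i j si sj; case/andP : us => ks _.
    have ik : k != i by apply: contraNneq ks => ->.
    have jk : k != j by apply: contraNneq ks => ->.
    by rewrite /unbump; lia.
  apply: uniq_perm => //; first exact: iota_uniq.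
  apply: (uniq_min_size us' _ _).2; last by rewrite size_map size_iota ss.
  move=> _ /mapP[i si ->]; rewrite mem_iota/= add0n.
  have := ls i; rewrite inE si orbT => /(_ isT) iln.
  case/andP : us => ks _; have ik : k != i by apply: contraNneq ks => ->.
  by rewrite /unbump; lia.
rewrite -(IH (fun v => F (x :: v)) s')//; last exact: seqmeas_cons.
apply: eq_integral => w _; congr F; rewrite nth_insert ?size_tuple// ltnn eqxx.
congr cons; rewrite -map_comp; apply/eq_in_map => i si /=.
case/andP : us => ks _; have ik : k != i by apply: contraNneq ks => ->.
rewrite nth_insert ?size_tuple//; case: ltnP => [ik'|ki].
  by congr nth; rewrite /unbump; lia.
by rewrite eq_sym (negbTE ik); congr nth; rewrite /unbump; lia.
Qed.

Lemma seqmeas_seqint m n F : seqmeas (m + n) F -> (forall v, 0 <= F v) ->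
  seqmeas m (fun s => seqint n (fun t => F (s ++ t))).
Proof.
move=> mF F0 d T f sf mf.
apply: (@measurable_seqint n _ _ (fun t => fun s => F (f t ++ s))) => //.
apply: mF => [z|i]; first by rewrite size_cat sf size_tuple.
under eq_fun do rewrite nth_cat sf.
case: ltnP => _; first exact: measurableT_comp (mf i) measurable_fst.
exact: (measurableT_comp (@measurable_nth_tuple n (i - m)) measurable_snd).
Qed.

Lemma seqint_cat m n F : seqmeas (m + n) F -> (forall v, 0 <= F v) ->
  seqint (m + n) F = seqint m (fun s => seqint n (fun t => F (s ++ t))).
Proof.
elim: m F => [|m IH] F mF F0.
  by rewrite seqint0//; exact: seqmeas_seqint.
rewrite addSn seqint_cons// [RHS]seqint_cons//; last 2 first.
- exact: seqmeas_seqint.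
- by move=> s; exact: seqint_ge0.
apply: eq_integral => x _; rewrite IH//.
exact: seqmeas_cons.
Qed.

End sequences_integral.

(** * Lebesgue measure on symmetric matrices *)

(** The position of entry (i, j) in the packed form read by [sym_mx]. *)
Definition pack (i j : nat) := ('C((maxn i j).+1, 2) + minn i j)%N.

Lemma packC i j : pack i j = pack j i.
Proof. by rewrite /pack maxnC minnC. Qed.

Lemma packE i j : (i <= j)%N -> pack i j = ('C(j.+1, 2) + i)%N.
Proof. by move=> ij; rewrite /pack (maxn_idPr ij) (minn_idPl ij). Qed.

Lemma pack_lt i j p : (i < p)%N -> (j < p)%N -> (pack i j < 'C(p.+1, 2))%N.
Proof.
wlog ij : i j / (i <= j)%N => [h ip jp|ip jp].
  by case/orP: (leq_total i j) => ij; [|rewrite packC]; exact: h.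
rewrite packE//; apply: (@leq_trans 'C(j.+2, 2)).
  by rewrite [X in (_ < X)%N]binS bin1; lia.
by apply: leq_bin2l; lia.
Qed.

Lemma pack_inj i j k l : (i <= j)%N -> (k <= l)%N -> pack i j = pack k l ->
  i = k /\ j = l.
Proof.
wlog jl : i j k l / (j <= l)%N => [h ij kl e|ij kl].
  case/orP: (leq_total j l) => jl; first exact: h.
  by have [] := h _ _ _ _ jl kl ij (esym e).
rewrite !packE//; have [->|ne] := eqVneq j l; first by lia.
have : ('C(j.+2, 2) <= 'C(l.+1, 2))%N by apply: leq_bin2l; lia.
by rewrite binS bin1; lia.
Qed.

Lemma pack_surj p k : (k < 'C(p.+1, 2))%N ->
  exists ij : 'I_p * 'I_p, (ij.1 <= ij.2)%N /\ pack ij.1 ij.2 = k.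
Proof.
elim: p => [|p IH]; first by rewrite bin_small.
rewrite binS bin1 => kp; have [/IH[[i j] /= [ij e]]|h] := ltnP k 'C(p.+1, 2).
  by exists (widen_ord (leqnSn p) i, widen_ord (leqnSn p) j).
have h' : (k - 'C(p.+1, 2) < p.+1)%N by lia.
exists (Ordinal h', ord_max) => /=; split; first by lia.
by rewrite packE; lia.
Qed.

Section symmetric_integral.
Context {R : realType}.
Local Notation mu := (@lebesgue_measure R).

(** Matrices are handled entrywise, so that a function of a matrix is Borel when
its composition with every entrywise measurable family is measurable. *)
Definition mxmeas d (T : measurableType d) m n (f : T -> 'M[R]_(m, n)) :=
  forall i j, measurable_fun setT (fun t => f t i j).

Definition borel m n (F : 'M[R]_(m, n) -> \bar R) :=
  forall d (T : measurableType d) (f : T -> 'M[R]_(m, n)),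
  mxmeas f -> measurable_fun setT (fun t => F (f t)).

Definition rvint n (F : 'rV[R]_n -> \bar R) : \bar R :=
  seqint n (fun s => F (\row_i nth 0 s i)).

Definition sint p (F : 'M[R]_p -> \bar R) : \bar R :=
  (\int[leb 'C(p.+1, 2)]_v F (sym_mx v))%E.

(** A symmetric matrix read from a sequence through any position function q; the
packed form is q = [pack], and other choices describe relabelled or
block-decomposed matrices. *)
Definition unpacked p (q : 'I_p -> 'I_p -> nat) (s : seq R) : 'M[R]_p :=
  \matrix_(i, j) nth 0 s (q i j).

Lemma sintE p F : sint F =
  seqint 'C(p.+1, 2) (fun s => F (unpacked (fun i j : 'I_p => pack i j) s)).
Proof. by []. Qed.

Lemma seqmeas_unpacked p N (q : 'I_p -> 'I_p -> nat) F : borel F ->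
  seqmeas N (fun s => F (unpacked q s)).
Proof. by move=> bF d T f sf mf; apply: bF => i j; under eq_fun do rewrite mxE; exact: mf. Qed.

(** Any position function that is a bijection on the pairs i <= j gives the same
integral, because it differs from [pack] by a permutation of the
coordinates. *)
Lemma seqint_unpacked p (q : 'I_p -> 'I_p -> nat) F : borel F ->
  (forall M, 0 <= F M)%E ->
  (forall i j, q i j = q j i) ->
  (forall i j : 'I_p, q i j < 'C(p.+1, 2))%N ->
  (forall i j k l : 'I_p, (i <= j)%N -> (k <= l)%N -> q i j = q k l -> (i, j) = (k, l)) ->
  seqint 'C(p.+1, 2) (fun s => F (unpacked q s)) = sint F.
Proof.
move=> bF F0 qC ql qI; rewrite sintE.
have /choice[u uP] : forall k : 'I_('C(p.+1, 2)), exists ij : 'I_p * 'I_p,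
    (ij.1 <= ij.2)%N /\ pack ij.1 ij.2 = k by move=> k; exact: pack_surj.
(* The permutation: the k-th packed coordinate holds the pair u k, which q reads
   at position q (u k).1 (u k).2. *)
pose s := [seq q (u k).1 (u k).2 | k <- enum 'I_('C(p.+1, 2))].
have us : uniq s.
  rewrite map_inj_uniq ?enum_uniq// => k l /qI.
  have [uk ek] := uP k; have [ul el] := uP l => /(_ uk ul)[e1 e2].
  by apply/val_inj; rewrite /= -ek -el e1 e2.
have ss : size s = 'C(p.+1, 2) by rewrite size_map size_enum_ord.
rewrite -[RHS](@seqint_perm _ _ _ s).
- apply: eq_integral => v _; congr F; apply/matrixP => i j; rewrite !mxE.
  have kl : (pack i j < 'C(p.+1, 2))%N by exact: pack_lt.
  rewrite (nth_map 0%N) ?ss// (nth_map (Ordinal kl)) ?size_enum_ord//.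
  rewrite (_ : nth _ _ _ = Ordinal kl); last first.
    exact/val_inj/nth_enum_ord.
  have [h] := uP (Ordinal kl); rewrite /=.
  move: (u (Ordinal kl)) h => [k l] /= h.
  have [ij|/ltnW ji] := leqP i j.
    by move=> /pack_inj-/(_ h ij)[/val_inj -> /val_inj ->].
  by rewrite (packC i) => /pack_inj-/(_ h ji)[/val_inj -> /val_inj ->]; rewrite qC.
- exact: seqmeas_unpacked.
- by [].
apply: uniq_perm => //; first exact: iota_uniq.
apply: (uniq_min_size us _ _).2; last by rewrite size_iota ss.
by move=> _ /mapP[k _ ->]; rewrite mem_iota/= add0n.
Qed.

Lemma sint_perm p (s : 'S_p) F : borel F -> (forall M, 0 <= F M)%E ->
  sint F = sint (fun M => F (\matrix_(i, j) M (s i) (s j))).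
Proof.
move=> bF F0.
rewrite -(@seqint_unpacked _ (fun i j => pack (s i) (s j))).
- rewrite sintE; apply: eq_integral => v _; congr F.
  by apply/matrixP => i j; rewrite !mxE.
- exact: bF.
- exact: F0.
- by move=> i j; rewrite packC.
- by move=> i j; exact: pack_lt.
move=> i j k l ij kl.
have inj x y : s x = s y -> x = y by exact: perm_inj.
have [ij'|/ltnW ij'] := leqP (s i) (s j);
have [kl'|/ltnW kl'] := leqP (s k) (s l).
- by move=> /pack_inj-/(_ ij' kl')[/val_inj/inj -> /val_inj/inj ->].
- rewrite [RHS]packC => /pack_inj-/(_ ij' kl')[/val_inj/inj ? /val_inj/inj ?]; subst.
  by have -> : k = l by apply/val_inj/eqP; rewrite eqn_leq ij kl.
- rewrite [LHS]packC => /pack_inj-/(_ ij' kl')[/val_inj/inj ? /val_inj/inj ?]; subst.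
  by have -> : k = l by apply/val_inj/eqP; rewrite eqn_leq ij kl.
- rewrite [LHS]packC [RHS]packC.
  by move=> /pack_inj-/(_ ij' kl')[/val_inj/inj -> /val_inj/inj ->].
Qed.

Definition bmx p (d : R) (c : 'rV[R]_p) (M : 'M[R]_p) : 'M[R]_(1 + p) :=
  block_mx d%:M c c^T M.

(** Tonelli for the corner d, the rest c of the first row and the lower right
block M. *)
Lemma sint_block p (F : 'M[R]_(1 + p) -> \bar R) : borel F ->
  (forall M, 0 <= F M)%E ->
  sint F = (\int[mu]_d rvint (fun c => sint (fun M => F (bmx d c M))))%E.
Proof.
move=> bF F0.
(* Positions when d comes first, then c, then M in packed form. *)
pose q (i j : 'I_(1 + p)) := match fintype.split i, fintype.split j with
  | inl _, inl _ => 0%N | inl _, inr j => j.+1 | inr i, inl _ => i.+1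
  | inr i, inr j => ((1 + p) + pack i j)%N end.
have NE : 'C(p.+2, 2) = ((1 + p) + 'C(p.+1, 2))%N by rewrite binS bin1 addnC.
rewrite -(@seqint_unpacked _ q)//.
- rewrite NE seqint_cat//; last by apply: seqmeas_unpacked.
  rewrite (@seqint_cons _ p); last 2 first.
  + apply: (@seqmeas_seqint _ (1 + p) 'C(p.+1, 2) (fun s => F (unpacked q s))).
      exact: seqmeas_unpacked.
    by move=> v.
  + by move=> v; exact: seqint_ge0.
  apply: eq_integral => d _; apply: eq_integral => c _; rewrite sintE.
  apply: eq_integral => v _; congr F; apply/matrixP => i j.
  rewrite mxE /q; case: (fintype.splitP i) => i' ei; case: (fintype.splitP j) => j' ej.
  + rewrite (_ : i = lshift p i'); last exact/val_inj.
    rewrite (_ : j = lshift p j'); last exact/val_inj.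
    by rewrite block_mxEul !mxE !ord1 eqxx.
  + rewrite (_ : i = lshift p i'); last exact/val_inj.
    rewrite (_ : j = rshift 1 j'); last exact/val_inj.
    by rewrite block_mxEur !mxE /= nth_cat size_tuple ltn_ord.
  + rewrite (_ : i = rshift 1 i'); last exact/val_inj.
    rewrite (_ : j = lshift p j'); last exact/val_inj.
    by rewrite block_mxEdl !mxE /= nth_cat size_tuple ltn_ord.
  + rewrite (_ : i = rshift 1 i'); last exact/val_inj.
    rewrite (_ : j = rshift 1 j'); last exact/val_inj.
    rewrite block_mxEdr !mxE /= nth_cat size_tuple.
    by rewrite ltnNge leq_addr/= addKn.
- by move=> i j; rewrite /q; case: fintype.split => i'; case: fintype.split => j' //; rewrite packC.
- move=> i j; rewrite /q NE; case: fintype.split => i'; case: fintype.split => j';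
    move: (ltn_ord i') (ltn_ord j') => li lj; try lia.
  by have := pack_lt li lj; lia.
have sl (x : 'I_(1 + p)) y : fintype.split x = inl y -> x = 0%N :> nat.
  by case: fintype.splitP => // z -> _; rewrite (ord1 z).
have sr (x : 'I_(1 + p)) y : fintype.split x = inr y -> x = y.+1 :> nat.
  by case: fintype.splitP => // z -> [->].
move=> i j k l ij kl.
suff h : q i j = q k l -> i = k :> nat /\ j = l :> nat.
  by move=> /h[/val_inj -> /val_inj ->].
move: ij kl; rewrite /q.
case ei : (fintype.split i) => [i'|i']; case ej : (fintype.split j) => [j'|j'];
case ek : (fintype.split k) => [k'|k']; case el : (fintype.split l) => [l'|l'];
  move: ei ej ek el; do 4 (first [move=> /sl + | move=> /sr +]; move=> ->);
  move: (ltn_ord i') (ltn_ord j') (ltn_ord k') (ltn_ord l')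
    => li lj lk ll ij kl e; try (by clear -li lj lk ll e ij kl; lia).
have e' : pack i' j' = pack k' l' by clear -e; lia.
by have [-> ->] := @pack_inj i' j' k' l' ij kl e'.
Qed.
End symmetric_integral.

(** * Measurability of matrix operations and matrix integrals *)

Section real_measurability.
Context {R : realType}.

(** The inverse is not continuous at 0; x^-1 = x exp(- ln (x^2)) is an identity of
total functions, also at x = 0. *)
Lemma measurable_funV d (T : measurableType d) (f : T -> R) :
  measurable_fun setT f -> measurable_fun setT (fun t => (f t)^-1).
Proof.
move=> mf; rewrite (_ : (fun _ => _) = fun t => f t * expR (- ln (f t ^+ 2))).
  apply: measurable_funM => //; apply: measurableT_comp => //.
  apply: measurableT_comp => //; apply: measurableT_comp => //.
  exact: measurable_funX.
apply/funext => t; have [->|ft] := eqVneq (f t) 0; first by rewrite invr0 mul0r.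
rewrite expRN lnK ?posrE; last by rewrite exprn_even_gt0.
by field.
Qed.

Lemma measurable_fun_sqrt d (T : measurableType d) (f : T -> R) :
  measurable_fun setT f -> measurable_fun setT (fun t => Num.sqrt (f t)).
Proof.
move=> mf.
exact: measurableT_comp (continuous_measurable_fun (@sqrt_continuous R)) mf.
Qed.

End real_measurability.

Section mxmeas.
Context {R : realType} d (T : measurableType d).

Lemma mxmeas_cst m n (A : 'M[R]_(m, n)) : mxmeas (fun _ : T => A).
Proof. by move=> i j; exact: measurable_cst. Qed.

Lemma mxmeas_mul m n p (f : T -> 'M[R]_(m, n)) (g : T -> 'M[R]_(n, p)) :
  mxmeas f -> mxmeas g -> mxmeas (fun t => f t *m g t).
Proof.
move=> mf mg i j; under eq_fun do rewrite mxE.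
by apply: measurable_sum => k; apply: measurable_funM; [exact: mf|exact: mg].
Qed.

Lemma mxmeasD m n (f g : T -> 'M[R]_(m, n)) :
  mxmeas f -> mxmeas g -> mxmeas (fun t => f t + g t).
Proof.
move=> mf mg i j; under eq_fun do rewrite mxE.
by apply: measurable_funD; [exact: mf|exact: mg].
Qed.

Lemma mxmeasN m n (f : T -> 'M[R]_(m, n)) : mxmeas f -> mxmeas (fun t => - f t).
Proof.
move=> mf i j; under eq_fun do rewrite mxE.
by apply: measurableT_comp => //; exact: mf.
Qed.

Lemma mxmeasZ m n (a : T -> R) (f : T -> 'M[R]_(m, n)) :
  measurable_fun setT a -> mxmeas f -> mxmeas (fun t => a t *: f t).
Proof.
move=> ma mf i j; under eq_fun do rewrite mxE.
by apply: measurable_funM => //; exact: mf.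
Qed.

Lemma mxmeas_tr m n (f : T -> 'M[R]_(m, n)) : mxmeas f -> mxmeas (fun t => (f t)^T).
Proof. by move=> mf i j; under eq_fun do rewrite mxE; exact: mf. Qed.

Lemma mxmeas_row_mx m n1 n2 (f : T -> 'M[R]_(m, n1)) (g : T -> 'M[R]_(m, n2)) :
  mxmeas f -> mxmeas g -> mxmeas (fun t => row_mx (f t) (g t)).
Proof.
move=> mf mg i j; under eq_fun do rewrite mxE.
by case: fintype.split => k; [exact: mf|exact: mg].
Qed.

Lemma mxmeas_col_mx m1 m2 n (f : T -> 'M[R]_(m1, n)) (g : T -> 'M[R]_(m2, n)) :
  mxmeas f -> mxmeas g -> mxmeas (fun t => col_mx (f t) (g t)).
Proof.
move=> mf mg i j; under eq_fun do rewrite mxE.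
by case: fintype.split => k; [exact: mf|exact: mg].
Qed.

Lemma mxmeas_scalar n (a : T -> R) :
  measurable_fun setT a -> mxmeas (fun t => (a t)%:M : 'M[R]_n).
Proof.
move=> ma i j; under eq_fun do rewrite mxE.
by case: (i == j); [exact: ma|exact: measurable_cst].
Qed.

Lemma mxmeas_bmx p (a : T -> R) (c : T -> 'rV[R]_p) (M : T -> 'M[R]_p) :
  measurable_fun setT a -> mxmeas c -> mxmeas M ->
  mxmeas (fun t => bmx (a t) (c t) (M t)).
Proof.
move=> ma mc mM; apply: mxmeas_col_mx; apply: mxmeas_row_mx => //.
- exact: mxmeas_scalar.
- exact: mxmeas_tr.
Qed.

Lemma measurable_det n (f : T -> 'M[R]_n) : mxmeas f ->
  measurable_fun setT (fun t => \det (f t)).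
Proof.
move=> mf; apply: measurable_sum => s; apply: measurable_funM => //.
by apply: measurable_prod => i _; exact: mf.
Qed.

Lemma measurable_tr n (f : T -> 'M[R]_n) : mxmeas f ->
  measurable_fun setT (fun t => \tr (f t)).
Proof. by move=> mf; apply: measurable_sum => i; exact: mf. Qed.

Lemma mxmeas_inv n (f : T -> 'M[R]_n) : mxmeas f -> mxmeas (fun t => invmx (f t)).
Proof.
move=> mf i j.
rewrite (_ : (fun _ => _) = fun t => if \det (f t) == 0 then f t i j
    else (\det (f t))^-1 * cofactor (f t) j i); last first.
  apply/funext => t; rewrite /invmx unitmxE unitfE.
  by case: eqP => //= _; rewrite !mxE.
have md := measurable_det mf.
apply: measurable_fun_ifT; [exact: measurable_fun_eqr|exact: mf|].
apply: measurable_funM; first exact: measurable_funV.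
apply: measurable_funM; first exact: measurable_cst.
by apply: measurable_det => k l; under eq_fun do rewrite !mxE; exact: mf.
Qed.
End mxmeas.

Section borel.
Context {R : realType}.
Local Notation mu := (@lebesgue_measure R).
Local Open Scope ereal_scope.

(** The form of Tonelli measurability that is stable under taking an inner matrix
integral: the parameter and the matrix may both vary with a third point. *)
Definition jborel d (T : measurableType d) m n
    (F : T -> 'M[R]_(m, n) -> \bar R) :=
  forall d' (T' : measurableType d') (g : T' -> T) (f : T' -> 'M[R]_(m, n)),
  measurable_fun setT g -> mxmeas f -> measurable_fun setT (fun t => F (g t) (f t)).

Lemma jborel_borel d (T : measurableType d) m n (F : T -> 'M[R]_(m, n) -> \bar R) t :
  jborel F -> borel (F t).
Proof. by move=> bF d' T' f mf; exact: bF. Qed.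

Lemma measurable_sint d (T : measurableType d) p (F : T -> 'M[R]_p -> \bar R) :
  jborel F -> (forall t M, 0 <= F t M) ->
  measurable_fun setT (fun t => sint (F t)).
Proof.
move=> bF F0.
apply: (@measurable_seqint _ _ _ _ (fun t s => F t (unpacked (fun i j : 'I_p => pack i j) s))).
  apply: bF => [//|i j]; under eq_fun do rewrite mxE.
  exact: measurableT_comp (measurable_nth_tuple _) measurable_snd.
by move=> z s.
Qed.

Lemma measurable_rvint d (T : measurableType d) n (F : T -> 'rV[R]_n -> \bar R) :
  jborel F -> (forall t M, 0 <= F t M) ->
  measurable_fun setT (fun t => rvint (F t)).
Proof.
move=> bF F0.
apply: (@measurable_seqint _ _ _ _ (fun t s => F t (\row_i nth 0%R s i))).
  apply: bF => [//|i j]; under eq_fun do rewrite mxE.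
  exact: measurableT_comp (measurable_nth_tuple _) measurable_snd.
by move=> z s.
Qed.

Lemma sint_ge0 p (F : 'M[R]_p -> \bar R) : (forall M, 0 <= F M) -> 0 <= sint F.
Proof. by move=> F0; apply: integral_ge0. Qed.

Lemma rvint_ge0 n (F : 'rV[R]_n -> \bar R) : (forall M, 0 <= F M) -> 0 <= rvint F.
Proof. by move=> F0; apply: integral_ge0. Qed.

Lemma eq_sint p (F G : 'M[R]_p -> \bar R) : (forall M, M^T%R = M -> F M = G M) ->
  sint F = sint G.
Proof. by move=> FG; apply: eq_integral => v _; apply: FG; exact: tr_sym_mx. Qed.

Lemma eq_rvint n (F G : 'rV[R]_n -> \bar R) : F =1 G -> rvint F = rvint G.
Proof. by move=> FG; apply: eq_integral => v _; exact: FG. Qed.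

Lemma sintZ p (k : \bar R) (F : 'M[R]_p -> \bar R) : borel F ->
  (forall M, 0 <= F M) -> 0 <= k -> sint (fun M => k * F M) = k * sint F.
Proof.
move=> bF F0 k0; apply: ge0_integralZl => //.
exact: (@seqmeas_tuple _ _ (fun s => F (unpacked (fun i j : 'I_p => pack i j) s))
  (@seqmeas_unpacked _ _ _ _ _ bF)).
Qed.

Lemma seqmeas_row n (F : 'rV[R]_n -> \bar R) : borel F ->
  seqmeas n (fun s => F (\row_i nth 0%R s i)).
Proof.
by move=> bF d T f sf mf; apply: bF => i j; under eq_fun do rewrite mxE; exact: mf.
Qed.

Lemma rvintZ n (k : \bar R) (F : 'rV[R]_n -> \bar R) : borel F ->
  (forall M, 0 <= F M) -> 0 <= k -> rvint (fun M => k * F M) = k * rvint F.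
Proof.
move=> bF F0 k0; apply: ge0_integralZl => //.
exact: (@seqmeas_tuple _ _ (fun s => F (\row_i nth 0%R s i)) (seqmeas_row bF)).
Qed.

Lemma sint0 (F : 'M[R]_0 -> \bar R) : borel F -> sint F = F 0%R.
Proof.
move=> bF; rewrite sintE seqint0; last exact: seqmeas_unpacked.
by congr F; apply/matrixP => -[].
Qed.

Lemma rvint0 (F : 'rV[R]_0 -> \bar R) : borel F -> rvint F = F 0%R.
Proof.
move=> bF; rewrite /rvint seqint0; last exact: seqmeas_row.
by congr F; apply/matrixP => i [].
Qed.

Lemma rvint_cons n (F : 'rV[R]_(1 + n) -> \bar R) : borel F ->
  (forall M, 0 <= F M) ->
  rvint F = \int[mu]_x rvint (fun c => F (row_mx x%:M c)).
Proof.
move=> bF F0; rewrite /rvint (@seqint_cons _ n _ (seqmeas_row bF)); last by move=> v; exact: F0.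
apply: eq_integral => x _; apply: eq_integral => v _; congr F.
apply/matrixP => i j; rewrite !mxE; case: fintype.splitP => k ek.
  by rewrite !mxE ek !ord1.
by rewrite !mxE ek.
Qed.

Lemma rvint_swap d (T : measurableType d) (m : {sigma_finite_measure set T -> \bar R}) n
    (F : T -> 'rV[R]_n -> \bar R) :
  jborel F -> (forall t M, 0 <= F t M) ->
  \int[m]_x rvint (F x) = rvint (fun c => \int[m]_x F x c).
Proof.
move=> bF F0.
apply: (@fubini_tonelli _ _ _ _ R m (leb n)
  (fun z => F z.1 (\row_i nth 0%R z.2 i))) => //.
apply: bF => // i j; under eq_fun do rewrite mxE.
exact: measurableT_comp (measurable_nth_tuple _) measurable_snd.
Qed.

Lemma borel_shift m n (F : 'M[R]_(m, n) -> \bar R) c : borel F ->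
  borel (fun M => F (M + c)%R).
Proof.
by move=> bF d T f mf; apply: bF; apply: mxmeasD => //; exact: mxmeas_cst.
Qed.

Lemma rvint_shift n (F : 'rV[R]_n -> \bar R) c0 : borel F ->
  (forall M, 0 <= F M) -> rvint F = rvint (fun c => F (c + c0)%R).
Proof.
elim: n F c0 => [|n IH] F c0 bF F0.
  by rewrite !rvint0//; [congr F; apply/matrixP => i []|exact: borel_shift].
have jF : jborel (fun (x : R) c => F (row_mx x%:M c : 'rV_(1 + n))).
  move=> d T g f mg mf; apply: bF; apply: (@mxmeas_row_mx _ _ _ 1 1 n) => //.
  exact: mxmeas_scalar.
rewrite (rvint_cons bF F0) (rvint_cons (borel_shift c0 bF)); last by move=> M; exact: F0.
rewrite (ge0_integral_shift (c0 ord0 ord0)).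
- apply: eq_integral => x _; rewrite (IH _ (rsubmx (c0 : 'rV_(1 + n)))).
  + apply: eq_rvint => c; congr F; apply/matrixP => i j; rewrite !mxE.
    case: fintype.splitP => k ek.
      by rewrite !mxE !ord1/= (_ : j = 0%R)//; apply/val_inj; rewrite /= ek ord1.
    by rewrite !mxE !ord1/=; congr (_ + c0 _ _)%R; apply/val_inj.
  + exact: (jborel_borel (x + c0 ord0 ord0)%R jF).
  + by [].
- exact: measurable_rvint.
- by move=> x; exact: rvint_ge0.
Qed.

(** Translation invariance on symmetric matrices, by peeling off the first row
and translating d, c and M separately. *)
Lemma sint_shift p (F : 'M[R]_p -> \bar R) S : S^T%R = S -> borel F ->
  (forall M, 0 <= F M) -> sint F = sint (fun M => F (M + S)%R).
Proof.
elim: p F S => [|p IH] F S trS bF F0.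
  rewrite (sint0 bF) (sint0 (borel_shift S bF)).
  by congr F; apply/matrixP => -[].
pose S' := (S : 'M[R]_(1 + p)).
have SE : S' = bmx (S' (lshift p ord0) (lshift p ord0)) (ursubmx S') (drsubmx S').
  rewrite -[LHS]submxK /bmx [ulsubmx _]mx11_scalar; congr block_mx.
    by rewrite !mxE; congr (S' _ _)%:M; apply/val_inj.
  by rewrite trmx_ursub [S'^T%R]trS.
have addE d c M : (bmx d c M + S' = bmx (d + S' (lshift p ord0) (lshift p ord0)) (c + ursubmx S') (M + drsubmx S'))%R.
  by rewrite {1}SE /bmx add_block_mx; congr block_mx; rewrite raddfD.
rewrite (sint_block bF F0) (sint_block (borel_shift S bF)); last by move=> M; exact: F0.
rewrite (ge0_integral_shift (S' (lshift p ord0) (lshift p ord0))); last 2 first.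
- apply: measurable_rvint => [d T g f mg mf|t M]; last exact: sint_ge0.
  apply: (@measurable_sint _ _ _ (fun t M => F (bmx (g t) (f t) M))) => //.
  move=> d' T' g' f' mg' mf'; apply: bF; apply: mxmeas_bmx => //.
    exact: measurableT_comp.
  by move=> i j; exact: (measurableT_comp (mf i j)).
- by move=> x; apply: rvint_ge0 => c; exact: sint_ge0.
apply: eq_integral => d _; rewrite (rvint_shift (ursubmx S')); last 2 first.
- move=> d' T g mg.
  apply: (@measurable_sint _ _ _ (fun t M => F (bmx (d + S' (lshift p ord0) (lshift p ord0))%R (g t) M))) => //.
  move=> d'' T' g' f' mg' mf'; apply: bF; apply: mxmeas_bmx => //.
  by move=> i j; exact: (measurableT_comp (mg i j)).
- by move=> c; exact: sint_ge0.
apply: eq_rvint => c; rewrite (IH _ (drsubmx S')); last 3 first.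
- by rewrite trmx_drsub trS.
- move=> d' T f mf; apply: bF; apply: mxmeas_bmx => //; exact: mxmeas_cst.
- by [].
by apply: eq_integral => v _; rewrite -addE.
Qed.
End borel.

(** * Quadratic forms and Schur complements *)

Section schur.
Context {R : realType}.

Definition qform p (A : 'M[R]_p) (u : 'rV[R]_p) : R := (u *m A *m u^T) 0 0.

Lemma posdefmxP p (A : 'M[R]_p) : posdefmx A <->
  A^T = A /\ forall u : 'rV[R]_p, u != 0 -> 0 < qform A u.
Proof.
split=> -[trA pA]; split=> // u u0.
  by have := pA u^T; rewrite trmx_eq0 trmxK; exact.
by have := pA u^T; rewrite trmx_eq0 /qform trmxK; exact.
Qed.

Lemma mx11D (A B : 'M[R]_1) : (A + B) 0 0 = A 0 0 + B 0 0.
Proof. by rewrite mxE. Qed.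

Lemma mx11Z k (A : 'M[R]_1) : (k *: A) 0 0 = k * A 0 0.
Proof. by rewrite mxE. Qed.

Lemma mx11_trmul p (u v : 'rV[R]_p) : (u *m v^T) 0 0 = (v *m u^T) 0 0.
Proof. by rewrite -[in LHS](trmxK u) -trmx_mul mxE. Qed.

Lemma qform_bmx p (d : R) (c : 'rV[R]_p) M x (w : 'rV[R]_p) :
  qform (bmx d c M) (row_mx x%:M w) =
  d * x ^+ 2 + 2 * x * (w *m c^T) 0 0 + qform M w.
Proof.
rewrite /qform /bmx mul_row_block tr_row_mx mul_row_col !mulmxDl !mul_scalar_mx.
rewrite tr_scalar_mx !mul_mx_scalar -!scalemxAl.
rewrite !(mx11D, mx11Z) (mx11_trmul c w) (_ : d%:M 0 0 = d); last by rewrite mxE eqxx.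
ring.
Qed.

Lemma qform_sqr p (c w : 'rV[R]_p) : qform (c^T *m c) w = ((w *m c^T) 0 0) ^+ 2.
Proof.
rewrite /qform !mulmxA -mulmxA [LHS]mxE big_ord1 expr2; congr (_ * _).
exact: mx11_trmul.
Qed.

Lemma qformD p (A B : 'M[R]_p) w : qform (A + B) w = qform A w + qform B w.
Proof. by rewrite /qform mulmxDr mulmxDl mxE. Qed.

Lemma qformZ p k (A : 'M[R]_p) w : qform (k *: A) w = k * qform A w.
Proof. by rewrite /qform -scalemxAr -scalemxAl mxE. Qed.

(** The symmetric matrix with first row (d, c) and Schur complement M. *)
Definition schurmx p (d : R) (c : 'rV[R]_p) (M : 'M[R]_p) : 'M[R]_(1 + p) :=
  bmx d c (M + d^-1 *: (c^T *m c)).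

(** Completing the square in the first coordinate. *)
Lemma qform_schur p (d : R) (c : 'rV[R]_p) M x (w : 'rV[R]_p) : d != 0 ->
  qform (schurmx d c M) (row_mx x%:M w) =
  d * (x + d^-1 * (w *m c^T) 0 0) ^+ 2 + qform M w.
Proof. by move=> d0; rewrite qform_bmx qformD qformZ qform_sqr; field. Qed.

Lemma row_mx1E p (u : 'rV[R]_(1 + p)) : u = row_mx (u 0 (lshift p 0))%:M (rsubmx u).
Proof.
rewrite -[LHS]hsubmxK; congr row_mx; rewrite [LHS]mx11_scalar; congr (_%:M).
by rewrite !mxE.
Qed.

Lemma bmx_sym p (d : R) (c : 'rV[R]_p) M : (bmx d c M)^T = bmx d c M -> M^T = M.
Proof.
by rewrite /bmx tr_block_mx trmxK tr_scalar_mx => /eq_block_mx[].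
Qed.

Lemma tr_bmx p (d : R) (c : 'rV[R]_p) M : (bmx d c M)^T = bmx d c M^T.
Proof. by rewrite /bmx tr_block_mx trmxK tr_scalar_mx. Qed.

Lemma posdef_bmx_gt0 p (d : R) (c : 'rV[R]_p) M : posdefmx (bmx d c M) -> 0 < d.
Proof.
move=> /posdefmxP[_ /(_ (row_mx 1%:M 0))]; rewrite qform_bmx.
rewrite mul0mx mxE mulr0 addr0 expr1n mulr1 /qform mul0mx mul0mx mxE addr0; apply.
apply/eqP => /(congr1 lsubmx); rewrite row_mxKl => /matrixP/(_ 0 0).
by rewrite !mxE => /eqP; rewrite oner_eq0.
Qed.

Lemma posdef_schur p (d : R) (c : 'rV[R]_p) M :
  posdefmx (schurmx d c M) <-> 0 < d /\ posdefmx M.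
Proof.
split=> [pB|[d0 /posdefmxP[trM pM]]].
  have d0 := posdef_bmx_gt0 pB; split=> //.
  move/posdefmxP : pB => [/bmx_sym trB pB]; apply/posdefmxP; split.
    apply: (addIr (d^-1 *: (c^T *m c))); rewrite -[RHS]trB linearD/=; congr +%R.
    by rewrite linearZ/= trmx_mul trmxK.
  move=> w w0; have := pB (row_mx (- (d^-1 * (w *m c^T) 0 0))%:M w).
  rewrite qform_schur ?gt_eqF// addNr expr0n/= mulr0 add0r; apply.
  by apply: contra w0 => /eqP/(congr1 rsubmx); rewrite row_mxKr linear0 => ->.
apply/posdefmxP; split.
  by rewrite tr_bmx linearD/= trM linearZ/= trmx_mul trmxK.
move=> u u0; rewrite (row_mx1E u) qform_schur ?gt_eqF//.
have [w0|w0] := eqVneq (rsubmx u) 0; last first.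
  by rewrite ltr_wpDl ?pM// mulr_ge0 ?sqr_ge0// ltW.
rewrite w0 mul0mx [in X in _ * X]mxE mulr0 addr0 /qform !mul0mx [in X in _ + X]mxE addr0.
rewrite mulr_gt0// exprn_even_gt0//=; apply: contra u0 => /eqP x0.
by rewrite (row_mx1E u) w0 x0 raddf0 row_mx0.
Qed.

Lemma schurmxK p (d : R) (c : 'rV[R]_p) M :
  bmx d c M = schurmx d c (M - d^-1 *: (c^T *m c)).
Proof. by rewrite /schurmx subrK. Qed.

(** One step of Gaussian elimination, which gives the determinant. *)
Lemma schurmx_mul p (d : R) (c : 'rV[R]_p) M : d != 0 -> schurmx d c M =
  block_mx 1%:M 0 (d^-1 *: c^T) 1%:M *m block_mx d%:M c 0 M.
Proof.
move=> d0; rewrite mulmx_block !mul1mx !mul0mx !addr0.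
rewrite -!scalemxAl mul_mx_scalar scalerA mulVf// scale1r.
by rewrite /schurmx /bmx addrC.
Qed.

Lemma det_schur p (d : R) (c : 'rV[R]_p) M : d != 0 ->
  \det (schurmx d c M) = d * \det M.
Proof.
move=> d0; rewrite schurmx_mul// det_mulmx det_lblock det_ublock !det1 !mul1r.
by rewrite det_scalar1.
Qed.

Lemma invmx_unique n (A B : 'M[R]_n) : A *m B = 1%:M -> invmx A = B.
Proof.
move=> AB; have [uA _] := mulmx1_unit AB.
by rewrite -[LHS]mulmx1 -AB mulmxA mulVmx// mul1mx.
Qed.

Lemma invmx_schur p (d : R) (c : 'rV[R]_p) M : d != 0 -> M \in unitmx ->
  invmx (schurmx d c M) = block_mx
    (d^-1%:M + d^-2 *: (c *m invmx M *m c^T)) (- d^-1 *: (c *m invmx M))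
    (- d^-1 *: (invmx M *m c^T)) (invmx M).
Proof.
move=> d0 uM; apply: invmx_unique; rewrite /schurmx /bmx mulmx_block.
rewrite (_ : 1%:M = block_mx 1%:M 0 0 1%:M); last by rewrite -scalar_mx_block.
congr block_mx.
- rewrite mulmxDr -scalar_mxM divff// -scalemxAr mul_scalar_mx -scalemxAr scalerA.
  rewrite (mulmxA c (invmx M)) -addrA -scalerDl (_ : d ^- 2 * d + - d^-1 = 0) ?scale0r ?addr0//.
  by field.
- by rewrite mul_scalar_mx scalerA mulrN divff// scaleN1r addNr.
- rewrite mulmxDr mul_mx_scalar mulmxDl -!scalemxAr -!scalemxAl !mulmxA mulmxV//.
  rewrite mul1mx addrACA -scalerDl subrr scale0r add0r scalerA -scalerDl.
  by rewrite (_ : _ + _ = 0) ?scale0r//; field.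
- by rewrite mulmxDl mulmxV// -scalemxAr -scalemxAl !mulmxA scaleNr addrCA addNr addr0.
Qed.

Lemma sym_bmx p (A : 'M[R]_(1 + p)) : A^T = A ->
  A = bmx (A (lshift p 0) (lshift p 0)) (ursubmx A) (drsubmx A).
Proof.
move=> trA; rewrite -[LHS]submxK /bmx [ulsubmx _]mx11_scalar; congr block_mx.
  by rewrite !mxE.
by rewrite trmx_ursub trA.
Qed.

(** Induction over positive definite matrices, one Schur complement at a time. *)
Lemma posdef_rect (P : forall p, 'M[R]_p -> Prop) :
  P 0%N 0 ->
  (forall p d (c : 'rV[R]_p) M, 0 < d -> posdefmx M -> P p M ->
    P (1 + p)%N (schurmx d c M)) ->
  forall p (A : 'M[R]_p), posdefmx A -> P p A.
Proof.
move=> P0 Pstep; elim=> [|p IH] A pA.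
  by rewrite (_ : A = 0)//; apply/matrixP => -[].
have trA : (A : 'M[R]_(1 + p))^T = A by case: pA.
move: pA; rewrite (sym_bmx trA) schurmxK => /posdef_schur[d0 pM].
by apply: Pstep => //; exact: IH.
Qed.

Lemma posdef_det_gt0 p (A : 'M[R]_p) : posdefmx A -> 0 < \det A.
Proof.
move: p A; apply: (@posdef_rect (fun p A => 0 < \det A)); first by rewrite det_mx00.
by move=> p d c M d0 pM IH; rewrite det_schur ?gt_eqF// mulr_gt0.
Qed.

Lemma posdef_unit p (A : 'M[R]_p) : posdefmx A -> A \in unitmx.
Proof. by move=> /posdef_det_gt0 dA; rewrite unitmxE unitfE gt_eqF. Qed.

Lemma posdef_inv p (A : 'M[R]_p) : posdefmx A -> posdefmx (invmx A).
Proof.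
move=> pA; have uA := posdef_unit pA; move/posdefmxP : pA => [trA pA].
apply/posdefmxP; split; first by rewrite trmx_inv trA.
move=> u u0; have := pA (u *m invmx A).
rewrite /qform trmx_mul trmx_inv trA mulmxKV// mulmxA; apply.
by apply: contra u0 => /eqP h; rewrite -(mulmxKV uA u) h mul0mx.
Qed.

Lemma posdef_conj p (A B : 'M[R]_p) : B \in unitmx -> posdefmx A ->
  posdefmx (B *m A *m B^T).
Proof.
move=> uB /posdefmxP[trA pA]; apply/posdefmxP; split.
  by rewrite !trmx_mul trmxK trA mulmxA.
move=> u u0; have := pA (u *m B); rewrite /qform trmx_mul !mulmxA; apply.
by apply: contra u0 => /eqP h; rewrite -(mulmxK uB u) h mul0mx.
Qed.

Lemma posdef_drsub p (A : 'M[R]_(1 + p)) : posdefmx A -> posdefmx (drsubmx A).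
Proof.
move=> /posdefmxP[trA pA]; apply/posdefmxP; split; first by rewrite trmx_drsub trA.
move=> w w0; have := pA (row_mx 0 w).
rewrite -{1}[A]submxK /qform mul_row_block !mul0mx !add0r tr_row_mx mul_row_col.
rewrite trmx0 mulmx0 add0r; apply.
by apply: contra w0 => /eqP/(congr1 rsubmx); rewrite row_mxKr linear0 => ->.
Qed.

Lemma posdef_diag_gt0 p (A : 'M[R]_p) i : posdefmx A -> 0 < A i i.
Proof.
move=> /posdefmxP[_ /(_ (delta_mx 0 i))]; rewrite /qform -rowE trmx_delta -colE !mxE.
apply; apply/eqP => /matrixP/(_ 0 i); rewrite !mxE !eqxx => /eqP.
by rewrite oner_eq0.
Qed.

Lemma trace_mulC p (A : 'M[R]_p) (c : 'rV[R]_p) : \tr (A *m (c^T *m c)) = qform A c.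
Proof. by rewrite mulmxA mxtrace_mulC mulmxA trace_mx11. Qed.

(** Since M enters only through the lower right block of A, the exponent of the
Wishart weight splits into a function of (d, c) and a function of M. *)
Lemma trace_schur p (A : 'M[R]_(1 + p)) d (c : 'rV[R]_p) M : A^T = A -> d != 0 ->
  \tr (A *m schurmx d c M) =
  d^-1 * qform A (row_mx d%:M c) + \tr (drsubmx A *m M).
Proof.
move=> trA d0; rewrite {1 2}(sym_bmx trA); set a := A _ _; set al := ursubmx A.
rewrite qform_bmx /schurmx /bmx mulmx_block mxtrace_block mulmxDr.
rewrite -scalemxAr !linearD/= linearZ/= trace_mulC.
rewrite -scalar_mxM mxtrace_scalar (mxtrace_mulC al^T) !trace_mx11.
by rewrite (mx11_trmul al); field.
Qed.

(** By induction on the size: positive definiteness means symmetry, a positive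
corner and a positive definite Schur complement. *)
Lemma measurable_posdef d (T : measurableType d) p (f : T -> 'M[R]_p) :
  mxmeas f -> measurable_fun setT (fun t => `[< posdefmx (f t) >]).
Proof.
elim: p f => [|p IH] f mf.
  rewrite (_ : (fun _ => _) = cst true); first exact: measurable_cst.
  apply/funext => t; apply/asboolP; split=> [|u]; first by apply/matrixP => -[].
  by rewrite (_ : u = 0) ?eqxx//; apply/matrixP => -[].
pose g t := (f t : 'M[R]_(1 + p)).
have mg : @mxmeas _ _ _ (1 + p) (1 + p) g by [].
pose d0 t := g t (lshift p 0) (lshift p 0).
pose s t := drsubmx (g t) - (d0 t)^-1 *: ((ursubmx (g t))^T *m ursubmx (g t)).
have md0 : measurable_fun setT d0 by exact: mg.
have mur : mxmeas (fun t => ursubmx (g t)).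
  by move=> i j; under eq_fun do rewrite !mxE; exact: mg.
have ms : mxmeas s.
  apply: mxmeasD; first by move=> i j; under eq_fun do rewrite !mxE; exact: mg.
  apply: mxmeasN; apply: mxmeasZ; first exact: measurable_funV.
  by apply: mxmeas_mul => //; exact: mxmeas_tr.
pose e t := \sum_i \sum_j (g t i j - g t j i) ^+ 2.
have me : measurable_fun setT (fun t => e t == 0).
  apply: measurable_fun_eqr => //; apply: measurable_sum => i.
  apply: measurable_sum => j; apply: measurable_funX.
  by apply: measurable_funB; exact: mg.
have eP t : e t = 0 <-> (g t)^T = g t.
  split=> [/eqP e0|trg].
    apply/matrixP => i j; move: e0; rewrite psumr_eq0; last first.
      by move=> k _; apply: sumr_ge0 => l _; exact: sqr_ge0.
    move=> /allP/(_ j (mem_index_enum _))/=.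
    rewrite psumr_eq0; last by move=> l _; exact: sqr_ge0.
    move=> /allP/(_ i (mem_index_enum _))/=.
    by rewrite sqrf_eq0 subr_eq0 mxE => /eqP.
  apply: big1 => i _; apply: big1 => j _.
  by rewrite -[in g t j i]trg mxE subrr expr0n.
rewrite (_ : (fun _ => _) = fun t => [&& e t == 0, 0 < d0 t & `[< posdefmx (s t) >]]).
  apply: measurable_and => //; apply: measurable_and; last exact: IH.
  exact: measurable_fun_ltr.
apply/funext => t; apply/asboolP/and3P => [pf|[/eqP/eP trg d00 /asboolP ps]].
  have trg : (g t)^T = g t by case: pf.
  move: (pf); rewrite -[f t]/(g t) (sym_bmx trg) schurmxK => /posdef_schur[d00 ps].
  by split=> //; [apply/eqP/eP|apply/asboolP].
by rewrite -[f t]/(g t) (sym_bmx trg) schurmxK; apply/posdef_schur.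
Qed.

End schur.

(** * Peeling the first row off a Wishart integral *)

Section wishart_integral.
Context {R : realType}.
Local Notation mu := (@lebesgue_measure R).

Definition wdens p (a : R) (A M : 'M[R]_p) : R :=
  if `[< posdefmx M >] then expR (a * ln (\det M) - \tr (A *m M) / 2) else 0.

Definition wint p (a : R) (A : 'M[R]_p) (F : 'M[R]_p -> \bar R) : \bar R :=
  sint (fun M => F M * (wdens a A M)%:E)%E.

(** The factor of the Wishart weight that depends on the first row (d, c). *)
Definition rdens p (a : R) (A : 'M[R]_(1 + p)) (d : R) (c : 'rV[R]_p) : R :=
  if 0 < d then expR (a * ln d - d^-1 * qform A (row_mx d%:M c) / 2) else 0.

Definition rint p (a : R) (A : 'M[R]_(1 + p)) (G : R -> 'rV[R]_p -> \bar R) : \bar R :=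
  (\int[mu]_d rvint (fun c => G d c * (rdens a A d c)%:E))%E.

Lemma wdens_ge0 p a (A M : 'M[R]_p) : 0 <= wdens a A M.
Proof. by rewrite /wdens; case: ifP => // _; exact: expR_ge0. Qed.

Lemma rdens_ge0 p a (A : 'M[R]_(1 + p)) d c : 0 <= rdens a A d c.
Proof. by rewrite /rdens; case: ifP => // _; exact: expR_ge0. Qed.

Lemma measurable_wdens d (T : measurableType d) p a (A : 'M[R]_p) (f : T -> 'M[R]_p) :
  mxmeas f -> measurable_fun setT (fun t => wdens a A (f t)).
Proof.
move=> mf; apply: measurable_fun_ifT; [exact: measurable_posdef| |exact: measurable_cst].
apply: measurableT_comp => //; apply: measurable_funB.
  apply: measurable_funM => //; apply: measurableT_comp => //.
  exact: measurable_det.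
apply: measurable_funM => //; apply: measurable_tr.
by apply: mxmeas_mul => //; exact: mxmeas_cst.
Qed.

Lemma measurable_qform d (T : measurableType d) p (A : 'M[R]_p) (f : T -> 'rV[R]_p) :
  mxmeas f -> measurable_fun setT (fun t => qform A (f t)).
Proof.
move=> mf; apply: (@mxmeas_mul _ _ _ _ _ _ (fun t => f t *m A)).
  by apply: mxmeas_mul => //; exact: mxmeas_cst.
exact: mxmeas_tr.
Qed.

Lemma measurable_rdens d (T : measurableType d) p a (A : 'M[R]_(1 + p))
    (g : T -> R) (f : T -> 'rV[R]_p) : measurable_fun setT g ->
  mxmeas f -> measurable_fun setT (fun t => rdens a A (g t) (f t)).
Proof.
move=> mg mf; apply: measurable_fun_ifT; [exact: measurable_fun_ltr| |exact: measurable_cst].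
apply: measurableT_comp => //; apply: measurable_funB.
  by apply: measurable_funM => //; apply: measurableT_comp.
apply: measurable_funM => //; apply: measurable_funM; first exact: measurable_funV.
by apply: measurable_qform; apply: mxmeas_row_mx => //; exact: mxmeas_scalar.
Qed.

Lemma wdens_schur p a (A : 'M[R]_(1 + p)) d c M : A^T = A ->
  wdens a A (schurmx d c M) = rdens a A d c * wdens a (drsubmx A) M.
Proof.
move=> trA; rewrite /wdens /rdens.
have [d0|d0] := ltP 0 d; last first.
  rewrite mul0r; case: asboolP => // /posdef_schur[d0'].
  by rewrite ltNge d0 in d0'.
have [pM|pM] := pselect (posdefmx M); last first.
  rewrite (asboolF pM) mulr0; case: asboolP => // /posdef_schur[_ pM'].
  by exfalso.
rewrite (asboolT pM) asboolT; last exact/posdef_schur.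
rewrite -expRD det_schur ?gt_eqF// lnM ?posrE// ?posdef_det_gt0//.
rewrite trace_schur ?gt_eqF//; congr expR; ring.
Qed.

Local Open Scope ereal_scope.

Lemma borel_wint p a (A : 'M[R]_p) F : borel F ->
  borel (fun M => F M * (wdens a A M)%:E).
Proof.
move=> bF d T f mf; apply: emeasurable_funM; first exact: bF.
by apply/measurable_EFinP; exact: measurable_wdens.
Qed.

Lemma jborel_rint p a (A : 'M[R]_(1 + p)) (G : R -> 'rV[R]_p -> \bar R) :
  jborel G -> jborel (fun d c => G d c * (rdens a A d c)%:E).
Proof.
move=> bG d T g f mg mf; apply: emeasurable_funM; first exact: bG.
by apply/measurable_EFinP; exact: measurable_rdens.
Qed.

Lemma wint_ge0 p a (A : 'M[R]_p) F : (forall M, 0 <= F M) -> 0 <= wint a A F.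
Proof.
by move=> F0; apply: sint_ge0 => M; rewrite mule_ge0// lee_fin wdens_ge0.
Qed.

Lemma mxmeas_schurmx d (T : measurableType d) p (a : T -> R)
    (c : T -> 'rV[R]_p) (M : T -> 'M[R]_p) :
  measurable_fun setT a -> mxmeas c -> mxmeas M ->
  mxmeas (fun t => schurmx (a t) (c t) (M t)).
Proof.
move=> ma mc mM; apply: mxmeas_bmx => //; apply: mxmeasD => //.
apply: mxmeasZ; first exact: measurable_funV.
by apply: mxmeas_mul => //; exact: mxmeas_tr.
Qed.

(** The Jacobian of M |-> M + c^T c / d is 1 and the weight factors
([wdens_schur]): the first row and the Schur complement are independent, and
the latter is Wishart with the same exponent. *)
Lemma wint_schur p a (A : 'M[R]_(1 + p)) F : A^T%R = A -> borel F ->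
  (forall M, 0 <= F M) ->
  wint a A F = rint a A (fun d c => wint a (drsubmx A) (fun M => F (schurmx d c M))).
Proof.
move=> trA bF F0; rewrite /wint sint_block; last 2 first.
- exact: borel_wint.
- by move=> M; rewrite mule_ge0// lee_fin wdens_ge0.
apply: eq_integral => d _; apply: eq_rvint => c.
have bFc : borel (fun M => F (schurmx d c M)).
  by move=> d' T f mf; apply: bF; apply: mxmeas_schurmx => //; exact: mxmeas_cst.
rewrite (@sint_shift _ _ _ (d^-1 *: (c^T *m c))%R); last 3 first.
- by rewrite linearZ/= trmx_mul trmxK.
- move=> d' T f mf; apply: (borel_wint a A bF).
  by apply: mxmeas_bmx => //; exact: mxmeas_cst.
- by move=> M; rewrite mule_ge0// lee_fin wdens_ge0.
rewrite muleC -sintZ.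
- apply: eq_sint => M _; rewrite -/(schurmx d c M) wdens_schur// EFinM.
  by rewrite muleCA.
- exact: (@borel_wint _ _ _ _ bFc).
- by move=> M; rewrite mule_ge0// lee_fin wdens_ge0.
- by rewrite lee_fin rdens_ge0.
Qed.

Lemma wint_cst p a (A : 'M[R]_p) k : 0 <= k ->
  wint a A (fun=> k) = k * wint a A (fun=> 1).
Proof.
move=> k0; rewrite /wint -sintZ//.
- by apply: eq_sint => M _; rewrite mul1e.
- by apply: borel_wint => d T f mf; exact: measurable_cst.
- by move=> M; rewrite mul1e lee_fin wdens_ge0.
Qed.

Lemma rintZ p a (A : 'M[R]_(1 + p)) G k : jborel G -> (forall d c, 0 <= G d c) ->
  0 <= k -> rint a A (fun d c => G d c * k) = rint a A G * k.
Proof.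
move=> bG G0 k0.
have G0' d c : 0 <= G d c * (rdens a A d c)%:E.
  by rewrite mule_ge0// lee_fin rdens_ge0.
rewrite /rint [RHS]muleC -ge0_integralZl//; last 2 first.
- by apply: measurable_rvint => //; exact: jborel_rint.
- by move=> d _; exact: rvint_ge0.
apply: eq_integral => d _; rewrite -rvintZ//; last first.
  exact: (jborel_borel d (@jborel_rint _ a A _ bG)).
by apply: eq_rvint => c; rewrite -muleA muleCA.
Qed.

(** If F ignores the Schur complement, the inner integral is a constant. *)
Lemma wint_row p a (A : 'M[R]_(1 + p)) (F : 'M[R]_(1 + p) -> \bar R) G :
  A^T%R = A -> borel F -> (forall M, 0 <= F M) ->
  jborel G -> (forall d c, 0 <= G d c) ->
  (forall d c M, F (bmx d c M) = G d c) ->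
  wint a A F = rint a A G * wint a (drsubmx A) (fun=> 1).
Proof.
move=> trA bF F0 bG G0 FG; rewrite (wint_schur a trA bF F0) -(rintZ a A bG G0); last first.
  by apply: wint_ge0 => _; exact: lee01.
apply: eq_integral => d _; apply: eq_rvint => c; congr (_ * _).
rewrite -wint_cst//; congr wint; apply/funext => M; exact: FG.
Qed.

(** The lower right block of the inverse is the inverse of the Schur complement,
so its law is inverse Wishart with the same exponent and the corresponding
block of A. *)
Lemma wint_inv p a (A : 'M[R]_(1 + p)) (H : 'M[R]_p -> \bar R) :
  A^T%R = A -> borel H -> (forall M, 0 <= H M) ->
  wint a A (fun M => H (drsubmx (invmx M))) =
  rint a A (fun _ _ => 1) * wint a (drsubmx A) (fun M => H (invmx M)).
Proof.
move=> trA bH H0; rewrite wint_schur//; last first.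
  move=> d T f mf; apply: bH => i j; under eq_fun do rewrite !mxE.
  exact: mxmeas_inv.
rewrite -(@rintZ _ a A (fun _ _ => 1)); last 3 first.
- by move=> d T f g mf mg; exact: measurable_cst.
- by move=> d c; exact: lee01.
- by apply: wint_ge0 => M; exact: H0.
apply: eq_integral => d _; apply: eq_rvint => c; rewrite mul1e.
rewrite /rdens; case: ifPn => [d0|_]; last by rewrite !mule0.
congr (_ * _); apply: eq_sint => M _; rewrite /wdens.
have [pM|pM] := pselect (posdefmx M); last by rewrite (asboolF pM) !mule0.
by rewrite invmx_schur ?gt_eqF ?posdef_unit// block_mxKdr.
Qed.

End wishart_integral.

(** * Gaussian, exponential and Cauchy integrals *)

Section one_dim.
Context {R : realType}.
Local Notation mu := (@lebesgue_measure R).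

Definition gaussw (x : R) : R := expR (- x ^+ 2 / 2).

Lemma gaussw_ge0 x : 0 <= gaussw x. Proof. exact: expR_ge0. Qed.

Lemma measurable_gaussw : measurable_fun setT gaussw.
Proof.
apply: measurableT_comp => //; apply: measurable_funM => //.
by apply: measurableT_comp => //; exact: measurable_funX.
Qed.

Lemma gaussw_normal x :
  gaussw x = Num.sqrt (2 * pi) * normal_pdf 0 1 x.
Proof.
rewrite normal_pdfE ?oner_eq0// /normal_peak /normal_fun expr1n subr0 mul1r mulrA.
rewrite (_ : pi *+ 2 = 2 * pi); last by rewrite mulr2n; ring.
by rewrite divff ?mul1r// gt_eqF// sqrtr_gt0 mulr_gt0// pi_gt0.
Qed.

Lemma integral_gaussw : (\int[mu]_x (gaussw x)%:E = (Num.sqrt (2 * pi))%:E)%E.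
Proof.
under eq_integral do rewrite gaussw_normal EFinM.
rewrite ge0_integralZl//.
- by rewrite integral_normal_pdf mule1.
- by apply/measurable_EFinP; exact: measurable_normal_pdf.
- by move=> x _; rewrite lee_fin normal_pdf_ge0.
Qed.

Lemma gauss_affine (g b : R) (G : R -> \bar R) : 0 < g ->
  measurable_fun setT G -> (forall x, 0 <= G x)%E ->
  (\int[mu]_x (G x * (expR (- (g * x ^+ 2 + 2 * b * x) / 2))%:E) =
   (Num.sqrt g^-1 * expR (b ^+ 2 / (2 * g)))%:E *
   \int[mu]_z (G (- b / g + Num.sqrt g^-1 * z)%R * (gaussw z)%:E))%E.
Proof.
move=> g0 mG G0.
have mE : measurable_fun setT (fun x : R => expR (- (g * x ^+ 2 + 2 * b * x) / 2)).
  apply: measurableT_comp => //; apply: measurable_funM => //.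
  apply: measurableT_comp => //; apply: measurable_funD; apply: measurable_funM => //.
have s0 : 0 < Num.sqrt g^-1 by rewrite sqrtr_gt0 invr_gt0.
rewrite (ge0_integral_affine (- b / g) (lt0r_neq0 s0)); last 2 first.
- by apply: emeasurable_funM => //; exact/measurable_EFinP.
- by move=> x; rewrite mule_ge0// lee_fin expR_ge0.
rewrite (gtr0_norm s0) [X in (_ = X * _)%E]EFinM -muleA; congr (_ * _)%E.
rewrite -ge0_integralZl//; last 2 first.
- apply: emeasurable_funM; last by apply/measurable_EFinP; exact: measurable_gaussw.
  apply: measurableT_comp => //; apply: measurable_funD => //.
- by move=> x _; rewrite mule_ge0// lee_fin gaussw_ge0.
apply: eq_integral => z _; rewrite muleCA addrC; congr (_ * _)%E.
rewrite -EFinM -expRD; congr (expR _)%:E.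
set s := Num.sqrt g^-1.
have hs : s ^+ 2 * g = 1 by rewrite sqr_sqrtr ?invr_ge0 ?ltW// mulVf ?gt_eqF.
transitivity (b ^+ 2 / (2 * g) - (s ^+ 2 * g) * z ^+ 2 / 2); last first.
  by rewrite hs; ring.
by field; rewrite gt_eqF.
Qed.

Lemma gauss_int (g b : R) : 0 < g ->
  (\int[mu]_x (expR (- (g * x ^+ 2 + 2 * b * x) / 2))%:E =
   (Num.sqrt g^-1 * expR (b ^+ 2 / (2 * g)) * Num.sqrt (2 * pi))%:E)%E.
Proof.
move=> g0; have := @gauss_affine g b (fun=> 1%E) g0 (measurable_cst _) (fun=> lee01).
under eq_integral do rewrite mul1e.
by under [in RHS]eq_integral do rewrite mul1e; rewrite integral_gaussw => ->.
Qed.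

Lemma exp_int (l : R) : 0 < l ->
  (\int[mu]_x (if 0 < x then expR (- l * x) else 0)%:E = (l^-1)%:E)%E.
Proof.
move=> l0.
have : (l^-1%:E * \int[mu]_x (exponential_pdf l x)%:E = (l^-1)%:E)%E.
  by rewrite integral_exponential_pdf ?ltW// mule1.
rewrite -ge0_integralZl; last 4 first.
- exact: measurableT.
- by apply/measurable_EFinP; exact: measurable_exponential_pdf.
- by move=> x _; rewrite lee_fin exponential_pdf_ge0// ltW.
- by rewrite lee_fin invr_ge0 ltW.
move=> <-; apply: ae_eq_integral => //.
- apply/measurable_EFinP; apply: measurable_fun_ifT => //.
    exact: measurable_fun_ltr.
  by apply: measurableT_comp => //; exact: measurable_funM.
- apply: emeasurable_funM => //; apply/measurable_EFinP.
  exact: measurable_exponential_pdf.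
exists [set 0]; split => //; first exact: lebesgue_measure_set1.
move=> x /= h; apply: contrapT => /eqP x0; apply: h => _.
have [xp|xn] := ltP 0 x; last first.
  by rewrite lt0_exponential_pdf ?mule0// lt_neqAle x0.
rewrite -EFinM /exponential_pdf patchE ifT ?mulKf ?gt_eqF//.
by rewrite inE/= in_itv/= andbT ltW.
Qed.

Lemma integral_cauchy_lty :
  (\int[mu]_x ((1 + x ^+ 2)^-1)%:E < +oo)%E.
Proof.
pose f (x : R) := 2 * ((1 + `|x|)^-1 * (1 + `|x|)^-1).
have p1 (x : R) : 0 < 1 + `|x| by rewrite ltr_pwDl.
have f0 x : 0 <= f x by rewrite mulr_ge0// mulr_ge0// invr_ge0 ltW.
have cf : continuous f.
  move=> x; have c : (1 + `|y|)^-1 @[y --> x] --> (1 + `|x|)^-1.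
    apply: cvgV; first by rewrite gt_eqF.
    by apply: cvgD; [exact: cvg_cst|exact: norm_continuous].
  by apply: cvgM; [exact: cvg_cst|exact: cvgM].
apply: (@le_lt_trans _ _ (\int[mu]_x (f x)%:E)%E).
  apply: ge0_le_integral => //.
  - by move=> x _; rewrite lee_fin invr_ge0 addr_ge0// sqr_ge0.
  - apply/measurable_EFinP; apply: measurable_funV; apply: measurable_funD => //.
  - by apply/measurable_EFinP; exact: continuous_measurable_fun.
  - move=> x _; rewrite lee_fin /f -invfM.
    rewrite -[leLHS]mul1r ler_pdivrMr ?ltr_pwDl ?sqr_ge0//.
    rewrite mulrAC ler_pdivlMr ?mulr_gt0// mul1r.
    have : `|x| ^+ 2 = x ^+ 2 by rewrite real_normK// num_real.
    move: `|x| => y <-.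
    have := sqr_ge0 (y - 1); rewrite !expr2; lra.
rewrite ge0_symfun_integralT//; last by move=> x; rewrite /f /= normrN.
rewrite (_ : [set x | _] = `[0, +oo[%classic); last first.
  by apply/seteqP; split => x/=; rewrite in_itv/= andbT.
have dF (x : R) : 0 < x -> is_derive x 1 (fun x : R => - 2 * (1 + x)^-1) (f x).
  move=> x0; have x1 : 1 + x != 0 by rewrite gt_eqF// ltr_pwDl// ltW.
  apply: is_derive_eq; rewrite /f (gtr0_norm x0) /GRing.scale /=.
  by field.
rewrite (@ge0_continuous_FTC2y _ f (fun x => - 2 * (1 + x)^-1) 0 0)//.
- by rewrite -EFinB -EFinM ltry.
- exact: continuous_subspaceT.
- rewrite -(mulr0 (- 2)); apply: cvgM; first exact: cvg_cst.
  apply/gtr0_cvgV0; last exact: cvg_addrl.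
  by near=> x; rewrite addr_gt0.
- by move=> x x0; have [] := dF _ x0.
- apply: cvg_at_right_filter; apply: cvgM; first exact: cvg_cst.
  apply: cvgV; first by rewrite addr0 oner_neq0.
  by apply: cvgD; [exact: cvg_cst|exact: cvg_id].
- move=> x; rewrite in_itv/= andbT => x0; rewrite derive1E.
  by have [_ ->] := dF _ x0.
Unshelve. all: by end_near. Qed.
End one_dim.

(** * Gamma integrals *)

Section gamma.
Context {R : realType}.
Local Notation mu := (@lebesgue_measure R).

(** The unnormalized gamma density of shape a + 1 and rate l / 2. *)
Definition gamw (a l x : R) : R := if 0 < x then expR (a * ln x - l * x / 2) else 0.

Lemma gamw_ge0 a l x : 0 <= gamw a l x.
Proof. by rewrite /gamw; case: ifP => // _; exact: expR_ge0. Qed.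

Lemma measurable_gamw a l : measurable_fun setT (gamw a l).
Proof.
apply: measurable_fun_ifT => //; first exact: measurable_fun_ltr.
by apply: measurableT_comp => //; apply: measurable_funB; apply: measurable_funM => //;
  exact: measurable_funM.
Qed.

Let Egamw a l : measurable_fun setT (fun x => (gamw a l x)%:E).
Proof. by apply/measurable_EFinP; exact: measurable_gamw. Qed.

Let Egamw0 a l x : (0 <= (gamw a l x)%:E)%E.
Proof. by rewrite lee_fin gamw_ge0. Qed.

Lemma gamma_nneg_lty (a l : R) : 0 <= a -> 0 < l -> (\int[mu]_x (gamw a l x)%:E < +oo)%E.
Proof.
move=> a0 l0; pose t := l / (4 * (a + 1)).
have a1 : 0 < a + 1 by rewrite ltr_wpDl.
have t0 : 0 < t by rewrite divr_gt0// mulr_gt0.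
have l4 : 0 < l / 4 by rewrite divr_gt0.
apply: (@le_lt_trans _ _ (\int[mu]_x ((expR (- (a * ln t)))%:E *
    (if 0 < x then expR (- (l / 4) * x) else 0)%:E))%E).
  apply: ge0_le_integral => //.
  - exact: Egamw.
  - apply: emeasurable_funM => //; apply/measurable_EFinP.
    apply: measurable_fun_ifT => //; first exact: measurable_fun_ltr.
    by apply: measurableT_comp => //; exact: measurable_funM.
  - move=> x _; rewrite -EFinM lee_fin /gamw; case: ifPn => [x0|_]; last by rewrite mulr0.
    rewrite -expRD ler_expR.
    (* ln (t x) <= t x with t = l / (4 (a + 1)) absorbs x^a into half of the
       exponential. *)
    have h : ln x + ln t <= t * x.
      by rewrite -lnM ?posrE// mulrC ltW// ln_sublinear// mulr_gt0.
    have h2 : a * t <= l / 4.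
      rewrite /t mulrA ler_pdivrMr ?mulr_gt0//.
      rewrite (_ : l / 4 * (4 * (a + 1)) = l * a + l); last by field.
      by rewrite mulrC lerDl ltW.
    have h3 := ler_wpM2l a0 h.
    have h4 := ler_wpM2r (ltW x0) h2.
    move: h3 h4; rewrite mulrDr mulrA mulNr. lra.
rewrite ge0_integralZl//.
- by rewrite exp_int// -EFinM ltry.
- apply/measurable_EFinP.
  apply: measurable_fun_ifT => //; first exact: measurable_fun_ltr.
  by apply: measurableT_comp => //; exact: measurable_funM.
- by move=> x _; rewrite lee_fin; case: ifP => // _; exact: expR_ge0.
Qed.

(** The exponent -1/2 is that of the prior with b = 1. Here the integrand is a
Gaussian integral over y of exp(- l x (1 + y^2) / 2), so Tonelli turns the
claim into the convergence of the Cauchy integral. *)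
Lemma gamma_half_lty (l : R) : 0 < l -> (\int[mu]_x (gamw (- 2^-1) l x)%:E < +oo)%E.
Proof.
move=> l0; pose f (z : R * R) : R := if 0 < z.2 then
  expR (- (l / 2 * (1 + z.1 ^+ 2)) * z.2) else 0.
have mf : measurable_fun setT (fun z => (f z)%:E).
  apply/measurable_EFinP; apply: measurable_fun_ifT => //.
    exact: measurable_fun_ltr.
  apply: measurableT_comp => //; apply: measurable_funM => //.
  apply: measurableT_comp => //; apply: measurable_funM => //.
  by apply: measurable_funD => //; exact: measurable_funX.
have f0 z : (0 <= (f z)%:E)%E by rewrite lee_fin /f; case: ifP => // _; exact: expR_ge0.
have p1 (y : R) : 0 < 1 + y ^+ 2 by rewrite ltr_pwDl// sqr_ge0.
have lty : (\int[mu]_y \int[mu]_x (f (y, x))%:E < +oo)%E.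
  rewrite (_ : integral _ _ _ = (\int[mu]_y ((l / 2)^-1%:E * ((1 + y ^+ 2)^-1)%:E))%E).
    rewrite ge0_integralZl//.
    - by rewrite lte_mul_pinfty// ?integral_cauchy_lty// lee_fin invr_ge0 divr_ge0// ltW.
    - apply/measurable_EFinP; apply: measurable_funV; exact: measurable_funD.
    - by move=> y _; rewrite lee_fin invr_ge0 ltW.
    - by rewrite lee_fin invr_ge0 divr_ge0// ltW.
  apply: eq_integral => y _.
  have h : 0 < l / 2 * (1 + y ^+ 2) by rewrite mulr_gt0// divr_gt0.
  by rewrite -EFinM -invfM -(exp_int h).
have : (\int[mu]_y \int[mu]_x (f (y, x))%:E = (Num.sqrt l^-1 * Num.sqrt (2 * pi))%:E *
    \int[mu]_x (gamw (- 2^-1) l x)%:E)%E.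
  rewrite (@fubini_tonelli _ _ _ _ R mu mu (fun z => (f z)%:E))//.
  rewrite -ge0_integralZl//; last exact: Egamw.
  apply: eq_integral => x _; rewrite /f /gamw /=.
  have [x0|x0] := ltP 0 x; last by rewrite mule0; under eq_integral do rewrite /=; rewrite integral0.
  have lx : 0 < l * x by rewrite mulr_gt0.
  transitivity (\int[mu]_y ((expR (- (l * x / 2)))%:E *
      (expR (- ((l * x) * y ^+ 2 + 2 * 0 * y) / 2))%:E))%E.
    apply: eq_integral => y _; rewrite -EFinM -expRD; congr (expR _)%:E; ring.
  rewrite ge0_integralZl; last 4 first.
  - exact: measurableT.
  - apply/measurable_EFinP; apply: measurableT_comp => //.
    apply: measurable_funM => //; apply: measurableT_comp => //.
    by apply: measurable_funD => //; apply: measurable_funM.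
  - by move=> y _; rewrite lee_fin expR_ge0.
  - by rewrite lee_fin expR_ge0.
  rewrite gauss_int// expr0n/= mul0r expR0 mulr1 -!EFinM; congr EFin.
  have sx : expR (- 2^-1 * ln x) = (Num.sqrt x)^-1.
    by rewrite mulNr expRN -powR12_sqrt ?ltW// /powR gt_eqF.
  rewrite [in RHS]expRD sx invfM sqrtrM ?invr_ge0 ?(ltW l0)// (sqrtrV (ltW x0)).
  by ring.
case: (\int[mu]_x (gamw _ l x)%:E)%E => [r| |]//=; rewrite ?ltry// => e; exfalso.
move: lty; rewrite e gt0_muley ?ltxx// lte_fin mulr_gt0// sqrtr_gt0.
  by rewrite invr_gt0.
by rewrite mulr_gt0// pi_gt0.
Qed.

(** x^a is at most x^(-1/2) for x < 1 and at most x^|a| for x >= 1. *)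
Lemma gamma_lty (a l : R) : - 2^-1 <= a -> 0 < l -> (\int[mu]_x (gamw a l x)%:E < +oo)%E.
Proof.
move=> a0 l0.
apply: (@le_lt_trans _ _ (\int[mu]_x ((gamw (- 2^-1) l x)%:E + (gamw `|a| l x)%:E))%E).
  apply: ge0_le_integral; [exact: measurableT|by move=> x _; exact: Egamw0|
    exact: Egamw|by apply: emeasurable_funD; exact: Egamw|].
  move=> x _; rewrite -EFinD lee_fin /gamw; case: ifPn => x0; last by rewrite addr0.
  have [h|h] := leP 0 (ln x).
    rewrite ler_wpDl ?expR_ge0// ler_expR lerD2r ler_wpM2r//.
    exact: ler_norm.
  by rewrite ler_wpDr ?expR_ge0// ler_expR lerD2r ler_wnM2r// ltW.
rewrite ge0_integralD//; do ?exact: Egamw.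
by apply: lte_add_pinfty; [exact: gamma_half_lty|exact: gamma_nneg_lty].
Qed.

Lemma gamma_gt0 (a l : R) : 0 < l -> (0 < \int[mu]_x (gamw a l x)%:E)%E.
Proof.
move=> l0; pose c := expR (- (`|a| * ln 2) - l).
apply: (@lt_le_trans _ _ (\int[mu]_(x in `[1%R, 2%R]) c%:E)%E).
  rewrite integral_cst//= lebesgue_measure_itv/= lte_fin ltr1n.
  by rewrite -EFinB -EFinM lte_fin mulr_gt0 ?expR_gt0// subr_gt0 ltr1n.
apply: (@le_trans _ _ (\int[mu]_(x in `[1%R, 2%R]) (gamw a l x)%:E)%E).
  apply: ge0_le_integral; [by []|by move=> x _; rewrite lee_fin expR_ge0|
    exact: measurable_cst|by apply: measurable_funTS; exact: Egamw|].
  move=> x; rewrite /= in_itv/= => /andP[x1 x2]; rewrite lee_fin /gamw.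
  have x0 : 0 < x by rewrite (lt_le_trans _ x1).
  rewrite x0 ler_expR; apply: lerB; last by rewrite ler_pdivrMr// ler_pM2l.
  have lnx : 0 <= ln x by rewrite ln_ge0.
  have lnx2 : ln x <= ln 2 by rewrite ler_ln ?posrE.
  have h : - `|a| <= a by rewrite lerNl -normrN ler_norm.
  apply: (@le_trans _ _ (- `|a| * ln x)); last exact: ler_wpM2r.
  by rewrite mulNr lerN2 ler_wpM2l.
by apply: ge0_subset_integral => //; exact: Egamw.
Qed.
End gamma.

(** * The law of the first row of a Wishart matrix *)

Section gauss_row.
Context {R : realType}.
Local Notation mu := (@lebesgue_measure R).

Lemma rvint1 (F : 'rV[R]_1 -> \bar R) : borel F -> (forall M, 0 <= F M)%E ->
  rvint F = (\int[mu]_x F x%:M)%E.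
Proof.
move=> bF F0; rewrite (@rvint_cons _ 0 F bF F0); apply: eq_integral => x _.
have E (c : 'rV[R]_0) : row_mx x%:M c = x%:M :> 'rV[R]_1.
  apply/matrixP => i j; rewrite !ord1 [LHS]mxE; case: fintype.splitP => [k _|[]//].
  by rewrite !mxE !ord1.
rewrite rvint0 ?E// => d T f mf; under eq_fun do rewrite E.
exact: measurable_cst.
Qed.

Lemma mul_row_tr p (x0 y0 : R) (x1 y1 : 'rV[R]_p) :
  (row_mx x0%:M x1 *m (row_mx y0%:M y1)^T) 0 0 = x0 * y0 + (x1 *m y1^T) 0 0.
Proof.
rewrite tr_row_mx mul_row_col mx11D tr_scalar_mx -scalar_mxM; congr (_ + _).
by rewrite mxE eqxx.
Qed.

Lemma qform_mulinv p (A : 'M[R]_p) u : A \in unitmx -> A^T = A ->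
  qform A (u *m invmx A) = qform (invmx A) u.
Proof.
by move=> uA trA; rewrite /qform trmx_mul trmx_inv trA mulmxKV// mulmxA.
Qed.

Lemma mulmx_invschur p (g a0 : R) (be : 'rV[R]_p) S (a1 : 'rV[R]_p) : g != 0 ->
  S \in unitmx ->
  rsubmx (row_mx a0%:M a1 *m invmx (schurmx g be S)) =
  (a1 - (a0 / g) *: be) *m invmx S.
Proof.
move=> g0 uS; rewrite invmx_schur// mul_row_block row_mxKr.
by rewrite mul_scalar_mx scalerA mulmxDl addrC mulNmx -scalemxAl mulrN scaleNr.
Qed.

Lemma qform_invschur p (g a0 : R) (be : 'rV[R]_p) S (a1 : 'rV[R]_p) : 0 < g ->
  posdefmx S ->
  qform (invmx (schurmx g be S)) (row_mx a0%:M a1) =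
  a0 ^+ 2 / g + qform (invmx S) (a1 - (a0 / g) *: be).
Proof.
move=> g0 pS; have uS := posdef_unit pS; have trS : S^T = S by case: pS.
have pA : posdefmx (schurmx g be S) by apply/posdef_schur.
have uA := posdef_unit pA; have trA : (schurmx g be S)^T = schurmx g be S by case: pA.
rewrite -qform_mulinv//; set y := _ *m _.
have yA : y *m schurmx g be S = row_mx a0%:M a1 by rewrite mulmxKV.
have y1 : rsubmx y = (a1 - (a0 / g) *: be) *m invmx S.
  by rewrite mulmx_invschur ?gt_eqF.
move: yA; rewrite (row_mx1E y) => /(congr1 lsubmx).
rewrite row_mxKl {1}/schurmx /bmx mul_row_block row_mxKl -scalar_mxM.
have E0 (k : R) : (k%:M : 'M[R]_1) 0 0 = k by rewrite mxE eqxx.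
move=> /(congr1 (fun M : 'M[R]_1 => M 0 0)); rewrite !mx11D !E0.
rewrite qform_schur ?gt_eqF// y1 qform_mulinv//.
set q := (_ *m be^T) 0 0 => e; congr (_ + _).
by rewrite -e; field; rewrite gt_eqF.
Qed.

Lemma invschur_max p (g : R) (be : 'rV[R]_p.+1) S : g != 0 -> S \in unitmx ->
  invmx (schurmx g be S) ord_max ord_max = invmx S ord_max ord_max.
Proof.
move=> g0 uS; rewrite invmx_schur//.
by rewrite (_ : ord_max = rshift 1 ord_max) ?block_mxEdr//; exact/val_inj.
Qed.

Lemma expR_half_ln (d : R) : 0 < d -> expR (2^-1 * ln d) = Num.sqrt d.
Proof. by move=> d0; rewrite -powR12_sqrt ?ltW// /powR gt_eqF. Qed.

(** Gaussian integral over a row vector when the integrand depends on the last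
coordinate only. Coordinates are integrated out from the first, completing the
square in each; the last one is Gaussian with mean - d (al A^-1)_last and
variance d (A^-1)_last,last, and every determinant goes into C, which does not
depend on d and al. *)
Lemma gauss_row p (A : 'M[R]_p.+1) : posdefmx A -> exists2 C : R, 0 < C &
  forall d (al : 'rV[R]_p.+1) (G : R -> \bar R), 0 < d ->
  measurable_fun setT G -> (forall x, 0 <= G x)%E ->
  (rvint (fun c => G (c 0%R ord_max) *
     (expR (- (d^-1 * qform A c + 2 * (al *m c^T) 0 0) / 2))%:E) =
   (C * expR (p.+1%:R / 2 * ln d) * expR (d / 2 * qform (invmx A) al))%:E *
   \int[mu]_z (G (- d * (al *m invmx A) 0 ord_max +
      Num.sqrt (d * invmx A ord_max ord_max) * z)%R * (gaussw z)%:E))%E.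
Proof.
elim: p A => [|p IH] A pA.
  have A0 : 0 < A 0 0 by exact: posdef_diag_gt0.
  exists (Num.sqrt (A 0 0)^-1); first by rewrite sqrtr_gt0 invr_gt0.
  move=> d al G d0 mG G0.
  have mx1 (M : 'M[R]_1) : M = (M 0 0)%:M by exact: mx11_scalar.
  have invA : invmx A = (A 0 0)^-1%:M by rewrite [in LHS](mx1 A) invmx_scalar.
  have m0 : @ord_max 0 = 0 by exact/val_inj.
  rewrite rvint1; last 2 first.
  - move=> d' T f mf; apply: emeasurable_funM.
      by apply: measurableT_comp => //; exact: mf.
    apply/measurable_EFinP; apply: measurableT_comp => //; apply: measurable_funM => //.
    apply: measurableT_comp => //; apply: measurable_funD; apply: measurable_funM => //.
      exact: measurable_qform.
    apply: (@mxmeas_mul _ _ _ _ _ _ (fun=> al)); first exact: mxmeas_cst.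
    exact: mxmeas_tr.
  - by move=> M; rewrite mule_ge0// lee_fin expR_ge0.
  have E k : k%:M 0 0 = k :> R by rewrite mxE eqxx.
  transitivity (\int[mu]_x (G x *
      (expR (- ((d^-1 * A 0 0) * x ^+ 2 + 2 * al 0 0 * x) / 2))%:E))%E.
    apply: eq_integral => x _; rewrite m0 E; congr (_ * (expR _)%:E)%E.
    rewrite /qform tr_scalar_mx !mul_mx_scalar mx11Z mul_scalar_mx !mx11Z; ring.
  have dA0 : 0 < d^-1 * A 0 0 by rewrite mulr_gt0 ?invr_gt0.
  rewrite (gauss_affine _ dA0 mG G0); congr (_%:E * _)%E.
    rewrite mul1r invfM invrK sqrtrM ?ltW// expR_half_ln// [Num.sqrt d * _]mulrC.
    congr (_ * expR _); rewrite /qform invA mul_mx_scalar -scalemxAl mx11Z.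
    rewrite [al^T](mx1) mul_mx_scalar mx11Z !mxE; field.
    by rewrite !gt_eqF.
  apply: eq_integral => z _; congr (G _ * _)%E.
  rewrite m0 invA mul_mx_scalar mx11Z E invfM invrK; congr (_ + _).
  by field; rewrite !gt_eqF.
have trA : (A : 'M[R]_(1 + p.+1))^T = A by case: pA.
move: (pA); rewrite (sym_bmx trA) schurmxK => /posdef_schur.
set g := (A : 'M[R]_(1 + p.+1)) _ _; set be := ursubmx _; set S := _ - _ => -[g0 pS].
have uS := posdef_unit pS.
have [C C0 HC] := IH _ pS.
exists (C * Num.sqrt g^-1 * Num.sqrt (2 * pi)).
  by rewrite !mulr_gt0// sqrtr_gt0 ?invr_gt0// mulr_gt0// pi_gt0.
move=> d al G d0 mG G0.
pose a0 := (al : 'rV[R]_(1 + p.+1)) 0 (lshift p.+1 0).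
pose a1 := rsubmx (al : 'rV[R]_(1 + p.+1)).
have alE : al = row_mx a0%:M a1 by exact: row_mx1E.
have mxG d' (T : measurableType d') (f : T -> 'rV[R]_(1 + p.+1)) : mxmeas f ->
    measurable_fun setT (fun t => G (f t 0%R ord_max) *
     (expR (- (d^-1 * qform (schurmx g be S) (f t) + 2 * (al *m (f t)^T) 0 0) / 2))%:E)%E.
  move=> mf; apply: emeasurable_funM.
    by apply: measurableT_comp => //; exact: mf.
  apply/measurable_EFinP; apply: measurableT_comp => //; apply: measurable_funM => //.
  apply: measurableT_comp => //; apply: measurable_funD; apply: measurable_funM => //.
    exact: measurable_qform.
  apply: (@mxmeas_mul _ _ _ _ _ _ (fun=> al)); first exact: mxmeas_cst.
  exact: mxmeas_tr.
have G0' (c : 'rV[R]_(1 + p.+1)) : (0 <= G (c 0%R ord_max) *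
   (expR (- (d^-1 * qform (schurmx g be S) c + 2 * (al *m c^T) 0 0) / 2))%:E)%E.
  by rewrite mule_ge0// lee_fin expR_ge0.
rewrite (@rvint_cons _ p.+1 _ mxG G0') rvint_swap; last 2 first.
- move=> d' T h f mh mf; apply: mxG; apply: mxmeas_row_mx => //.
  exact: mxmeas_scalar.
- by move=> x c; exact: G0'.
pose a' := a1 - (a0 / g) *: be.
pose K := Num.sqrt (d^-1 * g)^-1 * expR (a0 ^+ 2 / (2 * (d^-1 * g))) * Num.sqrt (2 * pi).
have K0 : 0 <= K by rewrite !mulr_ge0// ?expR_ge0.
transitivity (rvint (fun w => K%:E * (G (w 0%R ord_max) *
     (expR (- (d^-1 * qform S w + 2 * (a' *m w^T) 0 0) / 2))%:E)))%E.
  apply: eq_rvint => w.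
  have rE (x : R) : row_mx x%:M w 0 (ord_max : 'I_(1 + p.+1)) = w 0 ord_max.
    by rewrite (_ : ord_max = rshift 1 ord_max) ?row_mxEr//; exact/val_inj.
  pose h x := (expR (- (d^-1 * qform S w + 2 * (a' *m w^T) 0 0) / 2) *
      expR (- ((d^-1 * g) * x ^+ 2 + 2 * a0 * x) / 2)).
  transitivity (\int[mu]_x (G (w 0%R ord_max) *
     (h (x + g^-1 * (w *m be^T) 0 0)%R)%:E))%E.
    apply: eq_integral => x _; rewrite rE; congr (_ * _%:E)%E.
    have -> : (al *m (row_mx x%:M w)^T) 0 0 = a0 * x + (a1 *m w^T) 0 0.
      by rewrite [in LHS]alE; exact: mul_row_tr.
    rewrite /h -expRD qform_schur ?gt_eqF//.
    have -> : (a' *m w^T) 0 0 = (a1 *m w^T) 0 0 - a0 / g * (w *m be^T) 0 0.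
      by rewrite /a' mulmxBl -scalemxAl mxE [in X in _ + X = _]mxE mx11Z (mx11_trmul be).
    by congr expR; field; rewrite !gt_eqF.
  have mh : measurable_fun setT h.
    apply: measurable_funM => //; apply: measurableT_comp => //.
    apply: measurable_funM => //; apply: measurableT_comp => //.
    by apply: measurable_funD; apply: measurable_funM.
  have h0 x : 0 <= h x by rewrite mulr_ge0 ?expR_ge0.
  rewrite ge0_integralZl; last 4 first.
  - exact: measurableT.
  - apply/measurable_EFinP; apply: measurableT_comp => //.
    by apply: measurable_funD.
  - by move=> x _; rewrite lee_fin.
  - exact: G0.
  rewrite muleCA; congr (_ * _)%E.
  rewrite -(@ge0_integral_shift _ (g^-1 * (w *m be^T) 0 0) (fun x => (h x)%:E)); last 2 first.
  - exact/measurable_EFinP.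
  - by move=> x; rewrite lee_fin.
  rewrite /h; under eq_integral do rewrite EFinM.
  rewrite ge0_integralZl; last 4 first.
  - exact: measurableT.
  - apply/measurable_EFinP; apply: measurableT_comp => //.
    apply: measurable_funM => //; apply: measurableT_comp => //.
    by apply: measurable_funD; apply: measurable_funM.
  - by move=> x _; rewrite lee_fin expR_ge0.
  - by rewrite lee_fin expR_ge0.
  by rewrite gauss_int ?mulr_gt0 ?invr_gt0// muleC.
rewrite rvintZ; last 3 first.
- move=> d' T f mf; apply: emeasurable_funM.
    by apply: measurableT_comp => //; exact: mf.
  apply/measurable_EFinP; apply: measurableT_comp => //; apply: measurable_funM => //.
  apply: measurableT_comp => //; apply: measurable_funD; apply: measurable_funM => //.
    exact: measurable_qform.
  apply: (@mxmeas_mul _ _ _ _ _ _ (fun=> a')); first exact: mxmeas_cst.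
  exact: mxmeas_tr.
- by move=> w; rewrite mule_ge0// lee_fin expR_ge0.
- by rewrite lee_fin.
rewrite HC// muleA -EFinM; congr (_%:E * _)%E.
  rewrite alE qform_invschur// -/a' /K invfM invrK sqrtrM ?ltW//.
  have -> : p.+2%:R / 2 * ln d = p.+1%:R / 2 * ln d + 2^-1 * ln d.
    by rewrite -[p.+2%:R]natr1; field.
  have -> : expR (p.+1%:R / 2 * ln d + 2^-1 * ln d) =
      expR (p.+1%:R / 2 * ln d) * Num.sqrt d by rewrite expRD expR_half_ln.
  have -> : expR (d / 2 * (a0 ^+ 2 / g + qform (invmx S) a')) =
      expR (d / 2 * (a0 ^+ 2 / g)) * expR (d / 2 * qform (invmx S) a').
    by rewrite mulrDr expRD.
  have -> : a0 ^+ 2 / (2 * (d^-1 * g)) = d / 2 * (a0 ^+ 2 / g).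
    by field; rewrite !gt_eqF.
  by ring.
have sE : invmx (schurmx g be S) ord_max ord_max = invmx S ord_max ord_max.
  by rewrite invschur_max ?gt_eqF.
have mE : (al *m invmx (schurmx g be S)) 0 (ord_max : 'I_(1 + p.+1)) =
    (a' *m invmx S) 0 ord_max.
  rewrite /a' -(mulmx_invschur a0 be a1 (lt0r_neq0 g0) uS) -alE [RHS]mxE.
  by congr (fun_of_matrix _ _ _); exact/val_inj.
by apply: eq_integral => z _; rewrite -mE -sE.
Qed.

Lemma posdef_schur_compl_gt0 p (k : R) (al : 'rV[R]_p) A' :
  posdefmx (bmx k al A') -> posdefmx A' -> 0 < k - qform (invmx A') al.
Proof.
move=> /posdefmxP[_ pA] pA'; have uA := posdef_unit pA'; have trA : A'^T = A' by case: pA'.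
have := pA (row_mx 1%:M (- (al *m invmx A'))).
rewrite qform_bmx mulNmx mxE -/(qform (invmx A') al).
rewrite (_ : qform A' (- (al *m invmx A')) = qform (invmx A') al); last first.
  rewrite -qform_mulinv// /qform linearN/= mulNmx mulNmx mulmxN opprK.
  by [].
rewrite (_ : _ + _ = k - qform (invmx A') al); last by ring.
apply; apply/eqP => /(congr1 lsubmx); rewrite row_mxKl => /matrixP/(_ 0 0).
by rewrite !mxE => /eqP; rewrite oner_eq0.
Qed.

(** Block inversion relative to the lower right block, the counterpart of
[invmx_schur] with the roles of the two blocks exchanged. *)
Lemma invmx_bmx p (k : R) (al : 'rV[R]_p) A' (V := invmx A')
    (th := (k - qform V al)^-1) : A' \in unitmx -> k - qform V al != 0 ->
  invmx (bmx k al A') =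
  block_mx th%:M (- th *: (al *m V)) (- th *: (V *m al^T)) (V + th *: (V *m al^T *m (al *m V))).
Proof.
move=> uA k0; apply: invmx_unique; rewrite /bmx mulmx_block.
have thE : th * (k - qform V al) = 1 by rewrite mulVf.
have qE : al *m V *m al^T = (qform V al)%:M by exact: mx11_scalar.
rewrite (_ : 1%:M = block_mx 1%:M 0 0 1%:M); last by rewrite -scalar_mx_block.
congr block_mx.
- rewrite -scalar_mxM -scalemxAr mulmxA qE scale_scalar_mx.
  by apply/matrixP => i j; rewrite !ord1 !mxE eqxx !mulr1n -thE; ring.
- rewrite mulmxDr mul_scalar_mx scalerA -scalemxAr !mulmxA qE -mulmxA mul_scalar_mx.
  rewrite scalerA addrCA -scalerDl -[X in X + _]scale1r -scalerDl.
  by rewrite (_ : _ + _ = 0) ?scale0r// -thE; ring.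
- by rewrite mul_mx_scalar -scalemxAr mulKVmx// scaleNr subrr.
- rewrite mulmxDr mulmxV// -!scalemxAr !mulmxA mulmxV// mul1mx.
  by rewrite scaleNr addrCA addNr addr0.
Qed.

Lemma measurable_gaussw_int (g : R -> R -> \bar R) (u v : R -> R) :
  measurable_fun setT (fun z : R * R => g z.1 z.2) -> (forall x y, 0 <= g x y)%E ->
  measurable_fun setT u -> measurable_fun setT v ->
  measurable_fun setT (fun d => \int[mu]_z (g d (u d + v d * z)%R * (gaussw z)%:E))%E.
Proof.
move=> mg g0 mu' mv.
apply: (@measurable_fun_fubini_tonelli_F _ _ _ _ R mu
  (fun t : R * R => g t.1 (u t.1 + v t.1 * t.2)%R * (gaussw t.2)%:E)%E).
  apply: emeasurable_funM; last first.
    apply/measurable_EFinP; exact: measurableT_comp measurable_gaussw measurable_snd.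
  apply: (@measurableT_comp _ _ _ _ _ _ (fun z : R * R => g z.1 z.2) _
    (fun t : R * R => (t.1, u t.1 + v t.1 * t.2))) => //.
  apply: measurable_fun_pair => //; apply: measurable_funD.
    exact: measurableT_comp mu' measurable_fst.
  apply: measurable_funM => //; exact: measurableT_comp mv measurable_fst.
by move=> t; rewrite mule_ge0// lee_fin gaussw_ge0.
Qed.

(** Corner and last entry of the first row. In terms of N = A^-1 the corner is a
gamma variable d of scale N_00, whose exponent grows by one half for each
coordinate integrated out, and given d the entry is Gaussian with mean
d N_0j / N_00 and variance d times the Schur complement of N at j. *)
Lemma rint_row p a (A : 'M[R]_(1 + p.+1)) (N := invmx A)
    (n0 := N (lshift p.+1 0) (lshift p.+1 0)) (nj := N (lshift p.+1 0) (rshift 1 ord_max))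
    (njj := N (rshift 1 ord_max) (rshift 1 ord_max)) :
  posdefmx A -> exists2 C : R, 0 < C &
  forall g : R -> R -> \bar R,
  measurable_fun setT (fun z : R * R => g z.1 z.2) -> (forall x y, 0 <= g x y)%E ->
  (rint a A (fun d c => g d (c 0%R ord_max)) =
   C%:E * \int[mu]_d ((gamw (a + p.+1%:R / 2) n0^-1 d)%:E *
     \int[mu]_z (g d (d * (nj / n0) + Num.sqrt (d * (njj - nj ^+ 2 / n0)) * z)%R *
       (gaussw z)%:E)))%E.
Proof.
move=> pA; have trA : A^T = A by case: pA.
have pA' := posdef_drsub pA; have uA' := posdef_unit pA'.
set k := A (lshift p.+1 0) (lshift p.+1 0); set al := ursubmx A.
have AE : A = bmx k al (drsubmx A) by exact: sym_bmx.
pose V := invmx (drsubmx A); pose th := (k - qform V al)^-1.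
have trV : V^T = V by rewrite trmx_inv trmx_drsub trA.
have q0 : 0 < k - qform V al by apply: posdef_schur_compl_gt0 => //; rewrite -AE.
have NE : N = block_mx th%:M (- th *: (al *m V)) (- th *: (V *m al^T))
    (V + th *: (V *m al^T *m (al *m V))).
  by rewrite /N {1}AE invmx_bmx// gt_eqF.
have n0E : n0 = th by rewrite /n0 NE block_mxEul mxE eqxx.
have njE : nj = - th * (al *m V) 0 ord_max by rewrite /nj NE block_mxEur mxE.
have VaE : (V *m al^T) ord_max 0 = (al *m V) 0 ord_max.
  by rewrite -[in LHS]trV -trmx_mul mxE.
have njjE : njj = V ord_max ord_max + th * ((al *m V) 0 ord_max) ^+ 2.
  by rewrite /njj NE block_mxEdr [LHS]mxE [X in _ + X]mxE [X in _ * X]mxE big_ord1 VaE.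
have th0 : th != 0 by rewrite invr_eq0 gt_eqF.
have [C C0 HC] := gauss_row pA'; exists C => // g mg g0.
have mgd d : measurable_fun setT (g d).
  by apply: (measurableT_comp mg (g := fun y => (d, y))); exact: measurable_fun_pair.
rewrite /rint -ge0_integralZl; last 4 first.
- exact: measurableT.
- apply: emeasurable_funM; first by apply/measurable_EFinP; exact: measurable_gamw.
  apply: measurable_gaussw_int => //; first exact: measurable_funM.
  by apply: measurable_fun_sqrt; exact: measurable_funM.
- move=> d _; rewrite mule_ge0 ?lee_fin ?gamw_ge0//; apply: integral_ge0 => z _.
  by rewrite mule_ge0// lee_fin gaussw_ge0.
- by rewrite lee_fin ltW.
apply: eq_integral => d _; rewrite /gamw.
have [d0|d0] := ltP 0 d; last first.
  rewrite mul0e mule0; transitivity (rvint (fun _ : 'rV[R]_p.+1 => 0 : \bar R)%E).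
    by apply: eq_rvint => c; rewrite /rdens ltNge d0/= mule0.
  by rewrite /rvint /seqint integral0.
have rE (c : 'rV[R]_p.+1) : rdens a A d c = expR (a * ln d - k * d / 2) *
    expR (- (d^-1 * qform (drsubmx A) c + 2 * (al *m c^T) 0 0) / 2).
  rewrite /rdens d0 -expRD {1}AE qform_bmx (mx11_trmul c); congr expR.
  by field; rewrite gt_eqF.
transitivity (rvint (fun c => (expR (a * ln d - k * d / 2))%:E * (g d (c 0%R ord_max) *
   (expR (- (d^-1 * qform (drsubmx A) c + 2 * (al *m c^T) 0 0) / 2))%:E)))%E.
  by apply: eq_rvint => c; rewrite rE EFinM muleCA.
rewrite rvintZ; last 3 first.
- move=> d' T f mf; apply: emeasurable_funM.
    by apply: measurableT_comp => //; exact: mf.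
  apply/measurable_EFinP; apply: measurableT_comp => //; apply: measurable_funM => //.
  apply: measurableT_comp => //; apply: measurable_funD; apply: measurable_funM => //.
    exact: measurable_qform.
  apply: (@mxmeas_mul _ _ _ _ _ _ (fun=> al)); first exact: mxmeas_cst.
  exact: mxmeas_tr.
- by move=> c; rewrite mule_ge0// lee_fin expR_ge0.
- by rewrite lee_fin expR_ge0.
rewrite HC// muleA -EFinM [RHS]muleA -EFinM; congr (_%:E * _)%E.
  have -> : expR ((a + p.+1%:R / 2) * ln d - n0^-1 * d / 2) =
      expR (a * ln d - k * d / 2) * expR (p.+1%:R / 2 * ln d) *
      expR (d / 2 * qform (invmx (drsubmx A)) al).
    by rewrite -!expRD; congr expR; rewrite n0E /th invrK -/V; field.
  by ring.
apply: eq_integral => z _; congr (g d _ * _)%E; congr (_ + _ * z).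
  by rewrite njE n0E -/V; field.
by congr (Num.sqrt (d * _)); rewrite njjE njE n0E -/V; field.
Qed.

Lemma rint_row_fin p a (A : 'M[R]_(1 + p)) : - 2^-1 <= a -> posdefmx A ->
  (0 < rint a A (fun _ _ => 1) < +oo)%E.
Proof.
case: p A => [|p] A a0 pA; last first.
  have [C C0 HC] := rint_row a pA.
  set n0 := invmx A _ _ in HC.
  have n00 : 0 < n0^-1 by rewrite invr_gt0; apply: posdef_diag_gt0; exact: posdef_inv.
  rewrite (HC (fun _ _ => 1%E) (measurable_cst _) (fun _ _ => lee01)).
  rewrite (_ : (\int[mu]_d (_ * _))%E = (\int[mu]_d
      ((gamw (a + p.+1%:R / 2) n0^-1 d)%:E * (Num.sqrt (2 * pi))%:E))%E); last first.
    apply: eq_integral => d _; congr (_ * _)%E.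
    by under eq_integral do rewrite mul1e; exact: integral_gaussw.
  rewrite ge0_integralZr//; last 2 first.
  - by apply/measurable_EFinP; exact: measurable_gamw.
  - by move=> x _; rewrite lee_fin gamw_ge0.
  have s0 : 0 < Num.sqrt (2 * pi) :> R by rewrite sqrtr_gt0 mulr_gt0// pi_gt0.
  have h1 := @gamma_gt0 R (a + p.+1%:R / 2) _ n00.
  have h2 : (\int[mu]_x (gamw (a + p.+1%:R / 2) n0^-1 x)%:E < +oo)%E.
    by apply: gamma_lty => //; rewrite (le_trans a0)// lerDl divr_ge0.
  apply/andP; split; first by rewrite !mule_gt0// lte_fin.
  rewrite lte_mul_pinfty//; first by rewrite lee_fin ltW.
  by rewrite muleC lte_mul_pinfty// lee_fin ltW.
have A0 : 0 < A 0 0 by exact: posdef_diag_gt0.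
rewrite (_ : rint _ _ _ = (\int[mu]_x (gamw a (A 0 0) x)%:E)%E).
  by rewrite gamma_gt0// gamma_lty.
apply: eq_integral => d _; rewrite rvint0.
  rewrite mul1e /rdens /gamw; case: ifP => // d0; congr (expR (_ - _))%:E.
  have trA : A^T = A by case: pA.
  rewrite {1}(sym_bmx trA) qform_bmx mul0mx mxE mulr0 addr0 /qform mul0mx mul0mx mxE addr0.
  rewrite (_ : lshift 0 0 = 0); last exact/val_inj.
  by field; rewrite gt_eqF.
move=> d' T f mf; rewrite (_ : (fun _ => _) = cst (1 * (rdens a A d 0)%:E)%E).
  exact: measurable_cst.
by apply/funext => t /=; congr (_ * (rdens _ _ _ _)%:E)%E; apply/matrixP => i [].
Qed.

(** The normalizing constant is finite and positive: one gamma integral per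
coordinate. *)
Lemma wint_fin p a (A : 'M[R]_p) : - 2^-1 <= a -> posdefmx A ->
  (0 < wint a A (fun=> 1) < +oo)%E.
Proof.
move=> a0; elim: p A => [|p IH] A pA.
  rewrite /wint sint0; last by apply: borel_wint => d T f mf; exact: measurable_cst.
  rewrite mul1e /wdens asboolT.
    by rewrite lte_fin expR_gt0 ltry.
  split=> [|u]; first by apply/matrixP => -[].
  by rewrite (_ : u = 0) ?eqxx//; apply/matrixP => -[].
have trA : (A : 'M[R]_(1 + p))^T = A by case: pA.
have b1 : borel (fun _ : 'M[R]_(1 + p) => 1%E : \bar R).
  by move=> d T f mf; exact: measurable_cst.
have j1 : jborel (fun (_ : R) (_ : 'rV[R]_p) => 1%E : \bar R).
  by move=> d T f g mg mf; exact: measurable_cst.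
rewrite (@wint_row _ p a A _ (fun _ _ => 1%E) trA b1 (fun=> lee01) j1
  (fun _ _ => lee01) (fun _ _ _ => erefl)).
have /andP[h1 h2] := @rint_row_fin p a A a0 pA.
have /andP[h3 h4] := IH _ (@posdef_drsub _ p A pA).
rewrite mule_gt0//= lte_mul_pinfty// ?ltW// ge0_fin_numE// ltW//.
Qed.
End gauss_row.

(** * The posterior as a Wishart law *)

Section density_integral.
Context d (T : measurableType d) (R : realType).
Variables (mu : {measure set T -> \bar R}) (D : set T) (w : T -> R).
Hypotheses (mD : measurable D) (mw : measurable_fun setT w) (w0 : forall x, 0 <= w x).
Local Open Scope ereal_scope.
Import HBNNSimple.

Local Notation nu := (density_measure mu mD mw w0).

Let mwD : measurable_fun setT (fun x => (w x * \1_D x)%:E).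
Proof. by apply/measurable_EFinP; apply: measurable_funM. Qed.

Let wD0 x : 0 <= (w x * \1_D x)%:E.
Proof. by rewrite lee_fin mulr_ge0. Qed.

Let nu_indic A : measurable A ->
  \int[nu]_x (\1_A x)%:E = \int[mu]_x ((\1_A x)%:E * (w x * \1_D x)%:E).
Proof.
move=> mA; rewrite integral_indic// setIT.
transitivity (\int[mu]_(x in A `&` D) (w x)%:E) => //.
rewrite [LHS]integral_mkcond; apply: eq_integral => x _; rewrite patchE !indicE in_setI.
by case: (x \in A); case: (x \in D); rewrite ?mul1e ?mul0e ?mulr1 ?mulr0.
Qed.

Let nu_nnsfun (f : {nnsfun T >-> R}) :
  \int[nu]_x (f x)%:E = \int[mu]_x ((f x)%:E * (w x * \1_D x)%:E).
Proof.
under [LHS]eq_integral do rewrite fimfunE -fsumEFin//.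
rewrite ge0_integral_fsum//; last 2 first.
- by move=> r; apply/measurable_EFinP; apply: measurable_funM.
- by move=> r x _; rewrite EFinM nnfun_muleindic_ge0.
transitivity (\int[mu]_x (\sum_(r \in range f)
    ((r * \1_(f @^-1` [set r]) x)%:E * (w x * \1_D x)%:E))).
  rewrite ge0_integral_fsum//; last 2 first.
  - move=> r; apply: emeasurable_funM => //; apply/measurable_EFinP.
    by apply: measurable_funM.
  - by move=> r x _; apply: mule_ge0 => //; rewrite EFinM nnfun_muleindic_ge0.
  apply: eq_fsbigr => r /[!inE] -[t _ <-].
  have ft0 : (0 <= (f t)%:E) by rewrite lee_fin.
  under eq_integral do rewrite EFinM.
  rewrite ge0_integralZl; last 4 first.
  - exact: measurableT.
  - by apply/measurable_EFinP; exact: measurable_indic.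
  - by move=> x _; rewrite lee_fin.
  - exact: ft0.
  under [in RHS]eq_integral do rewrite EFinM -muleA.
  rewrite ge0_integralZl; last 4 first.
  - exact: measurableT.
  - apply: emeasurable_funM => //; apply/measurable_EFinP; exact: measurable_indic.
  - by move=> x _; apply: mule_ge0 => //; rewrite lee_fin.
  - exact: ft0.
  by rewrite nu_indic.
apply: eq_integral => x _; rewrite [in RHS]fimfunE -fsumEFin//.
rewrite ge0_mule_fsuml// => r; by rewrite EFinM nnfun_muleindic_ge0.
Qed.

(** Integration against a measure with a density, by monotone approximation
from simple functions. *)
Lemma ge0_integral_density f : measurable_fun setT f -> (forall x, 0 <= f x) ->
  \int[nu]_x f x = \int[mu]_x (f x * (w x * \1_D x)%:E).
Proof.
move=> mf f0; pose f_ := nnsfun_approx measurableT mf.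
transitivity (limn (fun n => \int[nu]_x (f_ n x)%:E)).
  rewrite -monotone_convergence//.
  - apply: eq_integral => x _; apply/esym/cvg_lim => //.
    exact: cvg_nnsfun_approx.
  - by move=> n; exact/measurable_EFinP.
  - by move=> n x _; rewrite lee_fin.
  - by move=> x _ a b ab; rewrite lee_fin//; exact/lefP/nd_nnsfun_approx.
transitivity (limn (fun n => \int[mu]_x ((f_ n x)%:E * (w x * \1_D x)%:E))).
  by congr (limn _); apply/funext => n; exact: nu_nnsfun.
rewrite -monotone_convergence//.
- apply: eq_integral => x _; apply/cvg_lim => //.
  by apply: cvgeZr => //; exact: cvg_nnsfun_approx.
- by move=> n; apply: emeasurable_funM => //; exact/measurable_EFinP.
- by move=> n x _; apply: mule_ge0 => //; rewrite lee_fin.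
- move=> x _ a b ab; apply: lee_wpmul2r => //.
  by rewrite lee_fin//; exact/lefP/nd_nnsfun_approx.
Qed.
End density_integral.

Section posterior.
Context {R : realType}.
Local Notation mu := (@lebesgue_measure R).

Lemma posdefmx1 p : posdefmx (1%:M : 'M[R]_p).
Proof.
apply/posdefmxP; split=> [|u u0]; first by rewrite tr_scalar_mx.
have [i ui] : exists i, u 0 i != 0.
  apply: contrapT => h; move/eqP : u0; apply; apply/matrixP => i j.
  rewrite (ord1 i) [RHS]mxE; apply: contrapT => /eqP uj; apply: h; by exists j.
rewrite /qform mulmx1 mxE (bigD1 i)//= ltr_pwDl//.
  by rewrite mxE -expr2 exprn_even_gt0.
by apply: sumr_ge0 => j _; rewrite mxE -expr2 sqr_ge0.
Qed.

Lemma prior_exponent_ge (b : nat) : (0 < b)%N -> - 2^-1 <= (b%:R - 2) / 2 :> R.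
Proof.
move=> b0; rewrite ler_pdivlMr// mulNr mulVf// lerBrDr.
by rewrite (_ : -1 + 2 = 1 :> R) ?ler1n//; ring.
Qed.

Local Notation nu p b := (density_measure (power_measure mu 'C(p.+1, 2))
  (@measurable_posdef_sym_mx R p) (@measurable_wishart_weight R p b)
  (@wishart_weight_ge0 R p b)).

Lemma integral_prior_density p b (F : 'M[R]_p -> \bar R) : borel F ->
  (forall M, 0 <= F M)%E ->
  (\int[nu p b]_v F (sym_mx v) = wint ((b%:R - 2) / 2) 1%:M F)%E.
Proof.
move=> bF F0.
have mF : measurable_fun setT (fun v : 'C(p.+1, 2).-tuple R => F (sym_mx v)).
  by apply: bF => i j; exact: measurable_sym_mx.
have E := @ge0_integral_density _ _ R (power_measure mu 'C(p.+1, 2)) _ _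
  (@measurable_posdef_sym_mx R p) (@measurable_wishart_weight R p b)
  (@wishart_weight_ge0 R p b) _ mF (fun v => F0 _).
apply: (etrans E).
apply: eq_integral => v _; congr (_ * _%:E)%E.
rewrite /wdens mul1mx indicE /wishart_weight.
rewrite (_ : (v \in _) = `[< posdefmx (sym_mx v) >])//.
by case: ifP => _; rewrite ?mulr1 ?mulr0.
Qed.

(** For b >= 1 the total mass is finite and positive, so the normalized prior is
the Wishart weight up to a constant c; c cancels in the posterior. *)
Lemma integral_wishart p b : (0 < b)%N -> exists2 c : R, 0 < c &
  forall F : 'M[R]_p -> \bar R, borel F -> (forall M, 0 <= F M)%E ->
  (\int[wishart p b]_v F (sym_mx v) = c%:E * wint ((b%:R - 2) / 2) 1%:M F)%E.
Proof.
move=> b0.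
have nuT : nu p b setT = wint ((b%:R - 2) / 2) (1%:M : 'M[R]_p) (fun=> 1%E).
  rewrite -integral_prior_density//.
  by rewrite integral_cst// mul1e.
have := wint_fin (prior_exponent_ge b0) (posdefmx1 p); rewrite -nuT => /andP[n0 ny].
have nfin : nu p b setT \is a fin_num by rewrite ge0_fin_numE// ltW.
have c0 : 0 < (fine (nu p b setT))^-1 by rewrite invr_gt0 fine_gt0// n0 ny.
exists (fine (nu p b setT))^-1 => // F bF F0.
pose m := mscale (NngNum (ltW c0)) (nu p b).
transitivity (\int[m]_v F (sym_mx v))%E.
  apply: eq_measure_integral => A mA _.
  transitivity (mnormalize (nu p b) (dirac point) A); first by [].
  by rewrite /mnormalize gt_eqF//= lt_eqF//= /m /mscale/= muleC.
rewrite /m ge0_integral_mscale//; last by apply: bF => i j; exact: measurable_sym_mx.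
by rewrite integral_prior_density.
Qed.

Section with_data.
Variables (n p b : nat) (x : 'I_n -> p.-tuple R).

Definition post_scale : 'M[R]_p := n%:R *: sample_cov x + 1%:M.

Lemma qform_sample_cov u : 0 <= qform (sample_cov x) u.
Proof.
rewrite /sample_cov qformZ mulr_ge0//.
rewrite /qform mulmx_sumr mulmx_suml summxE sumr_ge0// => k _.
have -> : (u *m (colv (x k) *m (colv (x k))^T) *m u^T) 0 0 =
    ((u *m colv (x k)) 0 0) ^+ 2.
  rewrite mulmxA -mulmxA -trmx_mul [LHS]mxE big_ord1 expr2; congr (_ * _).
  by rewrite mxE.
exact: sqr_ge0.
Qed.

Lemma tr_sample_cov : (sample_cov x)^T = sample_cov x.
Proof.
rewrite /sample_cov linearZ/= linear_sum/=; congr (_ *: _).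
by apply: eq_bigr => k _; rewrite trmx_mul trmxK.
Qed.

Lemma posdef_post_scale : posdefmx post_scale.
Proof.
apply/posdefmxP; split; first by rewrite linearD/= linearZ/= tr_sample_cov tr_scalar_mx.
move=> u u0; rewrite qformD qformZ ltr_wpDl//.
  by rewrite mulr_ge0// qform_sample_cov.
by have /posdefmxP[_] := posdefmx1 p; apply.
Qed.

Definition post_exp : R := (n%:R + b%:R - 2) / 2.

Lemma post_exp_ge : (0 < b)%N -> - 2^-1 <= post_exp.
Proof.
move=> b0; rewrite (le_trans (prior_exponent_ge b0))// ler_pM2r// lerD2r lerDr.
by [].
Qed.

(** Conjugacy: the log-likelihood adds n / 2 to the exponent and n Shat to the
scale. *)
Lemma wint_loglik (F : 'M[R]_p -> \bar R) :
  wint ((b%:R - 2) / 2) 1%:M (fun M => F M * (expR (loglik x M))%:E)%E =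
  wint post_exp post_scale F.
Proof.
apply: eq_sint => M _; rewrite -muleA -EFinM; congr (_ * _%:E)%E.
rewrite /wdens; case: ifP => _; last by rewrite mulr0.
have -> : \tr (post_scale *m M) = n%:R * \tr (M *m sample_cov x) + \tr M.
  by rewrite /post_scale mulmxDl mul1mx mxtraceD -scalemxAl mxtraceZ mxtrace_mulC.
by rewrite -expRD mul1mx /loglik /post_exp; congr expR; field.
Qed.

Lemma posteriorE (B : set 'M[R]_p) : (0 < b)%N ->
  borel (fun M => (\1_B M)%:E : \bar R) ->
  posterior b x B = fine (wint post_exp post_scale (fun M => (\1_B M)%:E)) /
                    fine (wint post_exp post_scale (fun=> 1%E)).
Proof.
move=> b0 bB; have [c c0 HC] := integral_wishart p b0.
have bl : borel (fun M : 'M[R]_p => (expR (loglik x M))%:E : \bar R).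
  move=> d T f mf; apply/measurable_EFinP; apply: measurableT_comp => //.
  apply: measurable_funB; apply: measurable_funM => //.
    by apply: measurableT_comp => //; exact: measurable_det.
  by apply: measurable_tr; apply: mxmeas_mul => //; exact: mxmeas_cst.
have H F : borel F -> (forall M, 0 <= F M)%E ->
    (\int[wishart p b]_v (F (sym_mx v) * (expR (loglik x (sym_mx v)))%:E) =
     c%:E * wint post_exp post_scale F)%E.
  move=> bF F0; rewrite -wint_loglik -HC//.
  - by move=> d T f mf; apply: emeasurable_funM; [exact: bF|exact: bl].
  - by move=> M; rewrite mule_ge0// lee_fin expR_ge0.
have b1 : borel (fun _ : 'M[R]_p => 1%E : \bar R).
  by move=> d T f mf; exact: measurable_cst.
rewrite /posterior integral_mkcond.
have -> : (\int[wishart p b]_v (((fun v => (expR (loglik x (sym_mx v)))%:E) \_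
    (sym_mx @^-1` B)) v) = c%:E * wint post_exp post_scale (fun M => (\1_B M)%:E))%E.
  rewrite -H//.
  apply: eq_integral => v _; rewrite patchE indicE.
  rewrite (_ : (v \in sym_mx @^-1` B) = (sym_mx v \in B))//.
  by case: (sym_mx v \in B); rewrite ?mul1e ?mul0e.
have -> : (\int[wishart p b]_v (expR (loglik x (sym_mx v)))%:E =
    c%:E * wint post_exp post_scale (fun=> 1%E))%E.
  rewrite -H//.
  by apply: eq_integral => v _; rewrite mul1e.
have /andP[w0 wy] := wint_fin (post_exp_ge b0) posdef_post_scale.
have wB : (wint post_exp post_scale (fun M => (\1_B M)%:E) <= wint post_exp post_scale (fun=> 1))%E.
  apply: ge0_le_integral => //.
  - by move=> v _; rewrite mule_ge0// lee_fin ?wdens_ge0.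
  - apply: emeasurable_funM; first by apply: bB => i j; exact: measurable_sym_mx.
    by apply/measurable_EFinP; apply: measurable_wdens => i j; exact: measurable_sym_mx.
  - apply: emeasurable_funM => //.
    by apply/measurable_EFinP; apply: measurable_wdens => i j; exact: measurable_sym_mx.
  move=> v _; apply: lee_wpmul2r; first by rewrite lee_fin wdens_ge0.
  by rewrite lee_fin indicE; case: (_ \in _).
have wB0 : (0 <= wint post_exp post_scale (fun M => (\1_B M)%:E))%E.
  by apply: wint_ge0 => M; rewrite lee_fin.
rewrite !fineM//; last 2 first.
- by rewrite ge0_fin_numE// ltW.
- by rewrite ge0_fin_numE// (le_lt_trans wB).
by rewrite /= -mulf_div divff ?mul1r// gt_eqF.
Qed.
End with_data.
End posterior.

(** * Relabelling, and two entries of an inverse Wishart matrix *)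

Section relabel.
Context {R : realType}.
Local Notation mu := (@lebesgue_measure R).

Definition relab p (s : 'S_p) (M : 'M[R]_p) : 'M[R]_p := \matrix_(i, j) M (s i) (s j).

Lemma relabE p (s : 'S_p) M : relab s M = perm_mx s *m M *m (perm_mx s)^T.
Proof.
rewrite tr_perm_mx -row_permE -col_permE; apply/matrixP => i j.
by rewrite !mxE.
Qed.

Lemma perm_mx_trK p (s : 'S_p) : (perm_mx s)^T *m perm_mx s = 1%:M :> 'M[R]_p.
Proof. by rewrite tr_perm_mx -perm_mxM mulVg perm_mx1. Qed.

Lemma relabK p (s : 'S_p) M : relab s^-1%g (relab s M) = M.
Proof. by apply/matrixP => i j; rewrite !mxE !permKV. Qed.

Lemma posdef_relab p (s : 'S_p) M : posdefmx (relab s M) <-> posdefmx M.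
Proof.
have h (t : 'S_p) (N : 'M[R]_p) : posdefmx N -> posdefmx (relab t N).
  by move=> pN; rewrite relabE; apply: posdef_conj => //; exact: unitmx_perm.
split=> [pM|]; last exact: h.
by have := h s^-1%g _ pM; rewrite relabK.
Qed.

Lemma invmx_relab p (s : 'S_p) M : M \in unitmx ->
  invmx (relab s M) = relab s (invmx M).
Proof.
move=> uM; apply: invmx_unique; rewrite !relabE -!mulmxA.
rewrite (mulmxA (perm_mx s)^T) perm_mx_trK mul1mx (mulmxA M) mulmxV// mul1mx.
by rewrite tr_perm_mx -perm_mxM mulgV perm_mx1.
Qed.

Lemma det_relab p (s : 'S_p) M : \det (relab s M) = \det M.
Proof.
rewrite relabE !det_mulmx mulrAC -det_mulmx.
by rewrite tr_perm_mx -perm_mxM mulgV perm_mx1 det1 mul1r.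
Qed.

Lemma trace_relab p (s : 'S_p) A M :
  \tr (A *m relab s M) = \tr (relab s^-1%g A *m M).
Proof.
have Q : perm_mx s^-1%g = (perm_mx s)^T :> 'M[R]_p by rewrite tr_perm_mx.
by rewrite !relabE Q trmxK !mulmxA mxtrace_mulC !mulmxA.
Qed.

Lemma wint_relab p a (A : 'M[R]_p) (s : 'S_p) F : borel F -> (forall M, 0 <= F M)%E ->
  wint a A F = wint a (relab s^-1%g A) (fun M => F (relab s M)).
Proof.
move=> bF F0; rewrite /wint (@sint_perm _ _ s); last 2 first.
- exact: borel_wint.
- by move=> M; rewrite mule_ge0// lee_fin wdens_ge0.
apply: eq_sint => M _; congr (_ * _%:E)%E; rewrite -/(relab s M) /wdens.
rewrite det_relab trace_relab; congr (if _ then _ else _).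
by apply: asbool_equiv_eq; exact: posdef_relab.
Qed.

Lemma perm_to p (i j i0 j0 : 'I_p) : i != j -> i0 != j0 ->
  exists s : 'S_p, s i = i0 /\ s j = j0.
Proof.
move=> ij ij0; exists (tperm i i0 * tperm (tperm i i0 j) j0)%g.
rewrite !permM tpermL tpermL; split=> //; rewrite (@tpermD _ (tperm i i0 j) j0 i0)//.
- by rewrite -[X in _ != X](tpermL i i0) (inj_eq perm_inj) eq_sym.
- by rewrite eq_sym.
Qed.

Lemma sint1 (F : 'M[R]_1 -> \bar R) : borel F -> (forall M, 0 <= F M)%E ->
  sint F = (\int[mu]_x F x%:M)%E.
Proof.
move=> bF F0; rewrite (@sint_block _ 0 F bF F0); apply: eq_integral => x _.
have E (c : 'rV[R]_0) (M : 'M[R]_0) : bmx x c M = x%:M :> 'M[R]_1.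
  apply/matrixP => i j; rewrite !ord1 [LHS]mxE; case: fintype.splitP => [k _|[]//].
  by rewrite mxE; case: fintype.splitP => [l _|[]//]; rewrite !mxE !ord1.
have E2 c : sint (fun M : 'M[R]_0 => F (bmx x c M)) = F x%:M.
  rewrite sint0 ?E// => d T f mf; under eq_fun do rewrite E.
  exact: measurable_cst.
under [X in rvint X]eq_fun do rewrite E2.
by rewrite rvint0// => d T f mf; exact: measurable_cst.
Qed.

(** The dependence on the rate l is explicit: this factor is what turns the
quadratic form of [wint_inv2] into a Student-type weight. *)
Lemma gamma_scale a (l : R) : 0 < l ->
  (\int[mu]_x (gamw a l x)%:E =
   (expR (- (a + 1) * ln l))%:E * \int[mu]_x (gamw a 1 x)%:E)%E.
Proof.
move=> l0; have l0' : l^-1 != 0 by rewrite invr_eq0 gt_eqF.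
rewrite (ge0_integral_affine 0 l0'); last 2 first.
- by apply/measurable_EFinP; exact: measurable_gamw.
- by move=> x; rewrite lee_fin gamw_ge0.
have -> : `|l^-1| = l^-1 by rewrite gtr0_norm// invr_gt0.
rewrite -[RHS]ge0_integralZl; last 4 first.
- exact: measurableT.
- by apply/measurable_EFinP; exact: measurable_gamw.
- by move=> x _; rewrite lee_fin gamw_ge0.
- by rewrite lee_fin expR_ge0.
rewrite -[LHS]ge0_integralZl; last 4 first.
- exact: measurableT.
- by apply/measurable_EFinP; apply: (measurableT_comp (measurable_gamw a l));
    apply: measurable_funD => //; apply: measurable_funM.
- by move=> x _; rewrite lee_fin gamw_ge0.
- by rewrite lee_fin invr_ge0 ltW.
apply: eq_integral => x _; rewrite -!EFinM addr0 /gamw pmulr_rgt0 ?invr_gt0//.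
case: ifPn => x0; last by rewrite !mulr0.
rewrite -[in LHS](lnK (l0 : l \in Num.pos)) -expRN -!expRD; congr (expR _)%:E.
rewrite expRN lnK ?posrE// lnM ?posrE ?invr_gt0// lnV ?posrE//.
by field; rewrite gt_eqF.
Qed.

Lemma row_mx1_neq0 p (w : 'rV[R]_p) : row_mx 1%:M w != 0.
Proof.
apply/eqP => /(congr1 lsubmx); rewrite row_mxKl => /matrixP/(_ 0 0).
by rewrite !mxE => /eqP; rewrite oner_eq0.
Qed.

Definition iprev p : 'I_p.+2 := widen_ord (leqnSn p.+1) ord_max.

(** [wint_inv] removes leading coordinates until two are left. In dimension two
write Om = [d, y; y, s + y^2 / d]; then the inverse has lower right entry 1 / s
and off-diagonal entry - (y / d) / s. Substituting r = y / d, the quadratic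
form becomes d (al + 2 be r + ga r^2), and the integral over d is a gamma
integral, which leaves the power - (a + 2) of that polynomial. *)
Lemma wint_inv2 p a (A : 'M[R]_p.+2) (al := A (iprev p) (iprev p))
   (be := A (iprev p) ord_max) (ga := A ord_max ord_max) :
  - 2^-1 <= a -> posdefmx A ->
  exists2 K : R, 0 < K &
  forall h : R -> R -> \bar R, measurable_fun setT (fun z : R * R => h z.1 z.2) ->
  (forall x y, 0 <= h x y)%E ->
  (wint a A (fun M => h (invmx M (iprev p) ord_max) (invmx M ord_max ord_max)) =
   K%:E * \int[mu]_r ((expR (- (a + 2) * ln (al + 2 * be * r + ga * r ^+ 2)))%:E *
     \int[mu]_s ((gamw a ga s)%:E * h (- r / s)%R s^-1%R)))%E.
Proof.
rewrite {}/al {}/be {}/ga => a0; elim: p A => [|p IH] A pA; last first.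
  have trA : (A : 'M[R]_(1 + p.+2))^T = A by case: pA.
  have [K K0 HK] := IH _ (@posdef_drsub _ p.+2 A pA).
  have /andP[r0 ry] := @rint_row_fin _ p.+2 a A a0 pA.
  have rfin : rint a (A : 'M[R]_(1 + p.+2)) (fun _ _ => 1%E) \is a fin_num.
    by rewrite ge0_fin_numE// ltW.
  exists (fine (rint a (A : 'M[R]_(1 + p.+2)) (fun _ _ => 1%E)) * K).
    by rewrite mulr_gt0// fine_gt0// r0 ry.
  move=> h mh h0.
  have i1 : iprev p.+1 = rshift 1 (iprev p) by exact/val_inj.
  have j1 : ord_max = rshift 1 ord_max :> 'I_(1 + p.+2) by exact/val_inj.
  pose H (N : 'M[R]_p.+2) := h (N (iprev p) ord_max) (N ord_max ord_max).
  have bH : borel H.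
    move=> d T f mf; apply: (measurableT_comp mh
      (g := fun t => (f t (iprev p) ord_max, f t ord_max ord_max))).
    by apply: measurable_fun_pair; exact: mf.
  have := @wint_inv _ p.+2 a A H trA bH (fun _ => h0 _ _).
  rewrite HK// EFinM fineK// -muleA !mxE -i1 -j1 => <-.
  by apply: eq_sint => M _; rewrite /H !mxE -i1 -j1.
have trA : (A : 'M[R]_(1 + 1))^T = A by case: pA.
have i0E : iprev 0 = lshift 1 0 :> 'I_(1 + 1) by exact/val_inj.
have j0E : ord_max = rshift 1 0 :> 'I_(1 + 1) by exact/val_inj.
set al := A _ _; set be := A _ _; set ga := A _ _.
pose q r := al + 2 * be * r + ga * r ^+ 2.
have E0 (k : R) : (k%:M : 'M[R]_1) 0 0 = k by rewrite mxE eqxx.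
have AE : A = bmx al be%:M ga%:M :> 'M[R]_(1 + 1).
  rewrite [LHS](sym_bmx trA) /al i0E; congr bmx.
    by apply/matrixP => i j; rewrite !ord1 /be i0E j0E !mxE eqxx mulr1n.
  by apply/matrixP => i j; rewrite !ord1 /ga j0E !mxE eqxx mulr1n.
have qfE d y : qform (A : 'M[R]_(1 + 1)) (row_mx d%:M y%:M) =
    al * d ^+ 2 + 2 * be * d * y + ga * y ^+ 2.
  rewrite AE qform_bmx tr_scalar_mx -scalar_mxM E0 /qform tr_scalar_mx -!scalar_mxM E0.
  by ring.
have q0 r : 0 < q r.
  have /posdefmxP[_ /(_ (row_mx 1%:M r%:M))] := pA; rewrite qfE.
  rewrite (_ : al * _ + _ + _ = q r); last by rewrite /q; ring.
  by apply; exact: (@row_mx1_neq0 1).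
have ga0 : 0 < ga by exact: posdef_diag_gt0.
have /andP[c0 cy] : (0 < \int[mu]_x (gamw (a + 1) 1 x)%:E < +oo)%E.
  by rewrite gamma_gt0//= gamma_lty// (le_trans a0)// lerDl.
have cfin : (\int[mu]_x (gamw (a + 1) 1 x)%:E)%E \is a fin_num.
  by rewrite ge0_fin_numE// ltW.
exists (fine (\int[mu]_x (gamw (a + 1) 1 x)%:E)%E).
  by rewrite fine_gt0// c0 cy.
move=> h mh h0.
pose F (M : 'M[R]_(1 + 1)) := h (invmx M (iprev 0) ord_max) (invmx M ord_max ord_max).
have bF : borel F.
  move=> d T f mf; apply: (measurableT_comp mh
    (g := fun t => (invmx (f t) (iprev 0) ord_max, invmx (f t) ord_max ord_max))).
  by apply: measurable_fun_pair; exact: mxmeas_inv.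
have F0 M : (0 <= F M)%E by exact: h0.
pose hs (z : R * R) := h (- z.1 / z.2) z.2^-1.
have mhs : measurable_fun setT hs.
  apply: (measurableT_comp mh (g := fun z : R * R => (- z.1 / z.2, z.2^-1))).
  apply: measurable_fun_pair; last exact: measurable_funV.
  by apply: measurable_funM; [apply: measurableT_comp|exact: measurable_funV].
have hs0 z : (0 <= hs z)%E by exact: h0.
(* The inner integral depends on (d, y) only through r = y / d. *)
pose Gf r := (\int[mu]_s ((gamw a ga s)%:E * hs (r, s)))%E.
have mgh : measurable_fun setT (fun z : R * R => (gamw a ga z.2)%:E * hs z)%E.
  apply: emeasurable_funM => //; apply/measurable_EFinP.
  exact: measurableT_comp (measurable_gamw _ _) measurable_snd.
have gh0 z : (0 <= (gamw a ga z.2)%:E * hs z)%E by rewrite mule_ge0// lee_fin gamw_ge0.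
have mGf : measurable_fun setT Gf.
  exact: (@measurable_fun_fubini_tonelli_F _ _ _ _ R mu _ mgh gh0).
have Gf0 r : (0 <= Gf r)%E by apply: integral_ge0 => s _; exact: (gh0 (r, s)).
have wdE s : wdens a (drsubmx (A : 'M[R]_(1 + 1))) s%:M = gamw a ga s.
  have dE : drsubmx (A : 'M[R]_(1 + 1)) = ga%:M by rewrite [in LHS]AE block_mxKdr.
  rewrite dE /wdens /gamw det_scalar1 -scalar_mxM mxtrace_scalar mulr1n.
  congr (if _ then _ else _); apply/asboolP/idP => [/(@posdef_diag_gt0 _ _ _ 0)|s0].
    by rewrite E0.
  apply/posdefmxP; split; first by rewrite tr_scalar_mx.
  move=> u u0; rewrite /qform [u]mx11_scalar tr_scalar_mx -!scalar_mxM E0.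
  rewrite mulrAC mulr_gt0// -expr2 exprn_even_gt0//=; apply: contra u0 => /eqP e.
  by rewrite [u]mx11_scalar e raddf0.
have wE d y : 0 < d ->
    wint a (drsubmx (A : 'M[R]_(1 + 1))) (fun M => F (schurmx d y%:M M)) = Gf (d^-1 * y).
  move=> d0; rewrite /wint sint1; last 2 first.
  - apply: borel_wint => d' T f mf; apply: bF.
    by apply: mxmeas_schurmx => //; exact: mxmeas_cst.
  - by move=> M; rewrite mule_ge0// lee_fin wdens_ge0.
  apply: eq_integral => s _; rewrite muleC wdE /gamw; case: ifPn => s0; last by rewrite !mul0e.
  have iE : invmx (s%:M : 'M[R]_1) = s^-1%:M by rewrite invmx_scalar.
  congr (_ * _)%E; rewrite /F invmx_schur ?gt_eqF//; last first.
    by rewrite unitmxE det_scalar1 unitfE gt_eqF.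
  rewrite i0E j0E block_mxEur block_mxEdr iE E0 mxE -scalar_mxM E0 /hs /=.
  by congr (h _ _); rewrite mulrA mulNr.
rewrite -[LHS]/(wint a (A : 'M[R]_(1 + 1)) F) (wint_schur a trA bF F0) /rint.
pose g2 (z : R * R) := (Gf z.2 * (gamw (a + 1) (q z.2) z.1)%:E)%E.
have mq : measurable_fun setT (fun z : R * R => q z.2).
  apply: measurable_funD; first apply: measurable_funD => //.
    by apply: measurable_funM.
  by apply: measurable_funM => //; apply: measurable_funX.
have mg2 : measurable_fun setT g2.
  apply: emeasurable_funM; first exact: measurableT_comp mGf measurable_snd.
  apply/measurable_EFinP; apply: measurable_fun_ifT => //; first exact: measurable_fun_ltr.
  apply: measurableT_comp => //; apply: measurable_funB.
    by apply: measurable_funM => //; apply: measurableT_comp.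
  by apply: measurable_funM => //; apply: measurable_funM.
have g20 z : (0 <= g2 z)%E by rewrite mule_ge0// lee_fin gamw_ge0.
transitivity (\int[mu]_d \int[mu]_r g2 (d, r))%E.
  apply: eq_integral => d _; rewrite rvint1; last 2 first.
  - move=> d' T f mf; apply: emeasurable_funM; last first.
      by apply/measurable_EFinP; exact: measurable_rdens.
    apply: (@measurable_sint _ _ _ _ (fun t M => F (schurmx d (f t) M) *
      (wdens a (drsubmx (A : 'M[R]_(1 + 1))) M)%:E)%E).
      move=> d'' T' g f' mg mf'; apply: emeasurable_funM.
        apply: bF; apply: mxmeas_schurmx => // i j.
        exact: (measurableT_comp (mf i j) mg).
      by apply/measurable_EFinP; exact: measurable_wdens.
    by move=> t M; rewrite mule_ge0// lee_fin wdens_ge0.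
  - by move=> c; rewrite mule_ge0 ?wint_ge0// lee_fin rdens_ge0.
  rewrite /g2 /gamw /rdens /=; have [d0|d0] := ltP 0 d; last first.
    by rewrite !integral0_eq// => y _; rewrite mule0.
  pose k (y : R) := (Gf (d^-1 * y)%R * (expR (a * ln d - d^-1 * (al * d ^+ 2 + 2 * be * d * y + ga * y ^+ 2) / 2))%:E)%E.
  transitivity (\int[mu]_y k y)%E.
    by apply: eq_integral => y _; rewrite wE// qfE.
  have mk : measurable_fun setT k.
    apply: emeasurable_funM.
      by apply: measurableT_comp => //; exact: measurable_funM.
    apply/measurable_EFinP; apply: measurableT_comp => //; apply: measurable_funB => //.
    apply: measurable_funM => //; apply: measurable_funM => //.
    by apply: measurable_funD; [apply: measurable_funD => //; apply: measurable_funM|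
      apply: measurable_funM => //; apply: measurable_funX].
  rewrite (@ge0_integral_affine _ d 0 k) ?gt_eqF//; last first.
    by move=> y; rewrite mule_ge0// lee_fin expR_ge0.
  rewrite gtr0_norm// -ge0_integralZl; last 4 first.
  - exact: measurableT.
  - apply: (measurableT_comp mk); apply: measurable_funD => //; exact: measurable_funM.
  - by move=> y _; rewrite mule_ge0// lee_fin expR_ge0.
  - by rewrite lee_fin ltW.
  apply: eq_integral => r _; rewrite /k addr0 mulKf ?gt_eqF// muleCA; congr (_ * _)%E.
  rewrite -EFinM -[X in X * _](lnK (d0 : d \in Num.pos)) -expRD; congr (expR _)%:E.
  by rewrite /q; field; rewrite gt_eqF.
rewrite (@fubini_tonelli _ _ _ _ R mu mu g2)//.
rewrite -ge0_integralZl; last 4 first.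
- exact: measurableT.
- apply: emeasurable_funM; last exact: mGf.
  apply/measurable_EFinP; apply: measurableT_comp => //; apply: measurable_funM => //.
  apply: measurableT_comp => //; apply: measurable_funD; last first.
    by apply: measurable_funM => //; apply: measurable_funX.
  by apply: measurable_funD => //; apply: measurable_funM.
- by move=> r _; rewrite mule_ge0 ?lee_fin ?expR_ge0//; exact: Gf0.
- by rewrite lee_fin fine_ge0// ltW.
apply: eq_integral => r _; rewrite /g2 /= ge0_integralZl; last 4 first.
- exact: measurableT.
- by apply/measurable_EFinP; exact: measurable_gamw.
- by move=> d _; rewrite lee_fin gamw_ge0.
- exact: Gf0.
rewrite gamma_scale// fineK// [X in X = _]muleC -muleA [RHS]muleCA; congr (_ * _)%E.
by congr (expR _)%:E; rewrite /q; ring.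
Qed.
End relabel.

(** * Standardized laws of one or two entries *)

Section standardized.
Context {R : realType}.
Local Notation mu := (@lebesgue_measure R).

(** The gamma density with exponent m / 2, in the variable e centred at the mode
m / l and scaled by sqrt (2 m) / l, about one standard deviation, normalized to
be 1 at e = 0. *)
Definition gmw (m e : R) : R := let w := 1 + Num.sqrt (2 / m) * e in
  if 0 < w then expR (m / 2 * (ln w - w + 1)) else 0.

(** The Student density with m - 1 degrees of freedom up to scale, normalized to
be 1 at 0. *)
Definition stw (m x : R) : R := expR (- (m / 2) * ln (1 + x ^+ 2 / m)).

Lemma gmw_ge0 m e : 0 <= gmw m e.
Proof. by rewrite /gmw; case: ifP => // _; exact: expR_ge0. Qed.

Lemma stw_ge0 m x : 0 <= stw m x. Proof. exact: expR_ge0. Qed.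

Lemma measurable_gmw m : measurable_fun setT (gmw m).
Proof.
have mw : measurable_fun setT (fun e : R => 1 + Num.sqrt (2 / m) * e).
  by apply: measurable_funD => //; exact: measurable_funM.
apply: measurable_fun_ifT; [exact: measurable_fun_ltr| |exact: measurable_cst].
apply: measurableT_comp => //; apply: measurable_funM => //.
apply: measurable_funD; last exact: measurable_cst.
by apply: measurable_funB => //; exact: measurableT_comp.
Qed.

Lemma measurable_stw m : measurable_fun setT (stw m).
Proof.
apply: measurableT_comp => //; apply: measurable_funM => //.
apply: measurableT_comp => //; apply: measurable_funD; first exact: measurable_cst.
by apply: measurable_funM; [apply: measurable_funX|exact: measurable_cst].
Qed.

Lemma gam_std (m l : R) : 0 < m -> 0 < l -> exists2 C : R, 0 < C &
  forall g : R -> \bar R, measurable_fun setT g -> (forall x, 0 <= g x)%E ->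
  (\int[mu]_d ((gamw (m / 2) l d)%:E * g d) =
   C%:E * \int[mu]_e ((gmw m e)%:E * g (m / l * (1 + Num.sqrt (2 / m) * e))%R))%E.
Proof.
move=> m0 l0; set a1 := m / l * Num.sqrt (2 / m).
have ml : 0 < m / l by rewrite divr_gt0.
have a10 : 0 < a1 by rewrite mulr_gt0// sqrtr_gt0 divr_gt0.
exists (a1 * expR (m / 2 * ln (m / l) - m / 2)); first by rewrite mulr_gt0// expR_gt0.
move=> g mg g0.
rewrite (ge0_integral_affine (m / l) (lt0r_neq0 a10)); last 2 first.
- by apply: emeasurable_funM => //; apply/measurable_EFinP; exact: measurable_gamw.
- by move=> x; rewrite mule_ge0// lee_fin gamw_ge0.
rewrite (gtr0_norm a10) [X in (_ = X * _)%E]EFinM -muleA; congr (_ * _)%E.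
rewrite -ge0_integralZl; last 4 first.
- exact: measurableT.
- apply: emeasurable_funM; first by apply/measurable_EFinP; exact: measurable_gmw.
  by apply: (measurableT_comp mg); apply: measurable_funM => //;
    apply: measurable_funD => //; apply: measurable_funM.
- by move=> x _; rewrite mule_ge0// lee_fin gmw_ge0.
- by rewrite lee_fin expR_ge0.
apply: eq_integral => e _; rewrite muleA -EFinM.
have -> : a1 * e + m / l = m / l * (1 + Num.sqrt (2 / m) * e) by rewrite /a1; ring.
congr (_%:E * _)%E; rewrite /gamw /gmw pmulr_rgt0//; case: ifPn => w0; last by rewrite mulr0.
rewrite -expRD lnM ?posrE//; congr expR; field.
by rewrite gt_eqF.
Qed.

(** Completing the square: al + 2 be r + ga r^2 = ka + ga (r + be / ga)^2. *)
Lemma stu_std (m al be ga : R) (ka := al - be ^+ 2 / ga) : 0 < m -> 0 < ga -> 0 < ka ->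
  exists2 C : R, 0 < C &
  forall g : R -> \bar R, measurable_fun setT g -> (forall x, 0 <= g x)%E ->
  (\int[mu]_r ((expR (- (m / 2) * ln (al + 2 * be * r + ga * r ^+ 2)))%:E * g r) =
   C%:E * \int[mu]_x ((stw m x)%:E * g (- be / ga + Num.sqrt (ka / ga / m) * x)%R))%E.
Proof.
move=> m0 ga0 ka0; set s := Num.sqrt (ka / ga / m).
have s0 : 0 < s by rewrite sqrtr_gt0 !divr_gt0.
exists (s * expR (- (m / 2) * ln ka)); first by rewrite mulr_gt0// expR_gt0.
move=> g mg g0.
rewrite (ge0_integral_affine (- be / ga) (lt0r_neq0 s0)); last 2 first.
- apply: emeasurable_funM => //; apply/measurable_EFinP; apply: measurableT_comp => //.
  apply: measurable_funM => //; apply: measurableT_comp => //; apply: measurable_funD.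
    by apply: measurable_funD => //; apply: measurable_funM.
  by apply: measurable_funM => //; apply: measurable_funX.
- by move=> x; rewrite mule_ge0// lee_fin expR_ge0.
rewrite (gtr0_norm s0) [X in (_ = X * _)%E]EFinM -muleA; congr (_ * _)%E.
rewrite -ge0_integralZl; last 4 first.
- exact: measurableT.
- apply: emeasurable_funM; first by apply/measurable_EFinP; exact: measurable_stw.
  by apply: (measurableT_comp mg); apply: measurable_funD => //; apply: measurable_funM.
- by move=> x _; rewrite mule_ge0// lee_fin stw_ge0.
- by rewrite lee_fin expR_ge0.
apply: eq_integral => x _; rewrite muleA -EFinM [(s * x + _)%R]addrC; congr (_%:E * _)%E.
have p1 : 0 < 1 + x ^+ 2 / m by rewrite ltr_pwDl// divr_ge0 ?sqr_ge0// ltW.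
rewrite /stw -expRD -mulrDr -lnM ?posrE//; congr (expR (_ * ln _)).
have s2 : s ^+ 2 = ka / ga / m by rewrite sqr_sqrtr// !divr_ge0// ltW.
have -> : al + 2 * be * (- be / ga + s * x) + ga * (- be / ga + s * x) ^+ 2 =
    ka + ga * s ^+ 2 * x ^+ 2 by rewrite /ka; field; rewrite gt_eqF.
by rewrite s2; field; rewrite !gt_eqF.
Qed.

Definition wprob (w : R * R -> R) (B : set (R * R)) : R :=
  fine (\int[mu \x mu]_z (w z * \1_B z)%:E)%E / fine (\int[mu \x mu]_z (w z)%:E)%E.

Lemma fineZ (K : R) (x : \bar R) : 0 < K -> fine (K%:E * x)%E = K * fine x.
Proof.
move=> K0; case: x => [r| |] //=; rewrite ?gt0_muley ?gt0_muleNy ?lte_fin//= mulr0//.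
Qed.

Lemma eq_wint p a (A : 'M[R]_p) F G : (forall M, posdefmx M -> F M = G M) ->
  wint a A F = wint a A G.
Proof.
move=> FG; apply: eq_sint => M _; rewrite /wdens; case: asboolP => [pM|]; last by rewrite !mule0.
by rewrite FG.
Qed.

Lemma indic_measurable_mx p (B : set (R * R)) (f : 'M[R]_p -> R * R) : measurable B ->
  (forall d (T : measurableType d) (g : T -> 'M[R]_p), mxmeas g -> measurable_fun setT (f \o g)) ->
  borel (fun M => (\1_[set M | B (f M)] M)%:E : \bar R).
Proof.
move=> mB mf d T g mg; apply/measurable_EFinP.
rewrite (_ : (fun _ => _) = \1_((f \o g) @^-1` B)); last first.
  by apply/funext => t; rewrite !indicE.
apply: measurable_indic; rewrite -[X in measurable X]setTI.
by apply: (mf _ _ _ mg).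
Qed.

Lemma posdef_schur2_gt0 p (A : 'M[R]_p) i j : i != j -> posdefmx A ->
  0 < A i i - A i j ^+ 2 / A j j.
Proof.
move=> ij pA; have Aj := posdef_diag_gt0 j pA; move/posdefmxP : (pA) => [trA qA].
set k := - (A i j / A j j).
pose u : 'rV[R]_p := delta_mx 0 i + k *: delta_mx 0 j.
have u0 : u != 0.
  apply/eqP => /matrixP/(_ 0 i); rewrite !mxE !eqxx (negbTE ij)/= mulr0 addr0 => /eqP.
  by rewrite oner_eq0.
have := qA _ u0; rewrite /qform.
have e r l : (delta_mx 0 r *m A *m (delta_mx 0 l)^T : 'M[R]_1) 0 0 = A r l.
  by rewrite -rowE trmx_delta -colE !mxE.
have Aji : A j i = A i j by rewrite -[in LHS]trA mxE.
have -> : u^T = (delta_mx 0 i)^T + k *: (delta_mx 0 j)^T by rewrite /u linearD/= linearZ.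
rewrite /u mulmxDl mulmxDl !mulmxDr -!scalemxAl -!scalemxAr.
rewrite !(mx11D, mx11Z) !e Aji; congr (_ < _); rewrite /k; field.
by rewrite gt_eqF.
Qed.

Lemma wint_inv_pair p a (A : 'M[R]_p) (i j : 'I_p) :
  - 2^-1 <= a -> i != j -> posdefmx A -> exists2 K : R, 0 < K &
  forall h : R -> R -> \bar R, measurable_fun setT (fun z : R * R => h z.1 z.2) ->
  (forall x y, 0 <= h x y)%E ->
  (wint a A (fun M => h (invmx M i j) (invmx M j j)) =
   K%:E * \int[mu]_r ((expR (- (a + 2) * ln (A i i + 2 * A i j * r + A j j * r ^+ 2)))%:E *
     \int[mu]_s ((gamw a (A j j) s)%:E * h (- r / s)%R s^-1%R)))%E.
Proof.
case: p i j A => [[]//|[|q]] i j A a0 ij pA; first by rewrite !ord1 in ij.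
have neq : iprev q != ord_max by rewrite -val_eqE/= neq_ltn ltnSn.
have [s [si sj]] := perm_to ij neq.
have pA' : posdefmx (relab s^-1%g A) by apply/posdef_relab.
have [K K0 HK] := wint_inv2 a0 pA'.
have rE k l : relab s^-1%g A (s k) (s l) = A k l by rewrite mxE !permK.
exists K; first exact: K0.
move=> h mh h0.
have ri : A i i = relab s^-1%g A (iprev q) (iprev q) by rewrite -si rE.
have rj : A j j = relab s^-1%g A ord_max ord_max by rewrite -sj rE.
have rij : A i j = relab s^-1%g A (iprev q) ord_max by rewrite -sj -si rE.
rewrite ri rj rij; apply: (etrans _ (HK h mh h0)).
rewrite (@wint_relab _ _ _ _ s); last 2 first.
- move=> d T f mf; apply: (measurableT_comp mh (g := fun t => (invmx (f t) i j, invmx (f t) j j))).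
  by apply: measurable_fun_pair; exact: mxmeas_inv.
- by move=> M; exact: h0.
apply: eq_wint => M pM; rewrite (invmx_relab _ (posdef_unit pM)) -si -sj.
by rewrite [relab s _ i j]mxE [relab s _ j j]mxE.
Qed.

Lemma wint_row_pair p a (A : 'M[R]_p) (i j : 'I_p) (N := invmx A) :
  - 2^-1 <= a -> i != j -> posdefmx A -> exists2 K : R, 0 < K &
  forall h : R -> R -> \bar R, measurable_fun setT (fun z : R * R => h z.1 z.2) ->
  (forall x y, 0 <= h x y)%E ->
  (wint a A (fun M => h (M i i) (M i j)) =
   K%:E * \int[mu]_d ((gamw (a + p.-1%:R / 2) (N i i)^-1 d)%:E *
     \int[mu]_z (h d (d * (N i j / N i i) +
       Num.sqrt (d * (N j j - N i j ^+ 2 / N i i)) * z)%R * (gaussw z)%:E)))%E.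
Proof.
case: p i j A @N => [[]//|[|q]] i j A N a0 ij pA; first by rewrite !ord1 in ij.
have neq : lshift q.+1 (0 : 'I_1) != rshift 1 ord_max by rewrite -val_eqE.
have [s [si sj]] := perm_to ij neq.
have pA' : posdefmx (relab s^-1%g A) by apply/posdef_relab.
have [C C0 HC] := @rint_row _ q a (relab s^-1%g A) pA'.
have [W W0 wE] : exists2 W : R, 0 < W &
    wint a (drsubmx (relab s^-1%g A : 'M[R]_(1 + q.+1))) (fun=> 1%E) = W%:E.
  have := wint_fin a0 (@posdef_drsub _ q.+1 _ pA'); case: (wint _ _ _) => [W||].
  - by rewrite lte_fin => /andP[W0 _]; exists W.
  - by rewrite ltxx andbF.
  - by rewrite ltNge leNye.
have rN k l : N k l = invmx (relab s^-1%g A) (s k) (s l).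
  by rewrite (invmx_relab _ (posdef_unit pA)) mxE !permK.
exists (C * W); first exact: mulr_gt0.
move=> h mh h0; rewrite !rN si sj.
have bF (k l : 'I_q.+2) : borel (fun M : 'M[R]_q.+2 => h (M k k) (M k l)).
  move=> d T f mf; apply: (measurableT_comp mh (g := fun t => (f t k k, f t k l))).
  by apply: measurable_fun_pair; exact: mf.
rewrite (@wint_relab _ _ _ _ s); last 2 first.
- exact: bF.
- by move=> M; exact: h0.
rewrite (@wint_row _ q.+1 a _ (fun M => h (relab s M i i) (relab s M i j))
  (fun d c => h d (c 0 ord_max))); last 6 first.
- by case: pA'.
- have := bF (s i) (s j); rewrite (_ : (fun M => h (relab s M i i) _) =
    (fun M : 'M[R]_q.+2 => h (M (s i) (s i)) (M (s i) (s j))))//.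
  by apply/funext => M; rewrite !mxE.
- by move=> M; exact: h0.
- move=> d' T' g f mg mf; apply: (measurableT_comp mh (g := fun t => (g t, f t 0 ord_max))).
  by apply: measurable_fun_pair => //; exact: mf.
- by move=> d c; exact: h0.
- move=> d c M; rewrite [relab s _ i i]mxE [relab s _ i j]mxE si sj /bmx; congr h.
    by apply: etrans (block_mxEul _ _ _ _ _ _) _; rewrite mxE eqxx.
  by apply: etrans (block_mxEur _ _ _ _ _ _) _.
by rewrite wE (HC h mh h0) EFinM muleAC.
Qed.

Section with_data.
Variables (n p b : nat) (x : 'I_n -> p.-tuple R).
Hypothesis b0 : (0 < b)%N.

(** Exact posterior law of (sigma_ij, sigma_jj): r is the Student part, s the
gamma part, and sigma_ij = - r / s, sigma_jj = 1 / s. *)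
Lemma posterior_cov (i j : 'I_p) (A := post_scale x) (m := 2 * post_exp n b)
    (r := fun e : R => - A i j / A j j +
      Num.sqrt ((A i i - A i j ^+ 2 / A j j) / A j j / (m + 4)) * e)
    (s := fun e : R => m / A j j * (1 + Num.sqrt (2 / m) * e)) (B : set (R * R)) :
  i != j -> 0 < m -> measurable B ->
  posterior b x [set M | B (invmx M i j, invmx M j j)] =
  wprob (fun z => stw (m + 4) z.1 * gmw m z.2)
    [set z | B (- r z.1 / s z.2, (s z.2)^-1)].
Proof.
move=> ij m0 mB; rewrite posteriorE//; last first.
  apply: (@indic_measurable_mx p B (fun M => (invmx M i j, invmx M j j))) => // d T g mg.
  by apply: measurable_fun_pair; exact: mxmeas_inv.
have pA : posdefmx A by exact: posdef_post_scale.
have ka0 : 0 < A i i - A i j ^+ 2 / A j j by exact: posdef_schur2_gt0.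
have ga0 : 0 < A j j by exact: posdef_diag_gt0.
have [K K0 HK] : exists2 K : R, 0 < K &
  forall h : R -> R -> \bar R, measurable_fun setT (fun z : R * R => h z.1 z.2) ->
  (forall x y, 0 <= h x y)%E ->
  (wint (post_exp n b) A (fun M => h (invmx M i j) (invmx M j j)) =
   K%:E * \int[mu]_r ((expR (- (post_exp n b + 2) * ln (A i i + 2 * A i j * r + A j j * r ^+ 2)))%:E *
     \int[mu]_s ((gamw (post_exp n b) (A j j) s)%:E * h (- r / s)%R s^-1%R)))%E by exact: wint_inv_pair (post_exp_ge n b0) ij pA.
have m40 : 0 < m + 4 by rewrite addr_gt0.
have [C1 C10 H1] := stu_std m40 ga0 ka0.
have [C2 C20 H2] := gam_std m0 ga0.
have mr : measurable_fun setT r.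
  by apply: measurable_funD => //; apply: measurable_funM.
have ms : measurable_fun setT s.
  by apply: measurable_funM => //; apply: measurable_funD => //; apply: measurable_funM.
have key h : measurable_fun setT (fun z : R * R => h z.1 z.2) ->
    (forall x y, 0 <= h x y)%E ->
    (wint (post_exp n b) A (fun M => h (invmx M i j) (invmx M j j)) =
     (K * (C2 * C1))%:E * \int[mu \x mu]_z ((stw (m + 4) z.1 * gmw m z.2)%:E *
        h (- r z.1 / s z.2)%R (s z.2)^-1%R))%E.
  move=> mh h0; rewrite HK// EFinM -muleA; congr (_ * _)%E.
  have eE1 : post_exp n b + 2 = (m + 4) / 2 by rewrite /m; field.
  have eE2 : post_exp n b = m / 2 by rewrite /m; field.
  have mh' (t : R) : measurable_fun setT (fun u : R => h (- t / u)%R u^-1%R).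
    apply: (measurableT_comp mh (g := fun u : R => (- t / u, u^-1))).
    by apply: measurable_fun_pair; [apply: measurable_funM => //|]; exact: measurable_funV.
  pose Hs t := (\int[mu]_e ((gmw m e)%:E * h (- t / s e)%R (s e)^-1%R))%E.
  pose HH (z : R * R) := ((gmw m z.2)%:E * h (- z.1 / s z.2)%R (s z.2)^-1%R)%E.
  have mHH : measurable_fun setT HH.
    apply: emeasurable_funM.
      by apply/measurable_EFinP; exact: measurableT_comp (measurable_gmw _) measurable_snd.
    apply: (measurableT_comp mh (g := fun z : R * R => (- z.1 / s z.2, (s z.2)^-1))).
    have ms2 : measurable_fun setT (fun z : R * R => (s z.2)^-1).
      by apply: measurable_funV; exact: measurableT_comp ms measurable_snd.
    by apply: measurable_fun_pair => //; apply: measurable_funM => //; apply: measurableT_comp.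
  have HH0 z : (0 <= HH z)%E by rewrite mule_ge0// lee_fin gmw_ge0.
  have mHs : measurable_fun setT Hs.
    exact: (@measurable_fun_fubini_tonelli_F _ _ _ _ R mu _ mHH HH0).
  have Hs0 t : (0 <= Hs t)%E by apply: integral_ge0 => e _; exact: (HH0 (t, e)).
  transitivity (C2%:E * \int[mu]_t ((expR (- ((m + 4) / 2) * ln (A i i + 2 * A i j * t + A j j * t ^+ 2)))%:E *
      Hs t))%E.
    rewrite -ge0_integralZl; last 4 first.
    - exact: measurableT.
    - apply: emeasurable_funM => //; apply/measurable_EFinP; apply: measurableT_comp => //.
      apply: measurable_funM => //; apply: measurableT_comp => //; apply: measurable_funD.
        by apply: measurable_funD => //; apply: measurable_funM.
      by apply: measurable_funM => //; apply: measurable_funX.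
    - by move=> t _; rewrite mule_ge0// lee_fin expR_ge0.
    - by rewrite lee_fin ltW.
    apply: eq_integral => t _; rewrite eE1 muleCA; congr (_ * _)%E.
    by rewrite eE2 H2.
  rewrite H1// EFinM -muleA; congr (_ * (_ * _))%E.
  rewrite fubini_tonelli1; last 2 first.
  - apply: emeasurable_funM.
      apply/measurable_EFinP; apply: measurable_funM.
        exact: measurableT_comp (measurable_stw _) measurable_fst.
      exact: measurableT_comp (measurable_gmw _) measurable_snd.
    have mrs : measurable_fun setT (fun z : R * R => (s z.2)^-1).
      by apply: measurable_funV; exact: measurableT_comp ms measurable_snd.
    apply: (measurableT_comp mh (g := fun z : R * R => (- r z.1 / s z.2, (s z.2)^-1))).
    apply: measurable_fun_pair => //; apply: measurable_funM => //.
    by apply: measurableT_comp => //; exact: measurableT_comp mr measurable_fst.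
  - by move=> z; rewrite mule_ge0// lee_fin mulr_ge0// ?stw_ge0 ?gmw_ge0.
  apply: eq_integral => e _; rewrite /fubini_F /= -ge0_integralZl; last 4 first.
  - exact: measurableT.
  - exact: (measurableT_comp mHH (measurable_fun_pair (measurable_cst (r e)) (@measurable_id _ _ _))).
  - by move=> t _; exact: (HH0 (r e, t)).
  - by rewrite lee_fin stw_ge0.
  by apply: eq_integral => t _; rewrite EFinM muleA.
have K0' : 0 < K * (C2 * C1) by rewrite !mulr_gt0.
have mB2 : measurable_fun setT (fun z : R * R => (\1_B (z.1, z.2))%:E : \bar R).
  apply/measurable_EFinP; rewrite (_ : (fun _ => _) = \1_B); first exact: measurable_indic.
  by apply/funext => -[].
have B01 (u v : R) : (0 <= (\1_B (u, v) : R)%:E)%E by rewrite lee_fin.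
move: (key (fun u v => (\1_B (u, v))%:E) mB2 B01) => /= e1.
move: (key (fun _ _ => 1%E) (measurable_cst _) (fun _ _ => lee01)) => /= e2.
rewrite (@eq_wint _ _ _ _ (fun M => (\1_B (invmx M i j, invmx M j j))%:E)); last by move=> M _; rewrite !indicE.
rewrite e1 e2 !fineZ// -mulf_div divff ?mul1r ?gt_eqF//; congr (fine _ / fine _).
by apply: eq_integral => z _; rewrite mule1.
Qed.

Lemma posterior_prec (i j : 'I_p) (N := invmx (post_scale x))
    (m := 2 * post_exp n b + p.-1%:R)
    (dd := fun e : R => m * N i i * (1 + Num.sqrt (2 / m) * e)) (B : set (R * R)) :
  i != j -> 0 < m -> measurable B ->
  posterior b x [set M | B (M i i, M i j)] =
  wprob (fun z => gmw m z.1 * gaussw z.2)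
    [set z | B (dd z.1, dd z.1 * (N i j / N i i) +
       Num.sqrt (dd z.1 * (N j j - N i j ^+ 2 / N i i)) * z.2)].
Proof.
move=> ij m0 mB; rewrite posteriorE//; last first.
  apply: (@indic_measurable_mx p B (fun M => (M i i, M i j))) => // d T g mg.
  by apply: measurable_fun_pair; exact: mg.
have pA : posdefmx (post_scale x) by exact: posdef_post_scale.
have Ni0 : 0 < N i i by apply: posdef_diag_gt0; exact: posdef_inv.
have [K K0 HK] := wint_row_pair (post_exp_ge n b0) ij pA.
have Nv0 : 0 < (N i i)^-1 by rewrite invr_gt0.
have [C1 C10 H1] := gam_std m0 Nv0.
have mdd : measurable_fun setT dd.
  by apply: measurable_funM => //; apply: measurable_funD => //; apply: measurable_funM.
pose yy (d z : R) := d * (N i j / N i i) + Num.sqrt (d * (N j j - N i j ^+ 2 / N i i)) * z.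
have myy : measurable_fun setT (fun z : R * R => (z.1, yy z.1 z.2)).
  apply: measurable_fun_pair => //; apply: measurable_funD.
    by apply: measurable_funM.
  apply: measurable_funM => //; apply: measurable_fun_sqrt.
  by apply: measurable_funM.
have key h : measurable_fun setT (fun z : R * R => h z.1 z.2) ->
    (forall x y, 0 <= h x y)%E ->
    (wint (post_exp n b) (post_scale x) (fun M => h (M i i) (M i j)) =
     (K * C1)%:E * \int[mu \x mu]_z ((gmw m z.1 * gaussw z.2)%:E *
        h (dd z.1) (yy (dd z.1) z.2)))%E.
  move=> mh h0; rewrite HK// EFinM -muleA; congr (_ * _)%E.
  have eE : post_exp n b + p.-1%:R / 2 = m / 2 by rewrite /m; field.
  pose HH (z : R * R) := (h z.1 (yy z.1 z.2) * (gaussw z.2)%:E)%E.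
  have mHH : measurable_fun setT HH.
    apply: emeasurable_funM; first exact: (measurableT_comp mh myy).
    by apply/measurable_EFinP; exact: measurableT_comp measurable_gaussw measurable_snd.
  have HH0 z : (0 <= HH z)%E by rewrite mule_ge0// lee_fin gaussw_ge0.
  pose G d := (\int[mu]_z (HH (d, z)))%E.
  have mG : measurable_fun setT G.
    exact: (@measurable_fun_fubini_tonelli_F _ _ _ _ R mu _ mHH HH0).
  have G0 d : (0 <= G d)%E by apply: integral_ge0 => z _; exact: HH0.
  transitivity (\int[mu]_d ((gamw (m / 2) (N i i)^-1 d)%:E * G d))%E.
    by apply: eq_integral => d _; rewrite eE.
  rewrite (H1 G mG G0); congr (_ * _)%E.
  rewrite fubini_tonelli1; last 2 first.
  - apply: emeasurable_funM.
      apply/measurable_EFinP; apply: measurable_funM.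
        exact: measurableT_comp (measurable_gmw _) measurable_fst.
      exact: measurableT_comp measurable_gaussw measurable_snd.
    apply: (measurableT_comp mh (g := fun z : R * R => (dd z.1, yy (dd z.1) z.2))).
    apply: (measurableT_comp myy (g := fun z : R * R => (dd z.1, z.2))).
    by apply: measurable_fun_pair => //; exact: measurableT_comp mdd measurable_fst.
  - by move=> z; rewrite mule_ge0// lee_fin mulr_ge0// ?gaussw_ge0 ?gmw_ge0.
  apply: eq_integral => e _; rewrite /fubini_F /= invrK -/(dd e) /G -ge0_integralZl; last 4 first.
  - exact: measurableT.
  - exact: (measurableT_comp mHH (measurable_fun_pair (measurable_cst (dd e)) (@measurable_id _ _ _))).
  - by move=> t _; exact: (HH0 (dd e, t)).
  - by rewrite lee_fin gmw_ge0.
  by apply: eq_integral => t _; rewrite /HH/= EFinM -muleA [(h _ _ * _)%E]muleC.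
have K0' : 0 < K * C1 by rewrite mulr_gt0.
have mB2 : measurable_fun setT (fun z : R * R => (\1_B (z.1, z.2))%:E : \bar R).
  apply/measurable_EFinP; rewrite (_ : (fun _ => _) = \1_B); first exact: measurable_indic.
  by apply/funext => -[].
have B01 (u v : R) : (0 <= (\1_B (u, v) : R)%:E)%E by rewrite lee_fin.
move: (key (fun u v => (\1_B (u, v))%:E) mB2 B01) => /= e1.
move: (key (fun _ _ => 1%E) (measurable_cst _) (fun _ _ => lee01)) => /= e2.
rewrite (@eq_wint _ _ _ _ (fun M => (\1_B (M i i, M i j))%:E)); last by move=> M _; rewrite !indicE.
rewrite e1 e2 !fineZ// -mulf_div divff ?mul1r ?gt_eqF//; congr (fine _ / fine _).
by apply: eq_integral => z _; rewrite mule1.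
Qed.

End with_data.
End standardized.

(** * Convergence and domination of the standardized densities *)

Section densities.
Context {R : realType}.
Local Notation mu := (@lebesgue_measure R).

Lemma ln1D_taylor2 (u : R) : `|u| <= 2^-1 ->
  `|ln (1 + u) - u + u ^+ 2 / 2| <= 2 * `|u| ^+ 3.
Proof.
pose f (x : R) := ln (1 + x) - x + x ^+ 2 / 2.
have df (x : R) : -1 < x -> is_derive x 1 f (x ^+ 2 / (1 + x)).
  move=> x1; have x0 : 0 < 1 + x by rewrite addrC -ltrBlDr sub0r.
  have d1 : is_derive x 1 (fun y : R => 1 + y) 1.
    by have := is_deriveD (is_derive_cst (1 : R) x 1) (is_derive_id x 1); rewrite add0r.
  have d2 : is_derive x 1 (fun y : R => ln (1 + y)) (1 + x)^-1.
    have := @is_derive1_comp R (@ln R) (fun y => 1 + y) x _ _ (is_derive1_ln x0) d1.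
    by rewrite mulr1.
  have d3 : is_derive x 1 (fun y : R => y ^+ 2 / 2) x.
    have := is_deriveM (is_deriveM (is_derive_id x 1) (is_derive_id x 1))
      (is_derive_cst (2^-1 : R) x 1).
    rewrite (_ : _ *: _ + _ = x); first by [].
    by rewrite /GRing.scale/=; field.
  have := is_deriveD (is_deriveB d2 (is_derive_id x 1)) d3.
  rewrite (_ : x ^+ 2 / (1 + x) = (1 + x)^-1 - 1 + x) //.
  by field; rewrite gt_eqF.
have key (a c : R) : a <= c -> - 2^-1 <= a ->
    exists2 y, y \in `[a, c] & f c - f a = y ^+ 2 / (1 + y) * (c - a).
  move=> ac a1; have lt1 y : a <= y -> -1 < y.
    by move=> ay; apply: lt_le_trans ay; apply: lt_le_trans a1; lra.
  apply: MVT_segment => // [y|].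
    by rewrite in_itv/= => /andP[/ltW ay _]; apply: df; exact: lt1.
  apply: derivable_within_continuous => y; rewrite in_itv/= => /andP[ay _].
  by have [] := df y (lt1 y ay).
have f0 : f 0 = 0 by rewrite /f addr0 ln1; ring.
rewrite -/(f u) => u2; have [u0|u0] := leP 0 u.
  have [|y] := @key 0 u u0; first by lra.
  rewrite in_itv/= f0 !subr0 => /andP[y0 yu] ->.
  rewrite !ger0_norm//; last by rewrite mulr_ge0// divr_ge0 ?sqr_ge0// addr_ge0.
  rewrite (_ : 2 * u ^+ 3 = 2 * u ^+ 2 * u); last by ring.
  apply: ler_wpM2r => //; rewrite ler_pdivrMr; last by lra.
  have : y ^+ 2 <= u ^+ 2 by rewrite lerXn2r// nnegrE.
  by have := sqr_ge0 u; nra.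
have un : - 2^-1 <= u by move: u2; rewrite ler_norml => /andP[].
have [|y] := @key u 0 (ltW u0); first by exact: un.
rewrite in_itv/= f0 !sub0r => /andP[uy y0] /eqP; rewrite eqr_oppLR => /eqP ->.
rewrite normrN normrM (normrN u); have y1 : 2^-1 <= 1 + y by lra.
have y1' : 0 < 1 + y by lra.
rewrite (_ : 2 * `|u| ^+ 3 = 2 * `|u| ^+ 2 * `|u|); last by ring.
apply: ler_wpM2r => //; rewrite ger0_norm; last by rewrite divr_ge0 ?sqr_ge0// ltW.
rewrite ler_pdivrMr// real_normK ?num_real//.
have : y ^+ 2 <= u ^+ 2 by rewrite -(sqrrN y) -(sqrrN u) lerXn2r ?nnegrE ?lerN2 ?oppr_ge0// ltW.
by have := sqr_ge0 u; nra.
Qed.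

Lemma cvg_dist_le (f g : nat -> R) (l : R) :
  (\forall k \near \oo, `|f k - l| <= g k) -> g k @[k --> \oo] --> 0 ->
  f k @[k --> \oo] --> l.
Proof.
move=> fg g0; have gl : l - g k @[k --> \oo] --> l.
  by rewrite -[X in _ --> X]subr0; apply: cvgB => //; exact: cvg_cst.
have gr : l + g k @[k --> \oo] --> l.
  by rewrite -[X in _ --> X]addr0; apply: cvgD => //; exact: cvg_cst.
apply: squeeze_cvgr gl gr; near=> k.
have : `|f k - l| <= g k by near: k.
by rewrite ler_norml lerBlDr lerBrDr addrC [g k + l]addrC.
Unshelve. all: by end_near. Qed.

Lemma cvg_2div (m : nat -> R) : (m k @[k --> \oo] --> +oo) -> 2 / m k @[k --> \oo] --> 0.
Proof.
move=> moo; have mV : (m k)^-1 @[k --> \oo] --> 0.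
  apply/cvgrVy; first by near=> k; rewrite invr_gt0; near: k; exact: cvgry_gt.
  rewrite (_ : unstable.inv_fun _ = m)//.
  by apply/funext => k; rewrite /unstable.inv_fun invrK.
by rewrite -[X in _ --> X](mulr0 2); apply: cvgM => //; exact: cvg_cst.
Unshelve. all: by end_near. Qed.

(** With u = sqrt (2 / m) e, second order Taylor expansion of ln (1 + u) - u
gives the exponent - e^2 / 2 up to an error of order u. *)
Lemma gmw_cvg (m : nat -> R) (e : R) : (m k @[k --> \oo] --> +oo) ->
  gmw (m k) e @[k --> \oo] --> gaussw e.
Proof.
move=> moo; pose u k := Num.sqrt (2 / m k) * e.
have u0 : u k @[k --> \oo] --> 0.
  rewrite -[X in _ --> X](mul0r e); apply: cvgM; last exact: cvg_cst.
  by rewrite -[X in _ --> X](@sqrtr0 R); apply: continuous_cvg;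
    [exact: sqrt_continuous|exact: cvg_2div].
have E : m k / 2 * (ln (1 + u k) - u k) @[k --> \oo] --> - e ^+ 2 / 2.
  apply: (@cvg_dist_le _ (fun k => 2 * e ^+ 2 * `|u k|)); last first.
    rewrite -[X in _ --> X](mulr0 (2 * e ^+ 2)); apply: cvgM; first exact: cvg_cst.
    by rewrite -[X in _ --> X](@normr0 _ R); exact: cvg_norm.
  near=> k; have mk0 : 0 < m k by near: k; exact: cvgry_gt.
  have uk : `|u k| <= 2^-1 by near: k; apply: cvgr0_norm_le => //; rewrite invr_gt0.
  have m2 : 0 <= 2 / m k by rewrite divr_ge0// ltW.
  have u2 : u k ^+ 2 = 2 / m k * e ^+ 2 by rewrite exprMn sqr_sqrtr.
  have -> : m k / 2 * (ln (1 + u k) - u k) - - e ^+ 2 / 2 =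
      m k / 2 * (ln (1 + u k) - u k + u k ^+ 2 / 2).
    by rewrite u2; field; rewrite gt_eqF.
  rewrite normrM gtr0_norm ?divr_gt0//.
  have -> : 2 * e ^+ 2 * `|u k| = m k / 2 * (2 * `|u k| ^+ 3).
    rewrite (exprSr `|u k| 2) real_normK ?num_real// u2; field.
    by rewrite gt_eqF.
  by rewrite ler_wpM2l ?ln1D_taylor2// divr_ge0// ltW.
apply: cvg_trans (continuous_cvg _ _ E); last exact: continuous_expR.
apply: near_eq_cvg; near=> k.
have uk : `|u k| <= 2^-1 by near: k; apply: cvgr0_norm_le => //; rewrite invr_gt0.
rewrite /gmw -/(u k) ifT; first by congr (expR (_ * _)); ring.
by move: uk; rewrite ler_norml => /andP[uk _]; lra.
Unshelve. all: by end_near. Qed.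

Lemma stw_cvg (m : nat -> R) (x : R) : (m k @[k --> \oo] --> +oo) ->
  stw (m k) x @[k --> \oo] --> gaussw x.
Proof.
move=> moo; pose v k := x ^+ 2 / m k.
have v0 : v k @[k --> \oo] --> 0.
  rewrite -[X in _ --> X](mulr0 (x ^+ 2 / 2)).
  rewrite (_ : v = fun k => x ^+ 2 / 2 * (2 / m k)); last by apply/funext => k; rewrite /v mulrA divfK.
  by apply: cvgM; [exact: cvg_cst|exact: cvg_2div].
have E : - (m k / 2) * ln (1 + v k) @[k --> \oo] --> - x ^+ 2 / 2.
  apply: (@cvg_dist_le _ (fun k => x ^+ 2 * `|v k|)); last first.
    rewrite -[X in _ --> X](mulr0 (x ^+ 2)); apply: cvgM; first exact: cvg_cst.
    by rewrite -[X in _ --> X](@normr0 _ R); exact: cvg_norm.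
  near=> k; have mk0 : 0 < m k by near: k; exact: cvgry_gt.
  have vk : `|v k| <= 2^-1 by near: k; apply: cvgr0_norm_le => //; rewrite invr_gt0.
  have v1 : 0 <= v k by rewrite divr_ge0 ?sqr_ge0// ltW.
  have -> : - (m k / 2) * ln (1 + v k) - - x ^+ 2 / 2 =
      - (m k / 2) * (ln (1 + v k) - v k).
    by rewrite /v; field; rewrite gt_eqF.
  rewrite normrM normrN (@gtr0_norm _ (m k / 2)) ?divr_gt0//.
  have -> : x ^+ 2 * `|v k| = m k / 2 * (2 * v k ^+ 2).
    by rewrite ger0_norm// /v; field; rewrite gt_eqF.
  rewrite ler_wpM2l//; first by rewrite divr_ge0// ltW.
  have := ln1D_taylor2 vk; rewrite (ger0_norm v1) in vk * => h.
  have -> : ln (1 + v k) - v k = (ln (1 + v k) - v k + v k ^+ 2 / 2) - v k ^+ 2 / 2 by ring.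
  apply: le_trans (ler_normB _ _) _.
  rewrite (ger0_norm (_ : 0 <= v k ^+ 2 / 2)); last by rewrite divr_ge0// sqr_ge0.
  have : v k ^+ 3 <= v k ^+ 2 * 2^-1 by rewrite (exprSr (v k) 2) ler_wpM2l// sqr_ge0.
  by have := sqr_ge0 (v k); lra.
by apply: (continuous_cvg _ _ E); exact: continuous_expR.
Unshelve. all: by end_near. Qed.

Definition cauchyw (x : R) : R := (1 + x ^+ 2)^-1.

Lemma cauchyw_gt0 x : 0 < cauchyw x.
Proof. by rewrite invr_gt0 ltr_pwDl// sqr_ge0. Qed.

Lemma measurable_cauchyw : measurable_fun setT cauchyw.
Proof.
by apply: measurable_funV; apply: measurable_funD => //; exact: measurable_funX.
Qed.

(** With s = sqrt w, ln w - w + 1 <= - (s - 1)^2 because ln s <= s - 1, and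
m (s - 1)^2 / 2 = e^2 / (s + 1)^2 grows at least like |e| / 2. The exponential
tail then lies below a multiple of the Cauchy density, for all m >= 2 at
once. *)
Lemma gmw_le m e : 2 <= m -> gmw m e <= 8 * expR 1 * cauchyw e.
Proof.
move=> m2; have m0 : 0 < m by lra.
have c0 := cauchyw_gt0 e.
rewrite /gmw; case: ifPn => w0; last by rewrite !mulr_ge0// ?expR_ge0// ltW.
set w := 1 + _ in w0 *.
have s0 : 0 < Num.sqrt w by rewrite sqrtr_gt0.
have ws : w = Num.sqrt w ^+ 2 by rewrite sqr_sqrtr// ltW.
set s := Num.sqrt w in s0 ws.
have lw : ln w - w + 1 <= - (s - 1) ^+ 2.
  have : ln s <= s - 1.
    by have := @le_ln1Dx R (s - 1); rewrite (_ : 1 + (s - 1) = s); [apply; lra|ring].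
  by rewrite ws lnXn// -(mulr_natl (ln s)); nra.
have we : (w - 1) ^+ 2 = 2 / m * e ^+ 2.
  rewrite /w (_ : 1 + _ - 1 = Num.sqrt (2 / m) * e); last by ring.
  by rewrite exprMn sqr_sqrtr// divr_ge0// ltW.
have we1 : (w - 1) ^+ 2 <= `|e| ^+ 2.
  rewrite we real_normK ?num_real// -[leRHS]mul1r ler_wpM2r ?sqr_ge0//.
  by rewrite ler_pdivrMr// mul1r.
have wabs : w - 1 <= `|e|.
  have [?|?] := leP (w - 1) 0; first exact: le_trans (normr_ge0 _).
  by rewrite -(@ler_pXn2r _ 2)// nnegrE ltW.
have se : e ^+ 2 = m / 2 * (s - 1) ^+ 2 * (s + 1) ^+ 2.
  have := we; rewrite ws (_ : (s ^+ 2 - 1) ^+ 2 = (s - 1) ^+ 2 * (s + 1) ^+ 2); last by ring.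
  by move=> h; rewrite -mulrA h; field; rewrite gt_eqF.
have s1 : (s + 1) ^+ 2 <= 4 + 2 * `|e|.
  by have := sqr_ge0 (s - 1); rewrite ws in wabs; nra.
(* From e^2 = m / 2 (s - 1)^2 (s + 1)^2 and (s + 1)^2 <= 4 + 2 |e|; the product
   (|e| / 2 - 1) (4 + 2 |e|) is e^2 - 4. *)
have main : `|e| / 2 - 1 <= m / 2 * (s - 1) ^+ 2.
  have a0 := normr_ge0 e.
  rewrite -(@ler_pM2r _ (4 + 2 * `|e|)); last by lra.
  apply: (@le_trans _ _ (e ^+ 2)).
    by rewrite -(real_normK (num_real e)); nra.
  rewrite se ler_wpM2l// mulr_ge0// ?sqr_ge0// divr_ge0// ltW//.
apply: (@le_trans _ _ (expR (1 + - (`|e| / 2)))).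
  rewrite ler_expR; have : m / 2 * (ln w - w + 1) <= m / 2 * - (s - 1) ^+ 2.
    by rewrite ler_wpM2l// divr_ge0// ltW.
  by lra.
rewrite expRD mulrAC [leRHS]mulrC ler_wpM2l ?expR_ge0//.
rewrite expRN /cauchyw -[8 / (1 + e ^+ 2)]invf_div lef_pV2 ?posrE ?expR_gt0//; last first.
  by rewrite divr_gt0// ltr_pwDl// sqr_ge0.
have := @expR_ge1Dxn R (`|e| / 2) 1; rewrite expr_div_n real_normK ?num_real//.
move=> h; apply: le_trans (h _); last by rewrite divr_ge0.
by have := sqr_ge0 e; rewrite /factorial/= ; lra.
Qed.

Lemma inv1D_half_le (x : R) : (1 + x ^+ 2 / 2)^-1 <= 2 * cauchyw x.
Proof.
have x2 := sqr_ge0 x.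
rewrite /cauchyw -[2 / (1 + x ^+ 2)]invf_div lef_pV2 ?posrE; last 2 first.
- by lra.
- by rewrite divr_gt0// ltr_pwDl.
by lra.
Qed.

(** The density decreases in m, so the case m = 2, a Cauchy density, bounds all
others; with v = x^2 / m the inequality is (1 + v)^(m/2) >= 1 + v m / 2. *)
Lemma stw_le m x : 2 <= m -> stw m x <= 2 * cauchyw x.
Proof.
move=> m2; have m0 : 0 < m by lra.
apply: le_trans (inv1D_half_le x); rewrite /stw mulNr expRN.
have x2 := sqr_ge0 x.
have z0 : 0 < 1 + x ^+ 2 / 2 by lra.
rewrite lef_pV2 ?posrE ?expR_gt0// -[leLHS]lnK ?posrE// ler_expR.
set v := x ^+ 2 / m; have v0 : 0 <= v by rewrite divr_ge0// ltW.
have y0 : 0 < 1 + v by lra.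
have xv : x ^+ 2 / 2 = m / 2 * v by rewrite /v; field; rewrite gt_eqF.
rewrite xv in z0 *.
have l1 : ln (1 + m / 2 * v) - ln (1 + v) <= (m / 2 - 1) * (v / (1 + v)).
  rewrite -ln_div ?posrE//.
  have e1 : (1 + m / 2 * v) / (1 + v) = 1 + (m / 2 - 1) * (v / (1 + v)).
    by field; rewrite gt_eqF.
  rewrite e1; apply: le_ln1Dx; apply: lt_le_trans (_ : 0 <= _); first by lra.
  by apply: mulr_ge0; [lra|apply: divr_ge0 => //; exact: ltW].
have l2 : v / (1 + v) <= ln (1 + v).
  have := @le_ln1Dx R (- (v / (1 + v))).
  have -> : 1 + - (v / (1 + v)) = (1 + v)^-1 by field; rewrite gt_eqF.
  rewrite lnV ?posrE// lerN2; apply.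
  by rewrite ltrN2 ltr_pdivrMr// mul1r; lra.
have m1 : 0 <= m / 2 - 1 by lra.
have := ler_wpM2l m1 l2; lra.
Qed.

Lemma gaussw_le x : gaussw x <= 2 * cauchyw x.
Proof.
apply: le_trans (inv1D_half_le x); rewrite /gaussw mulNr expRN.
have x2 := sqr_ge0 x.
rewrite lef_pV2 ?posrE ?expR_gt0//; last by lra.
exact: expR_ge1Dx.
Qed.

End densities.

(** * Uniform convergence to the normal distribution *)

Section limit.
Context {R : realType}.
Local Notation mu := (@lebesgue_measure R).
Local Notation M2 := (mu \x mu)%E.

Definition gauss2 (z : R * R) : R := gaussw z.1 * gaussw z.2.
Definition cauchy2 (z : R * R) : R := cauchyw z.1 * cauchyw z.2.

Lemma measurable_prodw (f g : R -> R) : measurable_fun setT f -> measurable_fun setT g ->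
  measurable_fun setT (fun z : R * R => f z.1 * g z.2).
Proof.
move=> mf mg; apply: measurable_funM; first exact: measurableT_comp mf measurable_fst.
exact: measurableT_comp mg measurable_snd.
Qed.

Lemma measurable_gauss2 : measurable_fun setT gauss2.
Proof. by apply: measurable_prodw; exact: measurable_gaussw. Qed.

Lemma gauss2_ge0 z : 0 <= gauss2 z. Proof. by rewrite mulr_ge0 ?gaussw_ge0. Qed.

Lemma measurable_lin (c d : R) : measurable_fun setT (fun z : R * R => c * z.1 + d * z.2).
Proof.
by apply: measurable_funD; apply: measurable_funM => //.
Qed.

(** A consequence of rotation invariance, by direct computation: for d <> 0
substitute the value of the linear form for y and integrate x out. *)
Lemma gauss_rot (c d : R) (f : R -> \bar R) : c ^+ 2 + d ^+ 2 = 1 ->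
  measurable_fun setT f -> (forall x, 0 <= f x)%E ->
  (\int[M2]_z ((gauss2 z)%:E * f (c * z.1 + d * z.2)%R) =
   (Num.sqrt (2 * pi))%:E * \int[mu]_x ((gaussw x)%:E * f x))%E.
Proof.
move=> cd mf f0; have mg : measurable_fun setT (fun x : R => (gaussw x)%:E : \bar R).
  by apply/measurable_EFinP; exact: measurable_gaussw.
have g0 (x : R) : (0 <= (gaussw x)%:E)%E by rewrite lee_fin gaussw_ge0.
rewrite fubini_tonelli1; last 2 first.
- apply: emeasurable_funM; first by apply/measurable_EFinP; exact: measurable_gauss2.
  exact: measurableT_comp mf (measurable_lin c d).
- by move=> z; rewrite mule_ge0// lee_fin gauss2_ge0.
have mfl (x : R) : measurable_fun setT (fun y : R => f (c * x + d * y)).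
  by apply: measurableT_comp => //; apply: measurable_funD => //; exact: measurable_funM.
transitivity (\int[mu]_x ((gaussw x)%:E * \int[mu]_y ((gaussw y)%:E * f (c * x + d * y)%R)))%E.
  apply: eq_integral => x _; rewrite /fubini_F -ge0_integralZl; last 4 first.
  - exact: measurableT.
  - exact: (emeasurable_funM mg (mfl x)).
  - by move=> y _; rewrite mule_ge0.
  - exact: g0.
  by apply: eq_integral => y _; rewrite EFinM muleA.
have [d0|d0] := eqVneq d 0.
  have c1 : c ^+ 2 = 1 by rewrite -cd d0 expr0n addr0.
  have c0 : c != 0 by apply/eqP => c0; move: c1; rewrite c0 expr0n => /eqP; rewrite eq_sym oner_eq0.
  have nc : `|c| = 1 by apply/eqP; rewrite -(@eqrXn2 _ 2)// real_normK ?num_real// c1 expr1n.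
  rewrite [in RHS](ge0_integral_affine 0 c0); last 2 first.
  - exact: (emeasurable_funM mg mf).
  - by move=> x; rewrite mule_ge0.
  rewrite nc mul1e -ge0_integralZl; last 4 first.
  - exact: measurableT.
  - apply: (measurableT_comp (emeasurable_funM mg mf) (g := fun x : R => c * x + 0)).
    by apply: measurable_funD => //; exact: measurable_funM.
  - by move=> x _; rewrite mule_ge0.
  - by rewrite lee_fin sqrtr_ge0.
  apply: eq_integral => x _; rewrite d0 addr0.
  have -> : gaussw (c * x) = gaussw x by rewrite /gaussw exprMn c1 mul1r.
  have -> : (\int[mu]_y ((gaussw y)%:E * f (c * x + 0 * y)%R) =
      (Num.sqrt (2 * pi))%:E * f (c * x)%R)%E.
    under eq_integral do rewrite mul0r addr0.
    rewrite ge0_integralZr//; first by rewrite integral_gaussw.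
  exact: muleCA.
have c2 : c ^+ 2 = 1 - d ^+ 2 by rewrite -cd addrK.
have nd0 : 0 < `|d| by rewrite normr_gt0.
set A := (X in X = _); set B := (X in _ = X).
suff key : (`|d|%:E * A = `|d|%:E * B)%E.
  have dV (x : \bar R) : x = (`|d|^-1%:E * (`|d|%:E * x))%E.
    by rewrite muleA -EFinM mulVf ?gt_eqF// mul1e.
  by rewrite (dV A) key -dV.
rewrite {}/A {}/B.
have mFy : measurable_fun setT (fun z : R * R =>
    (gaussw z.1)%:E * ((gaussw z.2)%:E * f (c * z.1 + d * z.2)%R))%E.
  apply: emeasurable_funM; first exact: measurableT_comp mg measurable_fst.
  apply: emeasurable_funM; first exact: measurableT_comp mg measurable_snd.
  exact: measurableT_comp mf (measurable_lin c d).
have mix (x : R) : measurable_fun setT (fun y : R => (gaussw y)%:E * f (c * x + d * y)%R)%E.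
  by exact: (emeasurable_funM mg (mfl x)).
have ix0 (x : R) : (0 <= \int[mu]_y ((gaussw y)%:E * f (c * x + d * y)%R))%E.
  by apply: integral_ge0 => y _; rewrite mule_ge0.
have E1 (x : R) : ((gaussw x)%:E * \int[mu]_y ((gaussw y)%:E * f (c * x + d * y)%R) =
    \int[mu]_y ((gaussw x)%:E * ((gaussw y)%:E * f (c * x + d * y)%R)))%E.
  rewrite ge0_integralZl; last 4 first.
  - exact: measurableT.
  - exact: mix.
  - by move=> y _; rewrite mule_ge0.
  - exact: g0.
  by [].
rewrite -ge0_integralZl; last 4 first.
- exact: measurableT.
- under eq_fun do rewrite E1.
  have := @measurable_fun_fubini_tonelli_F _ _ _ _ R mu _ mFy; apply.
  by move=> z; rewrite mule_ge0// mule_ge0.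
- by move=> x _; rewrite mule_ge0.
- by rewrite lee_fin.
pose F (z : R * R) := ((gaussw z.1 * gaussw ((z.2 - c * z.1) / d))%:E * f z.2)%E.
have mF : measurable_fun setT F.
  apply: emeasurable_funM; last exact: measurableT_comp mf measurable_snd.
  apply/measurable_EFinP; apply: measurable_funM.
    exact: measurableT_comp measurable_gaussw measurable_fst.
  apply: measurableT_comp; first exact: measurable_gaussw.
  by apply: measurable_funM => //; apply: measurable_funB => //; apply: measurable_funM.
have F0 z : (0 <= F z)%E by rewrite mule_ge0// lee_fin mulr_ge0// gaussw_ge0.
transitivity (\int[mu]_x \int[mu]_y F (x, y))%E.
  apply: eq_integral => x _.
  rewrite [RHS](ge0_integral_affine (c * x) d0); last 2 first.
  - exact: (measurableT_comp mF (measurable_fun_pair (measurable_cst x) (@measurable_id _ _ _))).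
  - by move=> y; exact: F0.
  congr (_ * _)%E; rewrite -ge0_integralZl; last 4 first.
  - exact: measurableT.
  - exact: (emeasurable_funM mg (mfl x)).
  - by move=> y _; rewrite mule_ge0.
  - exact: g0.
  apply: eq_integral => y _; rewrite /F/= EFinM muleA addrK mulrAC divff// mul1r.
  by rewrite addrC.
rewrite fubini_tonelli//.
transitivity (\int[mu]_y ((`|d| * Num.sqrt (2 * pi))%:E * ((gaussw y)%:E * f y)))%E; last first.
  rewrite ge0_integralZl; last 4 first.
  - exact: measurableT.
  - exact: (emeasurable_funM mg mf).
  - by move=> y _; rewrite mule_ge0.
  - by rewrite lee_fin mulr_ge0// sqrtr_ge0.
  by rewrite EFinM muleA.
apply: eq_integral => y _; rewrite /F/=.
have d20 : 0 < (d ^+ 2)^-1 by rewrite invr_gt0 exprn_even_gt0.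
transitivity (\int[mu]_x ((gaussw (y / d))%:E * f y *
    (expR (- ((d ^+ 2)^-1 * x ^+ 2 + 2 * (- (c * y / d ^+ 2)) * x) / 2))%:E))%E.
  apply: eq_integral => x _; rewrite muleAC -EFinM; congr (_%:E * _)%E.
  rewrite /gaussw -!expRD; congr expR.
  rewrite (_ : ((y - c * x) / d) ^+ 2 = (y ^+ 2 - 2 * c * x * y + c ^+ 2 * x ^+ 2) / d ^+ 2).
    by rewrite c2; field.
  by field.
rewrite ge0_integralZl; last 4 first.
- exact: measurableT.
- apply/measurable_EFinP; apply: measurableT_comp => //; apply: measurable_funM => //.
  apply: measurableT_comp => //; apply: measurable_funD; last exact: measurable_funM.
  by apply: measurable_funM => //; exact: measurable_funX.
- by move=> x _; rewrite lee_fin expR_ge0.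
- by rewrite mule_ge0.
rewrite gauss_int// invrK sqrtr_sqr muleAC muleA -!EFinM; congr (_%:E * _)%E.
transitivity (`|d| * Num.sqrt (2 * pi) * (gaussw (y / d) *
  expR ((- (c * y / d ^+ 2)) ^+ 2 / (2 / d ^+ 2)))); first by ring.
congr (_ * _).
rewrite /gaussw -expRD; congr expR.
transitivity (- (1 - c ^+ 2) * y ^+ 2 / (2 * d ^+ 2)); first by field.
by rewrite c2; field.
Qed.

Lemma indic_bool (T : Type) (b : T -> bool) z : \1_[set y | b y] z = (b z)%:R :> R.
Proof. by rewrite indicE; congr ((nat_of_bool _)%:R); apply/idP/idP; rewrite inE. Qed.

Lemma integral_gauss2 : (\int[M2]_z (gauss2 z)%:E = (2 * pi : R)%:E)%E.
Proof.
have cd : (1 : R) ^+ 2 + 0 ^+ 2 = 1 by ring.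
have := gauss_rot cd (measurable_cst 1%E) (fun=> lee01).
under eq_integral do rewrite mule1.
under [X in _ = (_ * X)%E -> _]eq_integral do rewrite mule1.
rewrite integral_gaussw => ->; rewrite -EFinM -expr2 sqr_sqrtr//.
by rewrite mulr_ge0// pi_ge0.
Qed.

Lemma normal_prob_gauss2 (c d t : R) : c ^+ 2 + d ^+ 2 = 1 ->
  fine (normal_prob 0 1 `]-oo, t]) = wprob gauss2 [set z | c * z.1 + d * z.2 <= t].
Proof.
move=> cd; have p0 : 0 < 2 * pi :> R by rewrite mulr_gt0// pi_gt0.
have s0 : 0 < Num.sqrt (2 * pi : R) by rewrite sqrtr_gt0.
have mI : measurable_fun setT (fun x : R => (\1_`]-oo, t] x)%:E : \bar R).
  by apply/measurable_EFinP; exact: measurable_indic.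
rewrite /wprob integral_gauss2 /=.
have -> : (\int[M2]_z (gauss2 z * \1_[set z | c * z.1 + d * z.2 <= t] z)%:E =
    (2 * pi)%:E * normal_prob 0 1 `]-oo, t])%E.
  transitivity (\int[M2]_z ((gauss2 z)%:E * (\1_`]-oo, t] (c * z.1 + d * z.2)%R)%:E))%E.
    apply: eq_integral => z _; rewrite -EFinM; congr (_ * _)%:E.
  rewrite (@gauss_rot c d (fun x => (\1_`]-oo, t] x)%:E))//.
  have pE : (2 * pi : R) = Num.sqrt (2 * pi) * Num.sqrt (2 * pi).
    by rewrite -expr2 sqr_sqrtr// ltW.
  rewrite [in RHS]pE [(Num.sqrt _ * Num.sqrt _)%:E]EFinM -muleA; congr (_ * _)%E.
  rewrite /normal_prob [X in (_ * X)%E]integral_mkcond epatch_indic -ge0_integralZl; last 4 first.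
  - exact: measurableT.
  - by apply: emeasurable_funM => //; apply/measurable_EFinP; exact: measurable_normal_pdf.
  - by move=> x _; rewrite mule_ge0 ?lee_fin ?normal_pdf_ge0.
  - by rewrite lee_fin ltW.
  by apply: eq_integral => x _; rewrite gaussw_normal EFinM muleA.
by rewrite fineZ// mulrAC divff ?mul1r// gt_eqF.
Qed.

(** The standard normal density is bounded, so a linear form rarely comes within e
of t, uniformly in t. *)
Lemma gauss_band (c d t e : R) : c ^+ 2 + d ^+ 2 = 1 -> 0 <= e ->
  (\int[M2]_z (gauss2 z * (`|c * z.1 + d * z.2 - t| <= e)%R%:R)%:E <=
   (Num.sqrt (2 * pi) * (2 * e))%:E)%E.
Proof.
move=> cd e0.
have mI : measurable_fun setT (fun x : R => (\1_`[t - e, t + e] x)%:E : \bar R).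
  by apply/measurable_EFinP; exact: measurable_indic.
have -> : (\int[M2]_z (gauss2 z * (`|c * z.1 + d * z.2 - t| <= e)%R%:R)%:E =
   \int[M2]_z ((gauss2 z)%:E * (\1_`[t - e, t + e] (c * z.1 + d * z.2)%R)%:E))%E.
  apply: eq_integral => z _; rewrite -EFinM; congr (_ * _)%:E.
  by rewrite indicE; congr ((nat_of_bool _)%:R); apply/idP/idP; rewrite inE/= in_itv/= ler_distl.
rewrite (@gauss_rot c d (fun x => (\1_`[t - e, t + e] x)%:E))// EFinM.
rewrite lee_wpmul2l ?lee_fin ?sqrtr_ge0//.
apply: (@le_trans _ _ (\int[mu]_x (\1_`[t - e, t + e] x)%:E)%E).
  apply: ge0_le_integral => //.
  - by move=> x _; rewrite mule_ge0// lee_fin gaussw_ge0.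
  - by apply: emeasurable_funM => //; apply/measurable_EFinP; exact: measurable_gaussw.
  move=> x _; rewrite -EFinM lee_fin ler_piMl//.
  by rewrite /gaussw expR_le1 mulNr oppr_le0 divr_ge0// sqr_ge0.
rewrite integral_indic// setIT.
suff : (lebesgue_measure `[(t - e)%R, (t + e)%R]%classic <= (2 * e)%:E)%E by [].
rewrite lebesgue_measure_itv/= lte_fin.
case: ifP => _; last by rewrite lee_fin mulr_ge0.
by rewrite -EFinB lee_fin; lra.
Qed.

Lemma integrable_cauchy2 (K : R) : M2.-integrable setT (EFin \o (fun z => K * cauchy2 z)).
Proof.
have mc : measurable_fun setT (EFin \o cauchy2).
  by apply/measurable_EFinP; apply: measurable_prodw; exact: measurable_cauchyw.
have c0 (z : R * R) : (0 <= (cauchy2 z)%:E)%E.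
  by rewrite lee_fin mulr_ge0// ltW// cauchyw_gt0.
have mc1 : measurable_fun setT (fun x : R => (cauchyw x)%:E).
  by apply/measurable_EFinP; exact: measurable_cauchyw.
have c10 (x : R) : (0 <= (cauchyw x)%:E)%E by rewrite lee_fin ltW// cauchyw_gt0.
have fI : (\int[mu]_x (cauchyw x)%:E)%E \is a fin_num.
  by rewrite ge0_fin_numE ?integral_ge0//; exact: integral_cauchy_lty.
suff : M2.-integrable setT (EFin \o cauchy2).
  move=> ic; rewrite (_ : _ \o _ = fun z => K%:E * (EFin \o cauchy2) z)%E.
    by apply: integrableZl.
  by apply/funext => z; rewrite /= EFinM.
apply/integrableP; split => //.
rewrite (@eq_integral _ _ _ M2 setT (EFin \o cauchy2)); last first.
  by move=> z _; rewrite gee0_abs// c0.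
rewrite fubini_tonelli1//.
under eq_integral.
  move=> x _; rewrite /fubini_F/=.
  under eq_integral do rewrite /cauchy2/= EFinM.
  rewrite ge0_integralZl//.
  over.
by rewrite ge0_integralZr ?integral_ge0// -(fineK fI) -EFinM ltry.
Qed.

Lemma integrable_dom (f : R * R -> R) K : measurable_fun setT f ->
  (forall z, `|f z| <= K * cauchy2 z) -> M2.-integrable setT (EFin \o f).
Proof.
move=> mf fK; apply: le_integrable (integrable_cauchy2 K) => //.
  exact/measurable_EFinP.
by move=> z _; rewrite /= lee_fin (le_trans (fK z))// ler_norm.
Qed.

Lemma gauss2_le z : gauss2 z <= 4 * cauchy2 z.
Proof.
rewrite (_ : 4 * cauchy2 z = (2 * cauchyw z.1) * (2 * cauchyw z.2)); last by rewrite /cauchy2; ring.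
by apply: ler_pM; rewrite ?gaussw_ge0 ?gaussw_le.
Qed.

Lemma measurable_natb d (T : measurableType d) (b : T -> bool) :
  measurable_fun setT b -> measurable_fun setT (fun z => (b z)%:R : R).
Proof.
move=> mb; rewrite (_ : (fun _ => _) = fun z => if b z then 1 else 0).
  exact: measurable_fun_ifT.
by apply/funext => z; case: (b z).
Qed.

(** The indicators of H <= t and L <= t differ only if H and L are more than e
apart or L is within e of t. *)
Lemma limit_split (w g H L t e : R) : 0 <= g ->
  `|w * (H <= t)%R%:R - g * (L <= t)%R%:R| <=
  `|w - g| + g * (e < `|H - L|)%R%:R + g * (`|L - t| <= e)%R%:R.
Proof.
move=> g0; have r0 (b b' : bool) : 0 <= g * b%:R + g * b'%:R.
  by rewrite addr_ge0// mulr_ge0.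
rewrite -addrA; case: (leP H t) => Ht; case: (leP L t) => Lt; rewrite ?mulr1 ?mulr0 ?subr0.
- by rewrite lerDl.
- have h : g <= g * (e < `|H - L|)%R%:R + g * (`|L - t| <= e)%R%:R.
    case: (ltP e `|H - L|) => [_|HL]; first by rewrite mulr1 lerDl mulr_ge0.
    have Le : `|L - t| <= e by move: HL; rewrite !ler_norml; lra.
    by rewrite Le mulr0 add0r mulr1.
  have := ler_normD (w - g) g; rewrite subrK (ger0_norm g0); lra.
- rewrite sub0r normrN (ger0_norm g0).
  have h : g <= g * (e < `|H - L|)%R%:R + g * (`|L - t| <= e)%R%:R.
    case: (ltP e `|H - L|) => [_|HL]; first by rewrite mulr1 lerDl mulr_ge0.
    have Le : `|L - t| <= e by move: HL; rewrite !ler_norml; lra.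
    by rewrite Le mulr0 add0r mulr1.
  by have := normr_ge0 (w - g); lra.
- by rewrite normr0 addr_ge0.
Qed.

(** If densities converge under an integrable dominating function, the laws
converge in total variation, uniformly over events. The indicators of H <= t and
L <= t are compared by [limit_split]: the first exceptional event has small
Gaussian probability by dominated convergence, independently of t, the second
by [gauss_band]. The linear form L may vary with k since it always has the
standard normal law. *)
Lemma wprob_limit (w H : nat -> R * R -> R) (c d : nat -> R) (K : R) :
  (forall k, measurable_fun setT (w k)) ->
  (forall k z, 0 <= w k z <= K * cauchy2 z) ->
  (forall z, w k z @[k --> \oo] --> gauss2 z) ->
  (forall k, measurable_fun setT (H k)) ->
  (forall z, H k z - (c k * z.1 + d k * z.2) @[k --> \oo] --> 0) ->
  (forall k, c k ^+ 2 + d k ^+ 2 = 1) ->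
  forall e, 0 < e -> \forall k \near \oo, forall t,
    `|wprob (w k) [set z | H k z <= t] - fine (normal_prob 0 1 `]-oo, t])| <= e.
Proof.
move=> mw wK wg mH HL cd e e0.
have p2 : 2 <= (pi : R) by exact: pi_ge2.
pose q := Num.sqrt (2 * pi : R); have q0 : 0 < q by rewrite sqrtr_gt0; lra.
(* Half-width for which [gauss_band] gives e / 4. *)
pose de := e / (8 * q); have de0 : 0 < de by rewrite divr_gt0// mulr_gt0.
pose L k (z : R * R) := c k * z.1 + d k * z.2.
have mL k : measurable_fun setT (L k) by exact: measurable_lin.
pose I (f : R * R -> R) := Rintegral M2 setT f.
have wn k z : `|w k z| <= K * cauchy2 z.
  by have /andP[w0 wz] := wK k z; rewrite ger0_norm.
have gn z : `|gauss2 z| <= 4 * cauchy2 z by rewrite ger0_norm ?gauss2_le ?gauss2_ge0.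
have mg := measurable_gauss2.
have b1 (x : R) (b : bool) : `|x * b%:R| <= `|x|.
  by rewrite normrM ler_piMr// ger0_norm//; case: b.
pose TV k := I (fun z => `|w k z - gauss2 z|).
pose S k := I (fun z => gauss2 z * (de < `|H k z - L k z|)%R%:R).
have mb k : measurable_fun setT (fun z => (de < `|H k z - L k z|)%R%:R : R).
  apply: measurable_natb; apply: measurable_fun_ltr => //.
  by apply: measurableT_comp => //; exact: measurable_funB.
have TV0 : TV k @[k --> \oo] --> 0.
  have [|||||_ h _] := @dominated_convergence _ _ _ M2 setT measurableT
    (fun k => EFin \o w k) (EFin \o gauss2) (EFin \o (fun z => K * cauchy2 z)).
  - by move=> k; apply/measurable_EFinP; exact: mw.
  - by apply/measurable_EFinP; exact: mg.
  - by apply: aeW => z _; apply: cvg_EFin; [exact: nearW|exact: wg].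
  - exact: integrable_cauchy2.
  - by apply: aeW => z k _; rewrite /= lee_fin wn.
  exact: (fine_cvg h).
have mS k : measurable_fun setT (fun z => gauss2 z * (de < `|H k z - L k z|)%R%:R).
  exact: measurable_funM.
have gb z (b : bool) : `|gauss2 z * b%:R| <= 4 * cauchy2 z.
  exact: le_trans (b1 _ _) (gn z).
have S0 : S k @[k --> \oo] --> 0.
  have [|||||_ _ h] := @dominated_convergence _ _ _ M2 setT measurableT
    (fun k => EFin \o (fun z => gauss2 z * (de < `|H k z - L k z|)%R%:R)) (cst 0%E)
    (EFin \o (fun z => 4 * cauchy2 z)).
  - by move=> k; apply/measurable_EFinP; exact: mS.
  - exact: measurable_cst.
  - apply: aeW => z _; apply: cvg_EFin; first exact: nearW.
    apply: (@cvg_trans _ ((fun=> 0 : R) @ \oo)); last exact: cvg_cst.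
    apply: near_eq_cvg; near=> k.
    have HLk : `|H k z - L k z| <= de by near: k; exact: (cvgr0_norm_le _ (HL z)).
    by rewrite /= ltNge HLk mulr0.
  - exact: integrable_cauchy2.
  - by apply: aeW => z k _; rewrite /= lee_fin gb.
  by move: h; rewrite integral0 => h; exact: (fine_cvg h).
have TVe : \forall k \near \oo, `|TV k| <= Num.min 1 (e / 4).
  by apply: cvgr0_norm_le => //; rewrite lt_min ltr01 divr_gt0.
have Se : \forall k \near \oo, `|S k| <= e / 4.
  by apply: cvgr0_norm_le => //; rewrite divr_gt0.
near=> k => t.
have Tk : TV k <= Num.min 1 (e / 4) by apply: le_trans (ler_norm _) _; near: k; exact: TVe.
have Sk : S k <= e / 4 by apply: le_trans (ler_norm _) _; near: k; exact: Se.
rewrite (normal_prob_gauss2 t (cd k)) /wprob.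
pose N := I (fun z => w k z * (H k z <= t)%R%:R).
pose N0 := I (fun z => gauss2 z * (L k z <= t)%R%:R).
have -> : fine (\int[M2]_z (w k z * \1_[set z | H k z <= t] z)%:E)%E = N.
  by congr (fine _); apply: eq_integral => z _; rewrite (indic_bool (fun z => H k z <= t)).
have -> : fine (\int[M2]_z (gauss2 z * \1_[set z | c k * z.1 + d k * z.2 <= t] z)%:E)%E = N0.
  by congr (fine _); apply: eq_integral => z _; rewrite (indic_bool (fun z => L k z <= t)).
have -> : fine (\int[M2]_z (w k z)%:E)%E = I (w k) by [].
rewrite integral_gauss2 /=.
have mle (h : R * R -> R) : measurable_fun setT h ->
    measurable_fun setT (fun z => (h z <= t)%R%:R : R).
  by move=> mh; apply: measurable_natb; exact: measurable_fun_ler.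
have iw : M2.-integrable setT (EFin \o w k) by exact: integrable_dom (mw k) (wn k).
have ig : M2.-integrable setT (EFin \o gauss2) by exact: integrable_dom mg gn.
have iN : M2.-integrable setT (EFin \o (fun z => w k z * (H k z <= t)%R%:R)).
  apply: (@integrable_dom _ K); first by apply: measurable_funM => //; exact: mle.
  by move=> z; exact: le_trans (b1 _ _) (wn k z).
have iN0 : M2.-integrable setT (EFin \o (fun z => gauss2 z * (L k z <= t)%R%:R)).
  by apply: (@integrable_dom _ 4) => //; apply: measurable_funM => //; exact: mle.
have iTV : M2.-integrable setT (EFin \o (fun z => `|w k z - gauss2 z|)).
  apply: (@integrable_dom _ (K + 4)).
    by apply: measurableT_comp => //; exact: measurable_funB.
  move=> z; rewrite normr_id mulrDl; apply: le_trans (ler_normB _ _) _.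
  by rewrite lerD.
have iS : M2.-integrable setT (EFin \o (fun z => gauss2 z * (de < `|H k z - L k z|)%R%:R)).
  exact: (@integrable_dom _ 4).
have iB : M2.-integrable setT (EFin \o (fun z => gauss2 z * (`|L k z - t| <= de)%R%:R)).
  apply: (@integrable_dom _ 4) => //; apply: measurable_funM => //.
  apply: measurable_natb; apply: measurable_fun_ler => //.
  by apply: measurableT_comp => //; exact: measurable_funB.
have B1 : I (fun z => gauss2 z * (`|L k z - t| <= de)%R%:R) <= e / 4.
  have := gauss_band t (cd k) (ltW de0); rewrite -/q.
  have -> : q * (2 * de) = e / 4 by rewrite /de; field; rewrite gt_eqF.
  move=> h; rewrite -lee_fin; apply: le_trans h; rewrite /I /Rintegral fineK//.
  exact: integrable_fin_num.
have iD : M2.-integrable setT (EFin \o (fun z => w k z - gauss2 z)).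
  apply: (@integrable_dom _ (K + 4)); first exact: measurable_funB.
  by move=> z; rewrite mulrDl; apply: le_trans (ler_normB _ _) _; rewrite lerD.
have iND : M2.-integrable setT
    (EFin \o (fun z => w k z * (H k z <= t)%R%:R - gauss2 z * (L k z <= t)%R%:R)).
  apply: (@integrable_dom _ (K + 4)).
    by apply: measurable_funB; apply: measurable_funM => //; exact: mle.
  move=> z; rewrite mulrDl; apply: le_trans (ler_normB _ _) _.
  by apply: lerD => //; exact: le_trans (b1 _ _) (wn k z).
have D1 : `|N - N0| <= TV k + S k + e / 4.
  rewrite /N /N0 /I -RintegralB//.
  apply: (le_trans (le_normr_Rintegral measurableT iND)).
  apply: (@le_trans _ _ (I (fun z => `|w k z - gauss2 z| +
      gauss2 z * (de < `|H k z - L k z|)%R%:R + gauss2 z * (`|L k z - t| <= de)%R%:R))).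
    apply: le_Rintegral => //.
    - exact: (integrable_norm iND).
    - by apply: (integrableD _ (integrableD _ iTV iS) iB).
    - by move=> z _; apply: limit_split; exact: gauss2_ge0.
  rewrite /I (RintegralD _ (integrableD _ iTV iS) iB)//.
  by rewrite (RintegralD _ iTV iS)// lerD.
have T1 : `|I (w k) - 2 * pi| <= TV k.
  have -> : 2 * pi = I gauss2 by rewrite /I /Rintegral integral_gauss2.
  rewrite /I -RintegralB//.
  exact: le_normr_Rintegral.
have N00 : 0 <= N0 by apply: Rintegral_ge0 => z _; rewrite mulr_ge0// gauss2_ge0.
have N01 : N0 <= 2 * pi.
  have -> : 2 * pi = I gauss2 by rewrite /I /Rintegral integral_gauss2.
  apply: le_Rintegral => // z _; rewrite ler_piMr ?gauss2_ge0//.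
  by case: (L k z <= t)%R; rewrite ?lexx ?ler01.
move: Tk; rewrite le_min => /andP[Tk1 Tk2].
have I1 : 1 <= I (w k) by move: T1; rewrite ler_norml; lra.
have -> : N / I (w k) - N0 / (2 * pi) =
   ((N - N0) - N0 / (2 * pi) * (I (w k) - 2 * pi)) / I (w k).
  by field; apply/andP; split; lra.
rewrite normrM normfV (gtr0_norm (_ : 0 < I (w k))); last by lra.
rewrite ler_pdivrMr; last by lra.
apply: le_trans (_ : e <= _); last by rewrite ler_peMr// ltW.
apply: le_trans (ler_normB _ _) _; rewrite normrM.
have r1 : `|N0 / (2 * pi)| <= 1.
  by rewrite ger0_norm ?divr_ge0// ?ler_pdivrMr ?mul1r//; lra.
have : `|N0 / (2 * pi)| * `|I (w k) - 2 * pi| <= 1 * TV k by apply: ler_pM.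
lra.
Unshelve. all: by end_near. Qed.

End limit.

(** * Asymptotics of the standardized statistics *)

Section scalar_limits.
Context {R : realType}.

(** The coefficients u and v come from the data and need not converge; being
bounded, they do not disturb the convergence of the factors around them. *)
Lemma lin_comb_cvg (rho a b g u v : nat -> R) (a0 b0 : R) :
  rho k @[k --> \oo] --> (1 : R) -> a k @[k --> \oo] --> a0 -> b k @[k --> \oo] --> b0 ->
  g k @[k --> \oo] --> 0 -> (forall k, `|u k| <= 1) -> (forall k, `|v k| <= 1) ->
  rho k * (a k * u k + b k * v k) + g k - (a0 * u k + b0 * v k) @[k --> \oo] --> 0.
Proof.
move=> rho1 aa bb g0 u1 v1.
have ra : rho k * a k - a0 @[k --> \oo] --> 1 * a0 - a0.
  by apply: cvgB; [apply: cvgM|exact: cvg_cst].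
rewrite mul1r subrr in ra.
have rb : rho k * b k - b0 @[k --> \oo] --> 1 * b0 - b0.
  by apply: cvgB; [apply: cvgM|exact: cvg_cst].
rewrite mul1r subrr in rb.
apply: (@cvg_dist_le _ _ (fun k => `|rho k * a k - a0| + `|rho k * b k - b0| + `|g k|)); last first.
  rewrite -[X in _ --> X]addr0 -[X in _ --> X + _]addr0.
  by apply: cvgD; [apply: cvgD|]; rewrite -(@normr0 _ R); exact: cvg_norm.
apply: nearW => k; rewrite subr0.
have -> : rho k * (a k * u k + b k * v k) + g k - (a0 * u k + b0 * v k) =
  (rho k * a k - a0) * u k + (rho k * b k - b0) * v k + g k by ring.
apply: le_trans (ler_normD _ _) _; rewrite lerD2r.
apply: le_trans (ler_normD _ _) _; rewrite !normrM.
by apply: lerD; rewrite -[leRHS]mulr1 ler_wpM2l.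
Qed.

Lemma unit_bound (u v : R) : 2 * u ^+ 2 + v ^+ 2 = 1 -> `|u| <= 1 /\ `|v| <= 1.
Proof.
move=> uv; split; rewrite -(@ler_pXn2r _ 2) ?nnegrE// expr1n real_normK ?num_real//.
  by have := sqr_ge0 u; have := sqr_ge0 v; lra.
by have := sqr_ge0 u; have := sqr_ge0 v; lra.
Qed.

Variables (N m : nat -> R).
Hypothesis Noo : N k @[k --> \oo] --> +oo.
Hypothesis moo : m k @[k --> \oo] --> +oo.
Hypothesis N0 : forall k, 0 < N k.
Hypothesis m0 : forall k, 0 < m k.
(* N is the sample size and m / 2 the exponent of the gamma part; N and m may
   differ by o(sqrt N) without moving the centre of the limit law. *)
Hypothesis mN : (m k - N k) / Num.sqrt (N k) @[k --> \oo] --> 0.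

Lemma cvg_sqrt (f : nat -> R) (l : R) : f k @[k --> \oo] --> l ->
  Num.sqrt (f k) @[k --> \oo] --> Num.sqrt l.
Proof. by move=> fl; apply: continuous_cvg => //; exact: sqrt_continuous. Qed.

Lemma cvg_Vsqrt : (Num.sqrt (N k))^-1 @[k --> \oo] --> 0.
Proof.
have h : Num.sqrt (2 / N k / 2) @[k --> \oo] --> 0.
  rewrite -(@sqrtr0 R); apply: cvg_sqrt; rewrite -(mul0r (2^-1)).
  by apply: cvgM; [exact: cvg_2div|exact: cvg_cst].
rewrite (_ : (fun k => _) = (fun k => Num.sqrt (2 / N k / 2)))//.
apply/funext => k; rewrite -sqrtrV ?ltW//; congr Num.sqrt.
by rewrite mulrAC divff// mul1r.
Qed.

Lemma ratio_cvg1 : m k / N k @[k --> \oo] --> (1 : R).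
Proof.
have h : 1 + (m k - N k) / Num.sqrt (N k) * (Num.sqrt (N k))^-1 @[k --> \oo] --> (1 : R).
  rewrite -[X in _ --> X]addr0; apply: cvgD; first exact: cvg_cst.
  by rewrite -[X in _ --> X](mulr0 0); apply: cvgM => //; exact: cvg_Vsqrt.
rewrite (_ : (fun k => _) = (fun k => 1 + (m k - N k) / Num.sqrt (N k) * (Num.sqrt (N k))^-1))//.
apply/funext => k; have := N0 k; rewrite -sqrtr_gt0 => s0.
have sN : N k = Num.sqrt (N k) ^+ 2 by rewrite sqr_sqrtr// ltW.
by rewrite {1 2}sN; field; rewrite gt_eqF.
Qed.

Lemma w_cvg1 (eta : R) : 1 + Num.sqrt (2 / m k) * eta @[k --> \oo] --> (1 : R).
Proof.
rewrite -[X in _ --> X]addr0; apply: cvgD; first exact: cvg_cst.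
rewrite -(mul0r eta); apply: cvgM; last exact: cvg_cst.
by rewrite -(@sqrtr0 R); apply: cvg_sqrt; exact: cvg_2div.
Qed.

Lemma alpha1_cvg (eta : R) :
  Num.sqrt (N k) * (m k / N k * (1 + Num.sqrt (2 / m k) * eta) - 1) @[k --> \oo] -->
  Num.sqrt 2 * eta.
Proof.
have h : (m k - N k) / Num.sqrt (N k) + Num.sqrt 2 * Num.sqrt (m k / N k) * eta @[k --> \oo]
    --> 0 + Num.sqrt 2 * 1 * eta.
  apply: cvgD => //; apply: cvgM; last exact: cvg_cst.
  apply: cvgM; first exact: cvg_cst.
  by rewrite -(@sqrtr1 R); apply: cvg_sqrt; exact: ratio_cvg1.
rewrite add0r mulr1 in h; rewrite (_ : (fun k => _) = (fun k => (m k - N k) / Num.sqrt (N k) +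
  Num.sqrt 2 * Num.sqrt (m k / N k) * eta))//.
apply/funext => k; rewrite !sqrtrM ?ler0n ?(ltW (m0 k))// !sqrtrV ?ltW//.
have := N0 k; rewrite -sqrtr_gt0 => s0; have := m0 k; rewrite -sqrtr_gt0 => t0.
have sN : N k = Num.sqrt (N k) ^+ 2 by rewrite sqr_sqrtr// ltW.
have sm : m k = Num.sqrt (m k) ^+ 2 by rewrite sqr_sqrtr// ltW.
move: s0 t0 sN sm; set s := Num.sqrt (N k); set t := Num.sqrt (m k) => s0 t0 -> ->.
by field; rewrite !gt_eqF.
Qed.

Lemma alpha_cvg (eta : R) :
  Num.sqrt (N k) * (N k / m k / (1 + Num.sqrt (2 / m k) * eta) - 1) @[k --> \oo] -->
  - (Num.sqrt 2 * eta).
Proof.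
have tw : m k / N k * (1 + Num.sqrt (2 / m k) * eta) @[k --> \oo] --> (1 : R).
  by rewrite -[X in _ --> X]mulr1; apply: cvgM; [exact: ratio_cvg1|exact: w_cvg1].
have h : - (Num.sqrt (N k) * (m k / N k * (1 + Num.sqrt (2 / m k) * eta) - 1)) /
    (m k / N k * (1 + Num.sqrt (2 / m k) * eta)) @[k --> \oo] --> - (Num.sqrt 2 * eta).
  rewrite -[X in _ --> X]divr1; apply: cvgM; first by apply: cvgN; exact: alpha1_cvg.
  by apply: cvgV => //; rewrite oner_eq0.
apply: cvg_trans h; apply: near_eq_cvg; near=> k.
have w0 : 0 < 1 + Num.sqrt (2 / m k) * eta by near: k; exact: (cvgr_gt _ (w_cvg1 eta) _ ltr01).
by field; rewrite !gt_eqF.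
Unshelve. all: by end_near. Qed.

Lemma beta_cvg (eta : R) :
  N k / m k * Num.sqrt (N k / (m k + 4)) / (1 + Num.sqrt (2 / m k) * eta) @[k --> \oo] --> (1 : R).
Proof.
have V (f : nat -> R) : f k @[k --> \oo] --> (1 : R) -> (f k)^-1 @[k --> \oo] --> (1 : R).
  by move=> f1; rewrite -[X in _ --> X]invr1; apply: cvgV => //; rewrite oner_eq0.
have h : (m k / N k)^-1 * Num.sqrt ((m k / N k + 2 * (2 / N k))^-1) *
    (1 + Num.sqrt (2 / m k) * eta)^-1 @[k --> \oo] --> (1 : R).
  have h4 : m k / N k + 2 * (2 / N k) @[k --> \oo] --> (1 + 2 * 0 : R).
    apply: cvgD; first exact: ratio_cvg1.
    by apply: cvgM; [exact: cvg_cst|exact: cvg_2div].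
  rewrite mulr0 addr0 in h4; have h5 := cvg_sqrt (V _ h4); rewrite sqrtr1 in h5.
  have h6 : (m k / N k)^-1 * Num.sqrt ((m k / N k + 2 * (2 / N k))^-1) *
      (1 + Num.sqrt (2 / m k) * eta)^-1 @[k --> \oo] --> (1 * 1 * 1 : R).
    by apply: cvgM; [apply: cvgM => //; apply: V; exact: ratio_cvg1|apply: V; exact: w_cvg1].
  by rewrite !mulr1 in h6.
rewrite (_ : (fun k => _) = (fun k => (m k / N k)^-1 * Num.sqrt ((m k / N k + 2 * (2 / N k))^-1) *
    (1 + Num.sqrt (2 / m k) * eta)^-1))//.
apply/funext => k; rewrite invf_div; congr (_ * Num.sqrt _ * _).
have m4 : 0 < m k + 4 by have := m0 k; lra.
by field; rewrite !gt_eqF//; lra.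
Qed.

Lemma tau_cvg (eta : R) :
  Num.sqrt (m k / N k * (1 + Num.sqrt (2 / m k) * eta)) @[k --> \oo] --> (1 : R).
Proof.
have h : Num.sqrt (m k / N k * (1 + Num.sqrt (2 / m k) * eta)) @[k --> \oo] -->
    Num.sqrt (1 * 1 : R).
  by apply: cvg_sqrt; apply: cvgM; [exact: ratio_cvg1|exact: w_cvg1].
by rewrite mulr1 sqrtr1 in h.
Qed.

End scalar_limits.

Section statistics.
Context {R : realType}.

(** The statistic for sigma_ij, written with the exact law: a gamma fluctuation
times be / N, minus a rescaled Student variable times sqrt (al ga - be^2) / N. *)
Lemma cov_stat (N m al be ga w xi : R) : 0 < N -> 0 < m -> 0 < ga ->
  0 < al - be ^+ 2 / ga -> w != 0 ->
  Num.sqrt N * (- (- be / ga + Num.sqrt ((al - be ^+ 2 / ga) / ga / (m + 4)) * xi) /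
    (m / ga * w) - be / N) =
  Num.sqrt N * (N / m / w - 1) * (be / N) +
  - (N / m * Num.sqrt (N / (m + 4)) / w * xi) * (Num.sqrt (al * ga - be ^+ 2) / N).
Proof.
move=> N0 m0 ga0 ka0 w0.
have m4 : 0 < m + 4 by lra.
have -> : (al - be ^+ 2 / ga) / ga = (al * ga - be ^+ 2) * (ga^-1) ^+ 2.
  by field; rewrite gt_eqF.
have e0 : 0 < al * ga - be ^+ 2.
  rewrite (_ : _ - _ = (al - be ^+ 2 / ga) * ga) ?mulr_gt0//.
  by field; rewrite gt_eqF.
rewrite ![in Num.sqrt (_ / (m + 4))]sqrtrM ?(ltW N0)//; last first.
  by rewrite mulr_ge0 ?sqr_ge0// ltW.
rewrite sqrtrM ?(ltW e0)// sqrtr_sqr gtr0_norm ?invr_gt0// sqrtrV ?ltW//.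
have s0 : 0 < Num.sqrt (m + 4) by rewrite sqrtr_gt0.
by field; rewrite w0 !gt_eqF.
Qed.

(** On the diagonal, A = N Shat + 1 exceeds N Shat by 1, whence the bias
1 / sqrt N. *)
Lemma cov_diag_stat (N m ga w : R) : 0 < N -> 0 < m -> 0 < ga -> w != 0 ->
  Num.sqrt N * ((m / ga * w)^-1 - (ga / N - N^-1)) =
  Num.sqrt N * (N / m / w - 1) * (ga / N) + (Num.sqrt N)^-1.
Proof.
move=> N0 m0 ga0 w0; have : 0 < Num.sqrt N by rewrite sqrtr_gt0.
have sN : N = Num.sqrt N ^+ 2 by rewrite sqr_sqrtr// ltW.
move: sN; set s := Num.sqrt N => -> s0.
by field; rewrite w0 !gt_eqF.
Qed.

Lemma prec_stat (N m nii nij njj w z h : R) : 0 < N -> 0 < m -> 0 < nii ->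
  0 < njj - nij ^+ 2 / nii -> 0 <= w ->
  Num.sqrt N * (m * nii * w * (nij / nii) +
     Num.sqrt (m * nii * w * (njj - nij ^+ 2 / nii)) * z - h) =
  Num.sqrt N * (m / N * w - 1) * (N * nij) +
  Num.sqrt (m / N * w) * z * (N * Num.sqrt (nii * njj - nij ^+ 2)) +
  Num.sqrt N * (N * nij - h).
Proof.
move=> N0 m0 nii0 ka0 w0.
have -> : m * nii * w * (njj - nij ^+ 2 / nii) = m * w * (nii * njj - nij ^+ 2).
  by field; rewrite gt_eqF.
have -> : m / N * w = m * w * N^-1 by ring.
have mw : 0 <= m * w by rewrite mulr_ge0// ltW.
rewrite [Num.sqrt (m * w * _)]sqrtrM// [Num.sqrt (m * w / N)]sqrtrM// sqrtrV ?ltW//.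
have : 0 < Num.sqrt N by rewrite sqrtr_gt0.
have sN : N = Num.sqrt N ^+ 2 by rewrite sqr_sqrtr// ltW.
move: sN; set s := Num.sqrt N => -> s0.
by field; rewrite !gt_eqF.
Qed.

(** Why the limit variance is al ga + be^2: the gamma part contributes 2 be^2 and
the Student or Gaussian part al ga - be^2. *)
Lemma unit_pair (al be ga : R) (D := Num.sqrt (al * ga + be ^+ 2)) : 0 < D ->
  0 <= al * ga - be ^+ 2 ->
  2 * (be / D) ^+ 2 + (Num.sqrt (al * ga - be ^+ 2) / D) ^+ 2 = 1.
Proof.
move=> D0 e0; rewrite !expr_div_n (sqr_sqrtr e0).
have D2 : D ^+ 2 = al * ga + be ^+ 2.
  by rewrite sqr_sqrtr//; have := sqr_ge0 be; lra.
have D20 : 0 < D ^+ 2 by rewrite exprn_gt0.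
rewrite -[RHS](divff (lt0r_neq0 D20)) mulrA -mulrDl; congr (_ / _).
by rewrite D2; ring.
Qed.

End statistics.

Section posterior_limits.
Context {R : realType}.
Local Notation mu := (@lebesgue_measure R).

Lemma measurable_sublevel d (T : measurableType d) (f : T -> R) (t : R) :
  measurable_fun setT f -> measurable [set z | f z <= t].
Proof.
move=> mf; rewrite -[X in measurable X]setTI.
have h : measurable_fun setT (fun z => f z <= t) by exact: measurable_fun_ler.
by have := h measurableT [set true]; apply.
Qed.

(** q is b for the covariance and b + p - 1 for the precision; both are
o(sqrt n). *)
Lemma cvg_addn_scale (n q : nat -> nat) : n @ \oo --> \oo ->
  (q k)%:R / Num.sqrt (n k)%:R @[k --> \oo] --> (0 : R) ->
  (forall k, 4 <= n k)%N -> (forall k, 0 < q k)%N ->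
  let N := fun k => (n k)%:R : R in let m := fun k => N k + (q k)%:R - 2 : R in
  [/\ N k @[k --> \oo] --> +oo, m k @[k --> \oo] --> +oo, forall k, 0 < N k,
    forall k, 2 <= m k & (m k - N k) / Num.sqrt (N k) @[k --> \oo] --> 0].
Proof.
move=> noo qn n4 q0 N m.
have Noo : N k @[k --> \oo] --> +oo by exact: cvg_comp noo (@cvgr_idn R).
have N4 k : 4 <= N k by rewrite (ler_nat R 4).
have q1 k : 1 <= (q k)%:R :> R by rewrite (ler_nat R 1).
have N0 k : 0 < N k by apply: lt_le_trans (N4 k).
split => //.
- have hoo : N k + (-1) @[k --> \oo] --> +oo.
    apply/cvgryPge => A; near=> k.
    have : A + 1 <= N k by near: k; move/cvgryPge: Noo; apply.
    lra.
  apply: ger_cvgy hoo; apply: nearW => k; rewrite /m; have := q1 k; lra.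
- by move=> k; rewrite /m; have := N4 k; have := q1 k; lra.
- have h : (q k)%:R / Num.sqrt (N k) - 2 * (Num.sqrt (N k))^-1 @[k --> \oo] --> 0 - 2 * (0 : R).
    by apply: cvgB => //; apply: cvgM; [exact: cvg_cst|exact: cvg_Vsqrt].
  rewrite mulr0 subr0 in h; rewrite (_ : (fun k => _) =
    (fun k => (q k)%:R / Num.sqrt (N k) - 2 * (Num.sqrt (N k))^-1))//.
  by apply/funext => k; rewrite /m; ring.
Unshelve. all: by end_near. Qed.

Lemma cov_weight_hyps (m : nat -> R) : (forall k, 2 <= m k) -> m k @[k --> \oo] --> +oo ->
  let w := fun k (z : R * R) => stw (m k + 4) z.1 * gmw (m k) z.2 in
  [/\ forall k, measurable_fun setT (w k),
    forall k z, 0 <= w k z <= 16 * expR 1 * cauchy2 z &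
    forall z, w k z @[k --> \oo] --> gauss2 z].
Proof.
move=> m2 moo w; split.
- by move=> k; apply: measurable_prodw; [exact: measurable_stw|exact: measurable_gmw].
- move=> k z; rewrite mulr_ge0 ?stw_ge0 ?gmw_ge0//=.
  rewrite (_ : _ * cauchy2 z = 2 * cauchyw z.1 * (8 * expR 1 * cauchyw z.2)); last first.
    by rewrite /cauchy2; ring.
  apply: ler_pM; rewrite ?stw_ge0 ?gmw_ge0 ?gmw_le// stw_le//.
  by have := m2 k; lra.
- move=> z; apply: cvgM; last exact: gmw_cvg.
  apply: (@stw_cvg _ (fun k => m k + 4)); apply: ger_cvgy moo.
  by apply: nearW => k; lra.
Qed.

Lemma prec_weight_hyps (m : nat -> R) : (forall k, 2 <= m k) -> m k @[k --> \oo] --> +oo ->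
  let w := fun k (z : R * R) => gmw (m k) z.1 * gaussw z.2 in
  [/\ forall k, measurable_fun setT (w k),
    forall k z, 0 <= w k z <= 16 * expR 1 * cauchy2 z &
    forall z, w k z @[k --> \oo] --> gauss2 z].
Proof.
move=> m2 moo w; split.
- by move=> k; apply: measurable_prodw; [exact: measurable_gmw|exact: measurable_gaussw].
- move=> k z; rewrite mulr_ge0 ?gaussw_ge0 ?gmw_ge0//=.
  rewrite (_ : _ * cauchy2 z = 8 * expR 1 * cauchyw z.1 * (2 * cauchyw z.2)); last first.
    by rewrite /cauchy2; ring.
  by apply: ler_pM; rewrite ?gaussw_ge0 ?gmw_ge0 ?gmw_le// gaussw_le.
- by move=> z; apply: cvgM; [exact: gmw_cvg|exact: cvg_cst].
Qed.

Lemma posdef_minor_gt0 p (A : 'M[R]_p) i j : i != j -> posdefmx A ->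
  0 < A i i * A j j - A i j ^+ 2.
Proof.
move=> ij pA; have Aj := posdef_diag_gt0 j pA.
have -> : A i i * A j j - A i j ^+ 2 = (A i i - A i j ^+ 2 / A j j) * A j j.
  by field; rewrite gt_eqF.
by rewrite mulr_gt0// posdef_schur2_gt0.
Qed.

(** The asymptotic standard deviation of sqrt n times the (i, j) entry. *)
Definition pair_scale p (A : 'M[R]_p) i j := Num.sqrt (A i i * A j j + A i j ^+ 2).

Lemma pair_scale_gt0 p (A : 'M[R]_p) i j : posdefmx A -> 0 < pair_scale A i j.
Proof.
move=> pA; rewrite sqrtr_gt0 ltr_pwDl ?sqr_ge0// mulr_gt0//; exact: posdef_diag_gt0.
Qed.

Variables (n p b : nat -> nat) (B : nat) (x : forall k, 'I_(n k) -> (p k).-tuple R).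
Variables (i j : forall k, 'I_(p k)) (D : nat -> R).
Hypotheses (n4 : forall k, (4 <= n k)%N) (noo : n @ \oo --> \oo).
Hypotheses (b0 : forall k, (0 < b k)%N) (bB : forall k, (b k <= B)%N).
Hypotheses (ij : forall k, i k != j k) (D0 : forall k, 0 < D k).
Local Notation A k := (post_scale (@x k)).
Local Notation N k := ((n k)%:R : R).

Let sqrtN0 : (Num.sqrt (N k))^-1 @[k --> \oo] --> 0.
Proof.
apply: cvg_Vsqrt; first exact: cvg_comp noo (@cvgr_idn R).
by move=> k; rewrite ltr0n; apply: leq_trans (n4 k).
Qed.

Let qb : (b k)%:R / Num.sqrt (N k) @[k --> \oo] --> (0 : R).
Proof.
apply: (@cvg_dist_le _ _ (fun k => B%:R * (Num.sqrt (N k))^-1)); last first.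
  by rewrite -(mulr0 (B%:R : R)); apply: cvgM => //; exact: cvg_cst.
apply: nearW => k; rewrite subr0 ger0_norm ?divr_ge0 ?sqrtr_ge0//.
by rewrite ler_wpM2r ?invr_ge0 ?sqrtr_ge0// ler_nat.
Qed.

Let post_expE k : 2 * post_exp (n k) (b k) = N k + (b k)%:R - 2 :> R.
Proof. by rewrite /post_exp; field. Qed.

(** For data sequences whose scale is asymptotically D. The coefficients u and v
of the limiting linear form are computed from A, so that u and v satisfy
[unit_pair] exactly, and only the ratio of the scale of A to D enters the
limit. *)
Lemma posterior_cov_limit :
  pair_scale (A k) (i k) (j k) / N k / D k @[k --> \oo] --> (1 : R) ->
  forall e, 0 < e -> \forall k \near \oo, forall t,
  `|posterior (b k) (@x k) [set Om | Num.sqrt (N k) *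
      (invmx Om (i k) (j k) - sample_cov (@x k) (i k) (j k)) / D k <= t]
    - fine (normal_prob 0 1 `]-oo, t])| <= e.
Proof.
move=> rho1; have [Noo moo N0 m2 mN] := cvg_addn_scale noo qb n4 b0.
pose m k := N k + (b k)%:R - 2.
have m0 k : 0 < m k by apply: lt_le_trans (m2 k).
have [mw wK wg] := cov_weight_hyps m2 moo.
have pA k : posdefmx (A k) by exact: posdef_post_scale.
pose u k := A k (i k) (j k) / pair_scale (A k) (i k) (j k).
pose v k := Num.sqrt (A k (i k) (i k) * A k (j k) (j k) - A k (i k) (j k) ^+ 2)
  / pair_scale (A k) (i k) (j k).
have uv k : 2 * u k ^+ 2 + v k ^+ 2 = 1.
  apply: unit_pair; first exact: pair_scale_gt0.
  by rewrite ltW// posdef_minor_gt0.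
pose r k xi := - A k (i k) (j k) / A k (j k) (j k) +
      Num.sqrt ((A k (i k) (i k) - A k (i k) (j k) ^+ 2 / A k (j k) (j k)) / A k (j k) (j k) / (m k + 4)) * xi.
pose s k eta := m k / A k (j k) (j k) * (1 + Num.sqrt (2 / m k) * eta).
pose H k (z : R * R) := Num.sqrt (N k) * (- r k z.1 / s k z.2 - sample_cov (@x k) (i k) (j k)) / D k.
have E k t : posterior (b k) (@x k) [set Om | Num.sqrt (N k) *
      (invmx Om (i k) (j k) - sample_cov (@x k) (i k) (j k)) / D k <= t] =
    wprob (fun z => stw (m k + 4) z.1 * gmw (m k) z.2) [set z | H k z <= t].
  have mB : measurable [set y : R * R |
      Num.sqrt (N k) * (y.1 - sample_cov (@x k) (i k) (j k)) / D k <= t].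
    apply: measurable_sublevel; apply: measurable_funM => //.
    by apply: measurable_funM => //; exact: measurable_funB.
  have := @posterior_cov _ _ _ _ (@x k) (b0 k) (i k) (j k) _ (ij k) _ mB.
  by rewrite post_expE => /(_ (m0 k)) ->.
have mH k : measurable_fun setT (H k).
  apply: measurable_funM => //; apply: measurable_funM => //; apply: measurable_funB => //.
  apply: measurable_funM.
    apply: measurableT_comp => //; apply: measurable_funD => //.
    by apply: measurable_funM => //; exact: measurable_fst.
  apply: measurable_funV; apply: measurable_funM => //; apply: measurable_funD => //.
  by apply: measurable_funM => //; exact: measurable_snd.
have HL z : H k z - (- v k * z.1 + - (Num.sqrt 2 * u k) * z.2) @[k --> \oo] --> 0.
  have u1 k : `|u k| <= 1 by have [] := unit_bound (uv k).
  have v1 k : `|v k| <= 1 by have [] := unit_bound (uv k).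
  have bb : - (N k / m k * Num.sqrt (N k / (m k + 4)) / (1 + Num.sqrt (2 / m k) * z.2) * z.1)
      @[k --> \oo] --> - (1 * z.1).
    by apply: cvgN; apply: cvgM; [exact: beta_cvg|exact: cvg_cst].
  have aa : Num.sqrt (N k) * (N k / m k / (1 + Num.sqrt (2 / m k) * z.2) - 1) @[k --> \oo]
      --> - (Num.sqrt 2 * z.2) by exact: alpha_cvg.
  have cc : (0 : R) @[k --> \oo] --> (0 : R) by exact: cvg_cst.
  have h := lin_comb_cvg rho1 aa bb cc u1 v1.
  apply: cvg_trans h; apply: near_eq_cvg; near=> k.
  have w0 : 1 + Num.sqrt (2 / m k) * z.2 != 0.
    by apply: lt0r_neq0; near: k; exact: (cvgr_gt _ (w_cvg1 moo z.2) _ ltr01).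
  have P0 := pair_scale_gt0 (i k) (j k) (pA k).
  have SE : sample_cov (@x k) (i k) (j k) = A k (i k) (j k) / N k.
    rewrite /post_scale !mxE (negbTE (ij k)) addr0 mulrAC divff ?mul1r// gt_eqF//.
  rewrite /H SE cov_stat ?posdef_diag_gt0 ?posdef_schur2_gt0//.
  rewrite /u /v -/(m k); field.
  by rewrite w0 !gt_eqF//=; have := m0 k; lra.
move=> e e0; apply: filterS (wprob_limit mw wK wg mH HL _ e0) => [k h t|k].
  by rewrite E; exact: h.
have s2 : Num.sqrt 2 ^+ 2 = 2 :> R by rewrite sqr_sqrtr ?ler0n.
transitivity (Num.sqrt 2 ^+ 2 * u k ^+ 2 + v k ^+ 2); first by ring.
by rewrite s2; exact: uv.
Unshelve. all: by end_near. Qed.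

(** The diagonal case of [unit_pair], where the second variable disappears. *)
Lemma unit_diag (a : R) (c := a / Num.sqrt (a * a + a ^+ 2)) : 0 < a ->
  2 * c ^+ 2 + 0 ^+ 2 = 1.
Proof.
move=> a0; rewrite expr0n addr0 /c expr_div_n sqr_sqrtr; last first.
  by rewrite addr_ge0 ?sqr_ge0// mulr_ge0// ltW.
rewrite (_ : a * a + a ^+ 2 = 2 * a ^+ 2); last by ring.
by field; rewrite gt_eqF.
Qed.

(** The diagonal entry is the second component of the pair studied in
[posterior_cov], for any auxiliary index i k <> j k. *)
Lemma posterior_var_limit :
  pair_scale (A k) (j k) (j k) / N k / D k @[k --> \oo] --> (1 : R) ->
  (Num.sqrt (N k))^-1 / D k @[k --> \oo] --> (0 : R) ->
  forall e, 0 < e -> \forall k \near \oo, forall t,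
  `|posterior (b k) (@x k) [set Om | Num.sqrt (N k) *
      (invmx Om (j k) (j k) - sample_cov (@x k) (j k) (j k)) / D k <= t]
    - fine (normal_prob 0 1 `]-oo, t])| <= e.
Proof.
move=> rho1 ga0; have [Noo moo N0 m2 mN] := cvg_addn_scale noo qb n4 b0.
pose m k := N k + (b k)%:R - 2.
have m0 k : 0 < m k by apply: lt_le_trans (m2 k).
have [mw wK wg] := cov_weight_hyps m2 moo.
have pA k : posdefmx (A k) by exact: posdef_post_scale.
have Aj0 k : 0 < A k (j k) (j k) by exact: posdef_diag_gt0.
pose u k := A k (j k) (j k) / pair_scale (A k) (j k) (j k).
have uv k : 2 * u k ^+ 2 + 0 ^+ 2 = 1 by exact: unit_diag.
pose s k eta := m k / A k (j k) (j k) * (1 + Num.sqrt (2 / m k) * eta).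
pose H k (z : R * R) := Num.sqrt (N k) * ((s k z.2)^-1 - sample_cov (@x k) (j k) (j k)) / D k.
have E k t : posterior (b k) (@x k) [set Om | Num.sqrt (N k) *
      (invmx Om (j k) (j k) - sample_cov (@x k) (j k) (j k)) / D k <= t] =
    wprob (fun z => stw (m k + 4) z.1 * gmw (m k) z.2) [set z | H k z <= t].
  have mB : measurable [set y : R * R |
      Num.sqrt (N k) * (y.2 - sample_cov (@x k) (j k) (j k)) / D k <= t].
    apply: measurable_sublevel; apply: measurable_funM => //.
    by apply: measurable_funM => //; exact: measurable_funB.
  have := @posterior_cov _ _ _ _ (@x k) (b0 k) (i k) (j k) _ (ij k) _ mB.
  by rewrite post_expE => /(_ (m0 k)) ->.
have mH k : measurable_fun setT (H k).
  apply: measurable_funM => //; apply: measurable_funM => //; apply: measurable_funB => //.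
  apply: measurable_funV; apply: measurable_funM => //; apply: measurable_funD => //.
  by apply: measurable_funM => //; exact: measurable_snd.
have HL z : H k z - (0 * z.1 + - (Num.sqrt 2 * u k) * z.2) @[k --> \oo] --> 0.
  have u1 k : `|u k| <= 1 by have [] := unit_bound (uv k).
  have v1 (k : nat) : `|0 : R| <= 1 by rewrite normr0.
  have aa : Num.sqrt (N k) * (N k / m k / (1 + Num.sqrt (2 / m k) * z.2) - 1) @[k --> \oo]
      --> - (Num.sqrt 2 * z.2) by exact: alpha_cvg.
  have bb : (0 : R) @[k --> \oo] --> (0 : R) by exact: cvg_cst.
  have h := lin_comb_cvg rho1 aa bb ga0 u1 v1.
  apply: cvg_trans h; apply: near_eq_cvg; near=> k.
  have w0 : 1 + Num.sqrt (2 / m k) * z.2 != 0.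
    by apply: lt0r_neq0; near: k; exact: (cvgr_gt _ (w_cvg1 moo z.2) _ ltr01).
  have P0 := pair_scale_gt0 (j k) (j k) (pA k).
  have SE : sample_cov (@x k) (j k) (j k) = A k (j k) (j k) / N k - (N k)^-1.
    by rewrite /post_scale !mxE eqxx mulrDl mul1r addrK mulrAC divff ?mul1r// gt_eqF.
  rewrite /H SE /s cov_diag_stat// /u -/(m k).
  have s0 : 0 < Num.sqrt (N k) by rewrite sqrtr_gt0.
  by field; rewrite w0 !gt_eqF.
move=> e e0; apply: filterS (wprob_limit mw wK wg mH HL _ e0) => [k h t|k].
  by rewrite E; exact: h.
by rewrite !sqrrN exprMn sqr_sqrtr ?ler0n// addrC; exact: uv.
Unshelve. all: by end_near. Qed.

Hypothesis pN : (p k)%:R / Num.sqrt (N k) @[k --> \oo] --> (0 : R).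
Local Notation V k := (invmx (A k)).
Let q k := (b k + (p k).-1)%N.

Let qq : (q k)%:R / Num.sqrt (N k) @[k --> \oo] --> (0 : R).
Proof.
have h : (b k)%:R / Num.sqrt (N k) + (p k)%:R / Num.sqrt (N k) @[k --> \oo] --> (0 + 0 : R).
  exact: cvgD.
rewrite addr0 in h; apply: cvg_dist_le h; apply: nearW => k.
rewrite subr0 ger0_norm ?divr_ge0 ?sqrtr_ge0// -mulrDl -natrD.
by rewrite ler_wpM2r ?invr_ge0 ?sqrtr_ge0// ler_nat leq_add2l leq_pred.
Qed.

Let q0 k : (0 < q k)%N. Proof. by rewrite addn_gt0 b0. Qed.

Let prec_expE k : 2 * post_exp (n k) (b k) + (p k).-1%:R = N k + (q k)%:R - 2 :> R.
Proof. by rewrite post_expE /q natrD; ring. Qed.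

Let pV k : posdefmx (V k). Proof. by apply: posdef_inv; exact: posdef_post_scale. Qed.

(** The exact law is centred at n V_ij with V = A^-1 instead of the inverse of
Shat; the second hypothesis makes the difference negligible. *)
Lemma posterior_prec_limit :
  N k * pair_scale (V k) (i k) (j k) / D k @[k --> \oo] --> (1 : R) ->
  Num.sqrt (N k) * (N k * V k (i k) (j k) - invmx (sample_cov (@x k)) (i k) (j k)) / D k
    @[k --> \oo] --> (0 : R) ->
  forall e, 0 < e -> \forall k \near \oo, forall t,
  `|posterior (b k) (@x k) [set Om | Num.sqrt (N k) *
      (Om (i k) (j k) - invmx (sample_cov (@x k)) (i k) (j k)) / D k <= t]
    - fine (normal_prob 0 1 `]-oo, t])| <= e.
Proof.
move=> rho1 ga0; have [Noo moo N0 m2 mN] := cvg_addn_scale noo qq n4 q0.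
pose m k := N k + (q k)%:R - 2.
have m0 k : 0 < m k by apply: lt_le_trans (m2 k).
have [mw wK wg] := prec_weight_hyps m2 moo.
pose u k := V k (i k) (j k) / pair_scale (V k) (i k) (j k).
pose v k := Num.sqrt (V k (i k) (i k) * V k (j k) (j k) - V k (i k) (j k) ^+ 2)
  / pair_scale (V k) (i k) (j k).
have uv k : 2 * u k ^+ 2 + v k ^+ 2 = 1.
  apply: unit_pair; first exact: pair_scale_gt0.
  by rewrite ltW// posdef_minor_gt0.
pose dd k e := m k * V k (i k) (i k) * (1 + Num.sqrt (2 / m k) * e).
pose H k (z : R * R) := Num.sqrt (N k) * (dd k z.1 * (V k (i k) (j k) / V k (i k) (i k)) +
  Num.sqrt (dd k z.1 * (V k (j k) (j k) - V k (i k) (j k) ^+ 2 / V k (i k) (i k))) * z.2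
  - invmx (sample_cov (@x k)) (i k) (j k)) / D k.
have E k t : posterior (b k) (@x k) [set Om | Num.sqrt (N k) *
      (Om (i k) (j k) - invmx (sample_cov (@x k)) (i k) (j k)) / D k <= t] =
    wprob (fun z => gmw (m k) z.1 * gaussw z.2) [set z | H k z <= t].
  have mB : measurable [set y : R * R |
      Num.sqrt (N k) * (y.2 - invmx (sample_cov (@x k)) (i k) (j k)) / D k <= t].
    apply: measurable_sublevel; apply: measurable_funM => //.
    by apply: measurable_funM => //; exact: measurable_funB.
  have := @posterior_prec _ _ _ _ (@x k) (b0 k) (i k) (j k) _ (ij k) _ mB.
  by rewrite prec_expE => /(_ (m0 k)) ->.
have mdd k : measurable_fun setT (fun z : R * R => dd k z.1).
  apply: measurable_funM => //; apply: measurable_funD => //.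
  by apply: measurable_funM => //; exact: measurable_fst.
have mH k : measurable_fun setT (H k).
  apply: measurable_funM => //; apply: measurable_funM => //; apply: measurable_funB => //.
  apply: measurable_funD; first exact: measurable_funM.
  by apply: measurable_funM => //; apply: measurable_fun_sqrt; exact: measurable_funM.
have HL z : H k z - (Num.sqrt 2 * u k * z.1 + v k * z.2) @[k --> \oo] --> 0.
  have u1 k : `|u k| <= 1 by have [] := unit_bound (uv k).
  have v1 k : `|v k| <= 1 by have [] := unit_bound (uv k).
  have aa : Num.sqrt (N k) * (m k / N k * (1 + Num.sqrt (2 / m k) * z.1) - 1) @[k --> \oo]
      --> Num.sqrt 2 * z.1 by exact: alpha1_cvg.
  have bb : Num.sqrt (m k / N k * (1 + Num.sqrt (2 / m k) * z.1)) * z.2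
      @[k --> \oo] --> 1 * z.2.
    by apply: cvgM; [exact: tau_cvg|exact: cvg_cst].
  have h := lin_comb_cvg rho1 aa bb ga0 u1 v1.
  apply: cvg_trans h; apply: near_eq_cvg; near=> k.
  have w0 : 0 < 1 + Num.sqrt (2 / m k) * z.1.
    by near: k; exact: (cvgr_gt _ (w_cvg1 moo z.1) _ ltr01).
  have P0 := pair_scale_gt0 (i k) (j k) (pV k).
  have Vji : V k (j k) (i k) = V k (i k) (j k) by have [tV _] := pV k; rewrite -[in LHS]tV mxE.
  have ji : j k != i k by rewrite eq_sym.
  have := posdef_schur2_gt0 ji (pV k); rewrite Vji => ka0.
  rewrite /H /dd prec_stat ?posdef_diag_gt0 ?(ltW w0)//.
  by rewrite /u /v; field; rewrite !gt_eqF.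
move=> e e0; apply: filterS (wprob_limit mw wK wg mH HL _ e0) => [k h t|k].
  by rewrite E; exact: h.
by rewrite exprMn sqr_sqrtr ?ler0n//; exact: uv.
Unshelve. all: by end_near. Qed.

Lemma posterior_prec_diag_limit :
  N k * pair_scale (V k) (i k) (i k) / D k @[k --> \oo] --> (1 : R) ->
  Num.sqrt (N k) * (N k * V k (i k) (i k) - invmx (sample_cov (@x k)) (i k) (i k)) / D k
    @[k --> \oo] --> (0 : R) ->
  forall e, 0 < e -> \forall k \near \oo, forall t,
  `|posterior (b k) (@x k) [set Om | Num.sqrt (N k) *
      (Om (i k) (i k) - invmx (sample_cov (@x k)) (i k) (i k)) / D k <= t]
    - fine (normal_prob 0 1 `]-oo, t])| <= e.
Proof.
move=> rho1 ga0; have [Noo moo N0 m2 mN] := cvg_addn_scale noo qq n4 q0.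
pose m k := N k + (q k)%:R - 2.
have m0 k : 0 < m k by apply: lt_le_trans (m2 k).
have [mw wK wg] := prec_weight_hyps m2 moo.
have Vi0 k : 0 < V k (i k) (i k) by exact: posdef_diag_gt0.
pose u k := V k (i k) (i k) / pair_scale (V k) (i k) (i k).
have uv k : 2 * u k ^+ 2 + 0 ^+ 2 = 1 by exact: unit_diag.
pose dd k e := m k * V k (i k) (i k) * (1 + Num.sqrt (2 / m k) * e).
pose H k (z : R * R) := Num.sqrt (N k) *
  (dd k z.1 - invmx (sample_cov (@x k)) (i k) (i k)) / D k.
have E k t : posterior (b k) (@x k) [set Om | Num.sqrt (N k) *
      (Om (i k) (i k) - invmx (sample_cov (@x k)) (i k) (i k)) / D k <= t] =
    wprob (fun z => gmw (m k) z.1 * gaussw z.2) [set z | H k z <= t].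
  have mB : measurable [set y : R * R |
      Num.sqrt (N k) * (y.1 - invmx (sample_cov (@x k)) (i k) (i k)) / D k <= t].
    apply: measurable_sublevel; apply: measurable_funM => //.
    by apply: measurable_funM => //; exact: measurable_funB.
  have := @posterior_prec _ _ _ _ (@x k) (b0 k) (i k) (j k) _ (ij k) _ mB.
  by rewrite prec_expE => /(_ (m0 k)) ->.
have mH k : measurable_fun setT (H k).
  apply: measurable_funM => //; apply: measurable_funM => //; apply: measurable_funB => //.
  apply: measurable_funM => //; apply: measurable_funD => //.
  by apply: measurable_funM => //; exact: measurable_fst.
have HL z : H k z - (Num.sqrt 2 * u k * z.1 + 0 * z.2) @[k --> \oo] --> 0.
  have u1 k : `|u k| <= 1 by have [] := unit_bound (uv k).
  have v1 (k : nat) : `|0 : R| <= 1 by rewrite normr0.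
  have aa : Num.sqrt (N k) * (m k / N k * (1 + Num.sqrt (2 / m k) * z.1) - 1) @[k --> \oo]
      --> Num.sqrt 2 * z.1 by exact: alpha1_cvg.
  have bb : (0 : R) @[k --> \oo] --> (0 : R) by exact: cvg_cst.
  have h := lin_comb_cvg rho1 aa bb ga0 u1 v1.
  apply: cvg_trans h; apply: near_eq_cvg; near=> k.
  have P0 := pair_scale_gt0 (i k) (i k) (pV k).
  by rewrite /H /dd /u; field; rewrite !gt_eqF.
move=> e e0; apply: filterS (wprob_limit mw wK wg mH HL _ e0) => [k h t|k].
  by rewrite E; exact: h.
by rewrite exprMn sqr_sqrtr ?ler0n//; exact: uv.
Unshelve. all: by end_near. Qed.

End posterior_limits.

(** * Moments of Gaussian samples *)

Section moments.
Context {R : realType}.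
Local Notation mu := (@lebesgue_measure R).
Local Notation q := (Num.sqrt (2 * pi : R)).

Lemma gauss_scale_int (r : R) : 0 < r ->
  (\int[mu]_x (expR (- (r ^+ 2 * x ^+ 2) / 2))%:E = (q / r)%:E)%E.
Proof.
move=> r0; have r20 : 0 < r ^+ 2 by rewrite exprn_gt0.
have := gauss_int 0 r20; rewrite expr0n /= mul0r expR0 mulr1 -exprVn sqrtr_sqr.
rewrite gtr0_norm ?invr_gt0// [q / r]mulrC => <-.
by apply: eq_integral => x _; rewrite mulr0 mul0r addr0.
Qed.

Lemma sqrt_2pi_gt0 : 0 < q. Proof. by rewrite sqrtr_gt0 mulr_gt0// pi_gt0. Qed.

Lemma measurable_gexp (r : R) : measurable_fun setT (fun x : R => expR (- (r * x ^+ 2) / 2)).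
Proof.
apply: measurableT_comp => //; apply: measurable_funM => //; apply: measurableT_comp => //.
by apply: measurable_funM => //; exact: measurable_funX.
Qed.

(** As a function of r^2, exp(- r^2 x^2 / 2) lies above its tangent at 1, and its
integral over x is sqrt (2 pi) / r. Comparing the two for r slightly below and
slightly above 1 bounds the second moment from both sides. *)
Lemma gauss_moment2 : (\int[mu]_x (gaussw x * x ^+ 2)%:E = q%:E)%E.
Proof.
have q0 := sqrt_2pi_gt0.
have mx2 : measurable_fun setT (fun x : R => gaussw x * x ^+ 2).
  by apply: measurable_funM; [exact: measurable_gaussw|exact: measurable_funX].
have x20 (x : R) : 0 <= gaussw x * x ^+ 2 by rewrite mulr_ge0 ?gaussw_ge0 ?sqr_ge0.
have tangent (r x : R) : gaussw x * (1 - (r ^+ 2 - 1) / 2 * x ^+ 2) <= expR (- (r ^+ 2 * x ^+ 2) / 2).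
  have -> : expR (- (r ^+ 2 * x ^+ 2) / 2) = gaussw x * expR (- ((r ^+ 2 - 1) / 2 * x ^+ 2)).
    by rewrite /gaussw -expRD; congr expR; field.
  by rewrite ler_wpM2l ?gaussw_ge0//; exact: expR_ge1Dx.
have iZ (k : R) : 0 <= k -> (\int[mu]_x (k * (gaussw x * x ^+ 2))%:E =
    k%:E * \int[mu]_x (gaussw x * x ^+ 2)%:E)%E.
  move=> k0; rewrite -ge0_integralZl//.
  - exact/measurable_EFinP.
  - by move=> x _; rewrite lee_fin.
have mg : measurable_fun setT (fun x : R => (gaussw x)%:E : \bar R).
  by apply/measurable_EFinP; exact: measurable_gaussw.
have mkx (k : R) : measurable_fun setT (fun x : R => (k * (gaussw x * x ^+ 2))%:E : \bar R).
  by apply/measurable_EFinP; exact: measurable_funM.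
have me (r : R) : measurable_fun setT (fun x : R => (expR (- (r ^+ 2 * x ^+ 2) / 2))%:E : \bar R).
  by apply/measurable_EFinP; exact: measurable_gexp.
have lo (r : R) : 0 < r -> r < 1 ->
    (q%:E + ((1 - r ^+ 2) / 2)%:E * \int[mu]_x (gaussw x * x ^+ 2)%:E <= (q / r)%:E)%E.
  move=> r0 r1; have k0 : 0 <= (1 - r ^+ 2) / 2.
    by rewrite divr_ge0// subr_ge0 expr_le1 ?ltW.
  rewrite -(gauss_scale_int r0) -integral_gaussw -iZ// -ge0_integralD; last 5 first.
  - exact: measurableT.
  - by move=> x _; rewrite lee_fin gaussw_ge0.
  - exact: mg.
  - by move=> x _; rewrite lee_fin mulr_ge0.
  - exact: mkx.
  apply: ge0_le_integral => //.
  - by move=> x _; rewrite -EFinD lee_fin addr_ge0 ?gaussw_ge0// mulr_ge0.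
  - exact: (emeasurable_funD mg (mkx _)).
  - exact: me.
  - by move=> x _; rewrite -EFinD lee_fin; have := tangent r x; lra.
have up (r : R) : 1 < r ->
    (q%:E <= (q / r)%:E + ((r ^+ 2 - 1) / 2)%:E * \int[mu]_x (gaussw x * x ^+ 2)%:E)%E.
  move=> r1; have r0 : 0 < r by apply: lt_trans r1.
  have k0 : 0 <= (r ^+ 2 - 1) / 2.
    by rewrite divr_ge0// subr_ge0 expr_ge1 ?ltW.
  rewrite -(gauss_scale_int r0) -integral_gaussw -iZ// -ge0_integralD; last 5 first.
  - exact: measurableT.
  - by move=> x _; rewrite lee_fin expR_ge0.
  - exact: me.
  - by move=> x _; rewrite lee_fin mulr_ge0.
  - exact: mkx.
  apply: ge0_le_integral => //.
  - by move=> x _; rewrite lee_fin gaussw_ge0.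
  - exact: (emeasurable_funD (me r) (mkx _)).
  - by move=> x _; rewrite -EFinD lee_fin; have := tangent r x; lra.
have M0 : (0 <= \int[mu]_x (gaussw x * x ^+ 2)%:E)%E.
  by apply: integral_ge0 => x _; rewrite lee_fin.
case: (\int[mu]_x _)%E M0 lo up => [M| |] M0 lo up; last by [].
- rewrite lee_fin in M0; congr EFin; apply/eqP; rewrite eq_le; apply/andP; split.
    rewrite leNgt; apply/negP => qM; have Mp : 0 < M by lra.
    (* At r = 1 - t the bound reads (1 - t) (2 - t) M <= 2 q, which fails for this t
       if q < M. *)
    pose t := (M - q) / (3 * M); have t0 : 0 < t by rewrite divr_gt0 ?subr_gt0// mulr_gt0.
    have tM : 3 * M * t = M - q by rewrite /t; field; rewrite gt_eqF.
    have t1 : t < 1 by nra.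
    have := lo (1 - t); rewrite subr_gt0 => /(_ t1); rewrite ltrBlDr ltrDl => /(_ t0).
    rewrite -EFinM -EFinD lee_fin ler_pdivlMr; last by lra.
    move=> h; have : (1 - t) * (2 - t) * M <= 2 * q by nra.
    nra.
  rewrite leNgt; apply/negP => Mq.
  (* At r = 1 + t the bound reads 2 q <= (2 + t) (1 + t) M, which fails for this t
     if M < q. *)
  pose t := (q - M) / (4 * q); have t0 : 0 < t by rewrite divr_gt0 ?subr_gt0// mulr_gt0.
  have tM : 4 * q * t = q - M by rewrite /t; field; rewrite gt_eqF.
  have t1 : t < 1 by nra.
  have := up (1 + t); rewrite ltrDl => /(_ t0).
  rewrite -EFinM -EFinD lee_fin => h.
  have : q * (1 + t) <= q + ((1 + t) ^+ 2 - 1) / 2 * M * (1 + t).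
    have e2 : (q / (1 + t) + ((1 + t) ^+ 2 - 1) / 2 * M) * (1 + t) =
        q + ((1 + t) ^+ 2 - 1) / 2 * M * (1 + t).
      by field; rewrite gt_eqF//; lra.
    by have := ler_wpM2r (ltW (addr_gt0 ltr01 t0)) h; rewrite e2.
  move=> h2; have : 2 * q <= (2 + t) * (1 + t) * M by nra.
  nra.
- have h1 : 0 < 2^-1 :> R by lra.
  have h2 : 2^-1 < 1 :> R by lra.
  have := lo _ h1 h2.
  rewrite gt0_muley ?lte_fin; last by lra.
  by rewrite addey// leye_eq.
Qed.

(** A bound is enough: x^4 <= 32 exp(x^2 / 4) leaves a Gaussian integral. *)
Lemma gauss_moment4 : (\int[mu]_x (gaussw x * x ^+ 4)%:E <= (64 * q)%:E)%E.
Proof.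
have h20 : 0 < 2^-1 :> R by rewrite invr_gt0.
have := gauss_int 0 h20.
have r2 : Num.sqrt (2 : R) <= 2.
  by rewrite -[leRHS]ger0_norm// -sqrtr_sqr ler_wsqrtr// expr2; lra.
have q0 := sqrt_2pi_gt0.
rewrite invrK expr0n/= mul0r expR0 mulr1 => E.
apply: (@le_trans _ _ (32%:E * (Num.sqrt 2 * q)%:E)%E); last first.
  by rewrite -EFinM lee_fin; nra.
rewrite -E -ge0_integralZl; last 4 first.
- exact: measurableT.
- apply/measurable_EFinP; apply: measurableT_comp => //; apply: measurable_funM => //.
  apply: measurableT_comp => //; apply: measurable_funD; last exact: measurable_funM.
  by apply: measurable_funM => //; exact: measurable_funX.
- by move=> x _; rewrite lee_fin expR_ge0.
- by rewrite lee_fin.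
apply: ge0_le_integral => //.
- by move=> x _; rewrite lee_fin mulr_ge0 ?gaussw_ge0 ?exprn_even_ge0.
- apply/measurable_EFinP; apply: measurable_funM; last exact: measurable_funX.
  exact: measurable_gaussw.
- apply: emeasurable_funM => //; apply/measurable_EFinP; apply: measurableT_comp => //.
  apply: measurable_funM => //.
  apply: measurableT_comp => //; apply: measurable_funD; last exact: measurable_funM.
  by apply: measurable_funM => //; exact: measurable_funX.
move=> x _; rewrite -EFinM lee_fin.
have x2 := sqr_ge0 x.
have := @expR_ge1Dxn R (x ^+ 2 / 4) 1; rewrite divr_ge0// => /(_ isT) h.
have h2 : x ^+ 4 <= 32 * expR (x ^+ 2 / 4).
  rewrite (_ : x ^+ 4 = (x ^+ 2) ^+ 2); last by ring.
  by move: h; rewrite /factorial/=; nra.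
apply: le_trans (ler_wpM2l (gaussw_ge0 x) h2) _.
rewrite mulrCA ler_wpM2l// /gaussw -expRD ler_expR; lra.
Qed.

Lemma normal_integral (s : R) (f : R -> \bar R) : 0 < s ->
  measurable_fun setT f -> (forall x, 0 <= f x)%E ->
  (\int[normal_prob 0 s]_x f x = q^-1%:E * \int[mu]_x ((gaussw x)%:E * f (s * x)%R))%E.
Proof.
move=> s0 mf f0.
have mpdf := @measurable_normal_pdf R 0 s.
have pdf0 (x : R) : 0 <= normal_pdf 0 s x by exact: normal_pdf_ge0.
have -> : (\int[normal_prob 0 s]_x f x =
    \int[density_measure mu measurableT mpdf pdf0]_x f x)%E.
  by apply: eq_measure_integral => A mA _; rewrite /= /density_measure setIT.
rewrite (@ge0_integral_density _ _ R mu _ _ measurableT mpdf pdf0 f mf f0).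
rewrite [in LHS](ge0_integral_affine 0 (lt0r_neq0 s0)); last 2 first.
- apply: emeasurable_funM => //; apply/measurable_EFinP; apply: measurable_funM => //.
- by move=> x; rewrite mule_ge0// lee_fin mulr_ge0.
have mfs : measurable_fun setT (fun x : R => (gaussw x)%:E * f (s * x)%R)%E.
  apply: emeasurable_funM; first by apply/measurable_EFinP; exact: measurable_gaussw.
  by apply: measurableT_comp => //; exact: measurable_funM.
have q0 := sqrt_2pi_gt0.
have fs0 (x : R) : (0 <= (gaussw x)%:E * f (s * x)%R)%E.
  by rewrite mule_ge0// lee_fin gaussw_ge0.
have -> : (q^-1%:E * \int[mu]_x ((gaussw x)%:E * f (s * x)%R) =
    s%:E * ((s * q)^-1%:E * \int[mu]_x ((gaussw x)%:E * f (s * x)%R)))%E.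
  rewrite muleA -EFinM; congr (_%:E * _)%E.
  by field; rewrite !gt_eqF.
rewrite gtr0_norm//; congr (_ * _)%E.
rewrite -ge0_integralZl; last 4 first.
- exact: measurableT.
- exact: mfs.
- by move=> x _; exact: fs0.
- by rewrite lee_fin invr_ge0 mulr_ge0// ltW.
apply: eq_integral => x _; rewrite addr0 indicT mulr1 muleA -EFinM muleC; congr (_%:E * _)%E.
rewrite normal_pdfE ?gt_eqF// /normal_peak /normal_fun /gaussw subr0.
rewrite -mulr_natl (_ : 2 * (s ^+ 2 * pi) = s ^+ 2 * (2 * pi)); last by ring.
rewrite sqrtrM ?sqr_ge0// sqrtr_sqr gtr0_norm//; congr (_ * expR _).
by rewrite -mulr_natl; field; rewrite gt_eqF.
Qed.

Lemma normal_moment2 (s : R) : 0 < s ->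
  (\int[normal_prob 0 s]_x (x ^+ 2)%:E = (s ^+ 2)%:E)%E.
Proof.
move=> s0; have q0 := sqrt_2pi_gt0.
have m2 : measurable_fun setT (fun x : R => (x ^+ 2)%:E : \bar R).
  by apply/measurable_EFinP; exact: measurable_funX.
rewrite (normal_integral s0 m2); last by move=> x; rewrite lee_fin sqr_ge0.
rewrite (_ : (\int[mu]_x _)%E = ((s ^+ 2)%:E * \int[mu]_x (gaussw x * x ^+ 2)%:E)%E).
  by rewrite gauss_moment2 -!EFinM; congr EFin; field; rewrite gt_eqF.
rewrite -ge0_integralZl; last 4 first.
- exact: measurableT.
- apply/measurable_EFinP; apply: measurable_funM; last exact: measurable_funX.
  exact: measurable_gaussw.
- by move=> x _; rewrite lee_fin mulr_ge0 ?gaussw_ge0 ?sqr_ge0.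
- by rewrite lee_fin sqr_ge0.
by apply: eq_integral => x _; rewrite -!EFinM; congr EFin; ring.
Qed.

Lemma normal_moment4 (s : R) : 0 < s ->
  (\int[normal_prob 0 s]_x (x ^+ 4)%:E <= (64 * s ^+ 4)%:E)%E.
Proof.
move=> s0; have q0 := sqrt_2pi_gt0.
have m2 : measurable_fun setT (fun x : R => (x ^+ 4)%:E : \bar R).
  by apply/measurable_EFinP; exact: measurable_funX.
rewrite (normal_integral s0 m2); last by move=> x; rewrite lee_fin exprn_even_ge0.
rewrite (_ : (\int[mu]_x _)%E = ((s ^+ 4)%:E * \int[mu]_x (gaussw x * x ^+ 4)%:E)%E).
  rewrite (_ : 64 * s ^+ 4 = q^-1 * (s ^+ 4 * (64 * q))); last by field; rewrite gt_eqF.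
  rewrite [X in (_ <= X)%E]EFinM; apply: lee_wpmul2l; first by rewrite lee_fin invr_ge0 ltW.
  rewrite [X in (_ <= X)%E]EFinM; apply: lee_wpmul2l; first by rewrite lee_fin exprn_ge0// ltW.
  exact: gauss_moment4.
rewrite -ge0_integralZl; last 4 first.
- exact: measurableT.
- apply/measurable_EFinP; apply: measurable_funM; last exact: measurable_funX.
  exact: measurable_gaussw.
- by move=> x _; rewrite lee_fin mulr_ge0 ?gaussw_ge0 ?exprn_even_ge0.
- by rewrite lee_fin exprn_ge0// ltW.
by apply: eq_integral => x _; rewrite -!EFinM; congr EFin; ring.
Qed.

End moments.

Section laws.
Context d (T : measurableType d) {R : realType} (P : probability T R).

Lemma law_integral d' (T' : measurableType d') (Z : T -> T')
    (nu : {measure set T' -> \bar R}) (f : T' -> \bar R) : measurable_fun setT Z ->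
  (forall A, measurable A -> P (Z @^-1` A) = nu A) ->
  measurable_fun setT f -> (forall x, 0 <= f x)%E ->
  (\int[P]_t f (Z t) = \int[nu]_x f x)%E.
Proof.
move=> mZ lawZ mf f0.
pose Zmix := isMeasurableFun.Build _ _ _ _ Z mZ.
pose Zf : {mfun T >-> T'} := HB.pack Z Zmix.
transitivity (\int[distribution P Zf]_y f y)%E; first by rewrite ge0_integral_distribution.
by apply: eq_measure_integral => A mA _; exact: lawZ.
Qed.

Lemma law_normal (Z : T -> R) (s : R) (f : R -> \bar R) : measurable_fun setT Z ->
  (forall A, measurable A -> P (Z @^-1` A) = normal_prob 0 s A) ->
  measurable_fun setT f -> (forall x, 0 <= f x)%E ->
  (\int[P]_t f (Z t) = \int[normal_prob 0 s]_x f x)%E.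
Proof.
move=> mZ lawZ mf f0.
exact: (@law_integral _ (g_sigma_algebraType (R.-ocitv.-measurable)) Z (normal_prob 0 s) f).
Qed.

Lemma law_pair (Z Y : T -> R) (s : R) : measurable_fun setT Z -> measurable_fun setT Y ->
  (forall A B, measurable A -> measurable B ->
    P (Z @^-1` A `&` Y @^-1` B) = normal_prob 0 s A * normal_prob 0 s B)%E ->
  (\int[P]_t (Z t ^+ 2 * Y t ^+ 2)%:E =
   \int[normal_prob 0 s]_x (x ^+ 2)%:E * \int[normal_prob 0 s]_x (x ^+ 2)%:E)%E.
Proof.
move=> mZ mY lawZY.
have mZY : measurable_fun setT (fun t => (Z t, Y t)) by exact: measurable_fun_pair.
have m2 : measurable_fun setT (fun x : R => (x ^+ 2)%:E : \bar R).
  by apply/measurable_EFinP; exact: measurable_funX.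
have mf : measurable_fun setT (fun z : R * R => (z.1 ^+ 2 * z.2 ^+ 2)%:E : \bar R).
  by apply/measurable_EFinP; apply: (@measurable_prodw _ (fun x => x ^+ 2) (fun x => x ^+ 2));
    exact: measurable_funX.
have f0 (z : R * R) : (0 <= (z.1 ^+ 2 * z.2 ^+ 2)%:E)%E by rewrite lee_fin mulr_ge0 ?sqr_ge0.
transitivity (\int[normal_prob 0 s \x normal_prob 0 s]_z (z.1 ^+ 2 * z.2 ^+ 2)%:E)%E.
  apply: (law_integral (nu := (normal_prob 0 s \x normal_prob 0 s)%E) mZY) => // A mA.
  pose R2 := (g_sigma_algebraType (R.-ocitv.-measurable) *
    g_sigma_algebraType (R.-ocitv.-measurable))%type.
  have mZY' : measurable_fun setT ((fun t => (Z t, Y t)) : T -> R2) by exact: mZY.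
  pose Zmix := isMeasurableFun.Build _ _ _ _ ((fun t => (Z t, Y t)) : T -> R2) mZY'.
  pose ZY : {mfun T >-> R2} := HB.pack ((fun t => (Z t, Y t)) : T -> R2) Zmix.
  have E : (normal_prob 0 s \x normal_prob 0 s)%E A = distribution P ZY A.
    have pu := @product_measure_unique _ _ _ _ R (normal_prob 0 s) (normal_prob 0 s) (distribution P ZY).
    by apply: pu => // B C mB mC; rewrite -lawZY.
  exact: esym E.
rewrite fubini_tonelli1// -ge0_integralZr//; last 2 first.
- by move=> x _; rewrite lee_fin sqr_ge0.
- by apply: integral_ge0 => x _; rewrite lee_fin sqr_ge0.
apply: eq_integral => x _; rewrite /fubini_F/= -ge0_integralZl//.
- by move=> y _; rewrite lee_fin sqr_ge0.
- by rewrite lee_fin sqr_ge0.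
Qed.

(** The law of large numbers in mean square: of the n^2 products in the square of
the sum, only the n diagonal ones exceed s^2 in the mean. *)
Lemma mean_square_dev n (Z : 'I_n -> T -> R) (s k : R) : (0 < n)%N -> 0 <= s ->
  (forall l, measurable_fun setT (Z l)) ->
  (forall l, \int[P]_t (Z l t ^+ 2)%:E = s%:E)%E ->
  (forall l, \int[P]_t (Z l t ^+ 4)%:E <= (k * s ^+ 2)%:E)%E ->
  (forall l m, l != m -> \int[P]_t (Z l t ^+ 2 * Z m t ^+ 2)%:E = (s ^+ 2)%:E)%E ->
  (\int[P]_t ((n%:R^-1 * \sum_l Z l t ^+ 2 - s) ^+ 2)%:E <= (k * s ^+ 2 / n%:R)%:E)%E.
Proof.
move=> n0 s0 mZ E2 E4 E22; have N0 : 0 < n%:R :> R by rewrite ltr0n.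
pose W t := n%:R^-1 * \sum_l Z l t ^+ 2.
have mZ2 l : measurable_fun setT (fun t => Z l t ^+ 2) by exact: measurable_funX.
have mW : measurable_fun setT W by apply: measurable_funM => //; exact: measurable_sum.
have W0 t : 0 <= W t.
  by rewrite mulr_ge0 ?invr_ge0// sumr_ge0// => l _; exact: sqr_ge0.
have EW : (\int[P]_t (W t)%:E = s%:E)%E.
  transitivity (n%:R^-1%:E * \sum_(l < n) \int[P]_t (Z l t ^+ 2)%:E)%E.
    rewrite -ge0_integral_sum//; last 2 first.
    - by move=> l; exact/measurable_EFinP.
    - by move=> l t _; rewrite lee_fin sqr_ge0.
    rewrite -ge0_integralZl//; last 2 first.
    - by apply: emeasurable_sum => l; exact/measurable_EFinP.
    - by move=> t _; apply: sume_ge0 => l _; rewrite lee_fin sqr_ge0.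
    by apply: eq_integral => t _; rewrite sumEFin.
  rewrite (eq_bigr (fun _ => s%:E)) ?sumEFin//.
  by rewrite sumr_const card_ord -mulr_natl -EFinM; congr EFin; field; rewrite gt_eqF.
have EW2 : (\int[P]_t (W t ^+ 2)%:E <= (k * s ^+ 2 / n%:R + s ^+ 2)%:E)%E.
  have -> : (\int[P]_t (W t ^+ 2)%:E = (n%:R^-1 ^+ 2)%:E *
      \sum_(l < n) \sum_(m < n) \int[P]_t (Z l t ^+ 2 * Z m t ^+ 2)%:E)%E.
    have z0 l m t : (0 <= (Z l t ^+ 2 * Z m t ^+ 2)%:E)%E.
      by rewrite lee_fin mulr_ge0 ?sqr_ge0.
    have mz l m : measurable_fun setT (fun t => (Z l t ^+ 2 * Z m t ^+ 2)%:E).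
      by apply/measurable_EFinP; exact: measurable_funM.
    transitivity ((n%:R^-1 ^+ 2)%:E *
        \sum_(l < n) \int[P]_t (\sum_(m < n) (Z l t ^+ 2 * Z m t ^+ 2)%:E))%E; last first.
      by congr (_ * _)%E; apply: eq_bigr => l _; rewrite ge0_integral_sum.
    rewrite -ge0_integral_sum//; last 2 first.
    - by move=> l; exact: emeasurable_sum.
    - by move=> l t _; apply: sume_ge0.
    rewrite -ge0_integralZl//; last 2 first.
    - by apply: emeasurable_sum => l; exact: emeasurable_sum.
    - by move=> t _; apply: sume_ge0 => l _; apply: sume_ge0.
    apply: eq_integral => t _; under eq_bigr do rewrite sumEFin.
    rewrite sumEFin -EFinM; congr EFin; rewrite /W exprMn; congr (_ * _).
    by rewrite expr2 mulr_suml; apply: eq_bigr => l _; rewrite mulr_sumr.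
  apply: (@le_trans _ _ ((n%:R^-1 ^+ 2)%:E * \sum_(l < n) (k * s ^+ 2 + n%:R * s ^+ 2)%:E)%E).
    apply: lee_wpmul2l; first by rewrite lee_fin sqr_ge0.
    apply: lee_sum => l _; rewrite (bigD1 l)//= EFinD leeD//.
      by under eq_integral do rewrite -exprD; exact: E4.
    rewrite (eq_bigr (fun _ => (s ^+ 2)%:E)); last by move=> m ml; rewrite E22// eq_sym.
    rewrite (eq_bigl (fun i => i \in predC1 l)); last by move=> i; rewrite !inE.
    rewrite sumEFin lee_fin sumr_const -[X in X <= _]mulr_natl ler_wpM2r ?sqr_ge0// ler_nat.
    by rewrite -[leqRHS]card_ord max_card.
  rewrite sumEFin -EFinM lee_fin sumr_const card_ord -mulr_natl.
  by rewrite le_eqVlt; apply/orP; left; apply/eqP; field; rewrite gt_eqF.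
have key : (\int[P]_t ((W t - s) ^+ 2)%:E + (2 * s)%:E * s%:E <=
    (k * s ^+ 2 / n%:R + s ^+ 2)%:E + (s ^+ 2)%:E)%E.
  rewrite -EW -ge0_integralZl//; last 3 first.
  - exact/measurable_EFinP.
  - by move=> t _; rewrite lee_fin.
  - by rewrite lee_fin mulr_ge0.
  rewrite -ge0_integralD//; last 4 first.
  - by move=> t _; rewrite lee_fin sqr_ge0.
  - by apply/measurable_EFinP; apply: measurable_funX; exact: measurable_funB.
  - by move=> t _; apply: mule_ge0; rewrite lee_fin ?W0// mulr_ge0.
  - by apply: emeasurable_funM => //; exact/measurable_EFinP.
  have -> : (\int[P]_t (((W t - s) ^+ 2)%:E + (2 * s)%:E * (W t)%:E) =
      \int[P]_t ((W t ^+ 2)%:E + (s ^+ 2)%:E))%E.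
    by apply: eq_integral => t _; rewrite -EFinM -!EFinD; congr EFin; ring.
  rewrite ge0_integralD//; last 3 first.
  - by move=> t _; rewrite lee_fin sqr_ge0.
  - by apply/measurable_EFinP; exact: measurable_funX.
  - by move=> t _; rewrite lee_fin sqr_ge0.
  have -> : (\int[P]__ (s ^+ 2)%:E = (s ^+ 2)%:E)%E.
    apply: etrans (integral_cst P measurableT (s ^+ 2)%:E) _.
    by rewrite -[RHS]mule1; congr (_ * _)%E; exact: probability_setT.
  by rewrite leeD2r.
move: key; rewrite -EFinM -EFinD.
case: (\int[P]_t _)%E => [I| |]; rewrite ?lee_fin ?leNye//.
move=> h; have : 2 * s * s = s ^+ 2 + s ^+ 2 by ring.
by lra.
Qed.

End laws.

Section sample_moments.
Context d (T : measurableType d) {R : realType} (P : probability T R).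
Variables (n p : nat) (X : 'I_n -> {RV P >-> p.-tuple R}) (S : 'M[R]_p).
Hypotheses (n0 : (0 < n)%N) (pS : posdefmx S) (gX : gaussian_sample X S).

Let Z (u : 'cV[R]_p) l w := (u^T *m colv (X l w)) 0 0.

Let mlin (u : 'cV[R]_p) : measurable_fun setT (fun y : p.-tuple R => (u^T *m colv y) 0 0).
Proof.
rewrite (_ : (fun y => _) = fun y : p.-tuple R => \sum_j u j 0 * tnth y j).
  by apply: measurable_sum => j; apply: measurable_funM => //; exact: measurable_tnth.
by apply/funext => y; rewrite mxE; apply: eq_bigr => j _; rewrite !mxE.
Qed.

Let mZ u l : measurable_fun setT (Z u l).
Proof. exact: measurableT_comp (mlin u) _. Qed.

(** The forms u^T X_l are N(0, s), and pairwise independent by the independence of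
the sample applied to boxes that constrain only two observations. *)
Lemma quadratic_mse u (s := (u^T *m S *m u) 0 0) :
  (\int[P]_w ((n%:R^-1 * \sum_l Z u l w ^+ 2 - s) ^+ 2)%:E <= (64 * s ^+ 2 / n%:R)%:E)%E.
Proof.
have [u0|u0] := eqVneq u 0.
  have s0 : s = 0 by rewrite /s u0 mulmx0 mxE.
  rewrite s0 expr0n /= mulr0 mul0r integral0_eq// => w _.
  rewrite big1 ?mulr0 ?subr0 ?expr0n// => l _.
  by rewrite /Z u0 trmx0 mul0mx mxE expr0n.
have s0 : 0 < s by have [_ h] := pS; exact: h.
have ss : Num.sqrt s ^+ 2 = s by rewrite sqr_sqrtr// ltW.
have q0 : 0 < Num.sqrt s by rewrite sqrtr_gt0.
have [indX cX] := gX.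
have lawZ l A : measurable A -> P (Z u l @^-1` A) = normal_prob 0 (Num.sqrt s) A.
  by move=> mA; exact: (cX l u u0 A mA).
have E2 l : (\int[P]_t (Z u l t ^+ 2)%:E = s%:E)%E.
  rewrite -[in RHS]ss -normal_moment2//.
  apply: (law_normal (f := fun x => (x ^+ 2)%:E) (mZ u l)).
  - by move=> A mA; exact: lawZ.
  - by apply/measurable_EFinP; exact: measurable_funX.
  - by move=> x; rewrite lee_fin sqr_ge0.
apply: mean_square_dev => // [|l|l m lm]; first exact: ltW.
  have -> : 64 * s ^+ 2 = 64 * Num.sqrt s ^+ 4 by rewrite -[in LHS]ss -exprM.
  apply: le_trans (normal_moment4 q0).
  rewrite (law_normal (s := Num.sqrt s) (f := fun x => (x ^+ 4)%:E) (mZ u l))//.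
  - by move=> A mA; exact: lawZ.
  - by apply/measurable_EFinP; exact: measurable_funX.
  - by move=> x; rewrite lee_fin exprn_even_ge0.
rewrite (law_pair (s := Num.sqrt s))// ?normal_moment2// ?ss -?EFinM -?expr2//.
move=> A B mA mB.
pose C k : set (p.-tuple R) := if k == l then (fun y => (u^T *m colv y) 0 0) @^-1` A
  else if k == m then (fun y => (u^T *m colv y) 0 0) @^-1` B else setT.
have mpre (D : set R) : measurable D ->
    measurable ((fun y : p.-tuple R => (u^T *m colv y) 0 0) @^-1` D).
  by move=> mD; rewrite -[X in measurable X]setTI; exact: mlin.
have mC k : measurable (C k).
  by rewrite /C; case: ifP => _; [exact: mpre|case: ifP => _; [exact: mpre|]].
have -> : Z u l @^-1` A `&` Z u m @^-1` B = \bigcap_k (X k @^-1` C k).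
  apply/seteqP; split=> w /=.
    by move=> [wA wB] k _; rewrite /C /=; case: eqP => [->//|_]; case: eqP => [->|].
  move=> h; split.
    by have := h l I; rewrite /C eqxx.
  by have := h m I; rewrite /C eq_sym (negbTE lm) eqxx.
rewrite (indX C mC) (bigD1 l)//= (bigD1 m) 1?eq_sym//= big1 ?mule1.
  rewrite {1}/C eqxx {1}/C eq_sym (negbTE lm) eqxx.
  by congr (_ * _)%E; [exact: lawZ|exact: lawZ].
by move=> k /andP[kl km]; rewrite /C (negbTE kl) (negbTE km) preimage_setT probability_setT.
Qed.

Lemma sample_covE (x : 'I_n -> p.-tuple R) i j :
  sample_cov x i j = n%:R^-1 * \sum_l tnth (x l) i * tnth (x l) j.
Proof.
rewrite /sample_cov mxE summxE; congr (_ * _); apply: eq_bigr => l _.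
by rewrite mxE big_ord1 !mxE.
Qed.

Lemma measurable_sample_cov i j :
  measurable_fun setT (fun w => sample_cov (fun l => X l w) i j).
Proof.
under eq_fun do rewrite sample_covE.
apply: measurable_funM => //; apply: measurable_sum => l; apply: measurable_funM.
  exact: measurableT_comp (measurable_tnth i) _.
exact: measurableT_comp (measurable_tnth j) _.
Qed.

(** Polarization: 4 Shat_ij is the difference of the empirical second moments of
X_i + X_j and X_i - X_j, whose variances are at most 4 c. *)
Lemma sample_cov_mse (c : R) i j : (forall k, S k k <= c) ->
  (\int[P]_w ((sample_cov (fun l => X l w) i j - S i j) ^+ 2)%:E <=
   (256 * c ^+ 2 / n%:R)%:E)%E.
Proof.
move=> Sc; have N0 : 0 < n%:R :> R by rewrite ltr0n.
pose e k : 'cV[R]_p := delta_mx k 0.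
pose up := e i + e j; pose um := e i - e j.
pose s (u : 'cV[R]_p) := (u^T *m S *m u) 0 0.
pose W u w := n%:R^-1 * \sum_l Z u l w ^+ 2.
have add00 (A B : 'M[R]_1) : (A + B) 0 0 = A 0 0 + B 0 0 by rewrite mxE.
have sub00 (A B : 'M[R]_1) : (A - B) 0 0 = A 0 0 - B 0 0 by rewrite !mxE.
have eSe k l : ((e k)^T *m S *m e l) 0 0 = S k l.
  by rewrite /e trmx_delta -rowE -colE !mxE.
have eX k l w : ((e k)^T *m colv (X l w)) 0 0 = tnth (X l w) k.
  by rewrite /e trmx_delta -rowE !mxE.
have Sji : S j i = S i j by have [tS _] := pS; rewrite -[in LHS]tS mxE.
have sp : s up = S i i + S j j + 2 * S i j.
  rewrite /s /up [(_ + _)^T]linearD/= !mulmxDl !mulmxDr !add00 !eSe Sji; ring.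
have sm : s um = S i i + S j j - 2 * S i j.
  rewrite /s /um [(_ - _)^T]linearB/= !mulmxBl !mulmxBr !sub00 !eSe Sji; ring.
have s0 u : 0 <= s u.
  have [->|u0] := eqVneq u 0; first by rewrite /s mulmx0 mxE.
  by have [_ h] := pS; apply/ltW/h.
have sc u : u = up \/ u = um -> 64 * s u ^+ 2 / n%:R <= 1024 * c ^+ 2 / n%:R.
  move=> h; have su : s u <= 4 * c.
    have := s0 up; have := s0 um; have := Sc i; have := Sc j.
    by case: h => ->; rewrite sp sm; lra.
  by rewrite ler_pM2r ?invr_gt0//; have := s0 u; nra.
have Zp l w : Z up l w = tnth (X l w) i + tnth (X l w) j.
  by rewrite /Z /up [(_ + _)^T]linearD/= mulmxDl add00 !eX.
have Zm l w : Z um l w = tnth (X l w) i - tnth (X l w) j.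
  by rewrite /Z /um [(_ - _)^T]linearB/= mulmxBl sub00 !eX.
have mW u : measurable_fun setT (fun w => ((W u w - s u) ^+ 2)%:E).
  apply/measurable_EFinP; apply: measurable_funX; apply: measurable_funB => //.
  apply: measurable_funM => //; apply: measurable_sum => l; apply: measurable_funX.
  exact: mZ.
have W0 u w : (0 <= ((W u w - s u) ^+ 2)%:E)%E by rewrite lee_fin sqr_ge0.
apply: (@le_trans _ _ (8^-1%:E * (\int[P]_w ((W up w - s up) ^+ 2)%:E +
    \int[P]_w ((W um w - s um) ^+ 2)%:E))%E).
  rewrite -ge0_integralD; last 5 first.
  - exact: measurableT.
  - by move=> w _; exact: W0.
  - exact: mW.
  - by move=> w _; exact: W0.
  - exact: mW.
  rewrite -ge0_integralZl; last 4 first.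
  - exact: measurableT.
  - by apply: emeasurable_funD; exact: mW.
  - by move=> w _; rewrite adde_ge0// W0.
  - by rewrite lee_fin invr_ge0.
  apply: ge0_le_integral => //.
  - by move=> w _; rewrite lee_fin sqr_ge0.
  - apply/measurable_EFinP; apply: measurable_funX; apply: measurable_funB => //.
    exact: measurable_sample_cov.
  - by apply: emeasurable_funM => //; apply: emeasurable_funD; exact: mW.
  move=> w _; rewrite -EFinD -EFinM lee_fin.
  have -> : sample_cov (fun l => X l w) i j = (W up w - W um w) / 4.
    rewrite sample_covE /W -mulrBr -mulrA; congr (_ * _).
    rewrite -sumrB mulr_suml; apply: eq_bigr => l _; rewrite Zp Zm.
    by field.
  rewrite (_ : S i j = (s up - s um) / 4); last by rewrite sp sm; field.
  by have := sqr_ge0 ((W up w - s up) + (W um w - s um)); nra.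
apply: (@le_trans _ _ (8^-1%:E * ((1024 * c ^+ 2 / n%:R)%:E + (1024 * c ^+ 2 / n%:R)%:E))%E).
  apply: lee_wpmul2l; first by rewrite lee_fin invr_ge0.
  by apply: leeD; (apply: le_trans (quadratic_mse _) _); rewrite lee_fin; apply: sc; [left|right].
by rewrite -EFinD -EFinM lee_fin; lra.
Qed.

End sample_moments.

(** * Spectral norm and perturbation of the inverse *)

Section norms.
Context {R : realType}.

Definition sqnorm m (u : 'cV[R]_m) : R := \sum_i u i 0 ^+ 2.

Lemma sqnorm_ge0 m (u : 'cV[R]_m) : 0 <= sqnorm u.
Proof. by apply: sumr_ge0 => i _; exact: sqr_ge0. Qed.

Lemma sqnorm_eq0 m (u : 'cV[R]_m) : sqnorm u = 0 -> u = 0.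
Proof.
move=> u0; apply/matrixP => i j; rewrite ord1 mxE; apply/eqP; rewrite -sqrf_eq0.
have := u0; rewrite /sqnorm => /eqP; rewrite psumr_eq0 => [/allP/(_ i)|k _]; last exact: sqr_ge0.
by rewrite mem_index_enum => /(_ isT).
Qed.

Lemma sqnormZ m (k : R) (u : 'cV[R]_m) : sqnorm (k *: u) = k ^+ 2 * sqnorm u.
Proof. by rewrite /sqnorm mulr_sumr; apply: eq_bigr => i _; rewrite mxE exprMn. Qed.

Lemma sqnormD_le m (u v : 'cV[R]_m) : sqnorm (u + v) <= 2 * sqnorm u + 2 * sqnorm v.
Proof.
rewrite /sqnorm !mulr_sumr -big_split/=; apply: ler_sum => i _; rewrite mxE.
by have := sqr_ge0 (u i 0 - v i 0); nra.
Qed.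

Lemma entry_le_sqnorm m (u : 'cV[R]_m) i : u i 0 ^+ 2 <= sqnorm u.
Proof.
by rewrite /sqnorm (bigD1 i)//= lerDl sumr_ge0// => j _; exact: sqr_ge0.
Qed.

Lemma sqnorm_delta m (i : 'I_m) : sqnorm (delta_mx i 0 : 'cV[R]_m) = 1.
Proof.
rewrite /sqnorm (bigD1 i)//= mxE !eqxx expr1n big1 ?addr0// => j ji.
by rewrite mxE (negbTE ji) expr0n.
Qed.

(** Lagrange's identity. *)
Lemma cauchy_schwarz_sum m (a b : 'I_m -> R) :
  (\sum_i a i * b i) ^+ 2 <= (\sum_i a i ^+ 2) * (\sum_i b i ^+ 2).
Proof.
have key : 0 <= \sum_i \sum_j (a i * b j - a j * b i) ^+ 2.
  by apply: sumr_ge0 => i _; apply: sumr_ge0 => j _; exact: sqr_ge0.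
have E : \sum_i \sum_j (a i * b j - a j * b i) ^+ 2 =
    2 * ((\sum_i a i ^+ 2) * (\sum_i b i ^+ 2)) - 2 * (\sum_i a i * b i) ^+ 2.
  have -> : 2 * ((\sum_i a i ^+ 2) * (\sum_i b i ^+ 2)) =
      \sum_i \sum_j a i ^+ 2 * b j ^+ 2 + \sum_i \sum_j a j ^+ 2 * b i ^+ 2.
    rewrite [X in _ = _ + X]exchange_big/= mulr2n mulrDl mul1r mulr_suml.
    by congr (_ + _); apply: eq_bigr => i _; rewrite mulr_sumr.
  have -> : 2 * (\sum_i a i * b i) ^+ 2 = \sum_i \sum_j 2 * (a i * b i) * (a j * b j).
    rewrite expr2 mulr_suml mulr_sumr; apply: eq_bigr => i _.
    by rewrite mulr_sumr mulr_sumr; apply: eq_bigr => j _; rewrite mulrA.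
  rewrite -big_split/= -sumrB; apply: eq_bigr => i _.
  by rewrite -big_split/= -sumrB; apply: eq_bigr => j _; ring.
by rewrite E in key; lra.
Qed.

Definition frob2 p (E : 'M[R]_p) : R := \sum_i \sum_j E i j ^+ 2.

Lemma sqnorm_frob p (E : 'M[R]_p) u : sqnorm (E *m u) <= frob2 E * sqnorm u.
Proof.
rewrite /frob2 mulr_suml; apply: ler_sum => i _; rewrite mxE.
exact: cauchy_schwarz_sum.
Qed.

Lemma spectral_norm_bound p (A : 'M[R]_p) (C : R) u : spectral_norm A <= C ->
  sqnorm (A *m u) <= C ^+ 2 * sqnorm u.
Proof.
move=> AC; have l2 (v : 'cV[R]_p) : l2norm v = Num.sqrt (sqnorm v) by [].
have ub v : l2norm v <= 1 -> l2norm (A *m v) <= C.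
  move=> v1; apply: le_trans AC; apply: ub_le_sup; last by exists v.
  exists (Num.sqrt (frob2 A)) => _ [w w1 <-]; rewrite l2 ler_wsqrtr//.
  apply: le_trans (sqnorm_frob _ _) _; rewrite ler_piMr//.
    by apply: sumr_ge0 => i _; apply: sumr_ge0 => j _; exact: sqr_ge0.
  by move: w1; rewrite /= l2 -[X in _ <= X]sqrtr1 ler_sqrt.
have C0 : 0 <= C.
  apply: le_trans (ub 0 _); first by rewrite l2 sqrtr_ge0.
  by rewrite l2 /sqnorm big1 ?sqrtr0// => i _; rewrite mxE expr0n.
have [u0|u0] := eqVneq (sqnorm u) 0.
  by rewrite (sqnorm_eq0 u0) mulmx0 /sqnorm big1 ?mulr_ge0 ?sqr_ge0 ?sumr_ge0// => i _;
    rewrite !mxE ?expr0n// sqr_ge0.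
have up : 0 < sqnorm u by rewrite lt_neqAle eq_sym u0 sqnorm_ge0.
pose k := (Num.sqrt (sqnorm u))^-1.
have k2 : k ^+ 2 = (sqnorm u)^-1 by rewrite exprVn sqr_sqrtr// ltW.
have := ub (k *: u); rewrite l2 sqnormZ k2 mulVf ?gt_eqF// sqrtr1 lexx => /(_ isT).
rewrite l2 -scalemxAr sqnormZ k2 => h.
have : (sqnorm u)^-1 * sqnorm (A *m u) <= C ^+ 2.
  rewrite -(@ler_sqrt _ _ (C ^+ 2)) ?exprn_ge0// sqrtr_sqr ger0_norm//.
by rewrite mulrC ler_pdivrMr.
Qed.

Lemma pair_arith (a c b e : R) : 0 < e -> 0 <= b ^+ 2 -> e <= c -> e <= a ->
  e ^+ 2 <= a * c + b ^+ 2.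
Proof. nra. Qed.

Lemma lower_arith (a g c e f : R) : a <= g * c -> c <= 2 * e + 2 * (f * a) ->
  f * a * (4 * g) <= a -> 0 <= a -> 0 < g -> a <= 4 * g * e.
Proof. nra. Qed.

Section spectral.
Variables (p : nat) (S : 'M[R]_p) (C : R).
Hypotheses (pS : posdefmx S) (C1 : 1 <= C).
Hypotheses (SC : spectral_norm S <= C) (OC : spectral_norm (invmx S) <= C).

Let C0 : 0 < C. Proof. exact: lt_le_trans ltr01 C1. Qed.

Lemma spectral_entry_le i j : `|S i j| <= C.
Proof.
rewrite -(@ler_pXn2r _ 2) ?nnegrE ?(ltW C0)//.
rewrite real_normK ?num_real//.
have -> : S i j = (S *m delta_mx j 0 : 'cV[R]_p) i 0 by rewrite -colE mxE.
apply: le_trans (entry_le_sqnorm _ _) _.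
by apply: le_trans (spectral_norm_bound _ SC) _; rewrite sqnorm_delta mulr1.
Qed.

Lemma spectral_inv_diag_le i : invmx S i i <= C.
Proof.
apply: le_trans (ler_norm _) _.
rewrite -(@ler_pXn2r _ 2) ?nnegrE ?(ltW C0)//.
rewrite real_normK ?num_real//.
have -> : invmx S i i = (invmx S *m delta_mx i 0 : 'cV[R]_p) i 0 by rewrite -colE mxE.
apply: le_trans (entry_le_sqnorm _ _) _.
by apply: le_trans (spectral_norm_bound _ OC) _; rewrite sqnorm_delta mulr1.
Qed.

(** The quadratic form at e - y / (S^-1)_ii, with y = S^-1 e, equals
S_ii - 1 / (S^-1)_ii. *)
Lemma diag_inv_ge1 i : 1 <= S i i * invmx S i i.
Proof.
have uS := posdef_unit pS; have [tS qS] := pS.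
have Oi : 0 < invmx S i i by apply: posdef_diag_gt0; exact: posdef_inv.
pose e : 'cV[R]_p := delta_mx i 0; pose y := invmx S *m e.
pose u := e - (invmx S i i)^-1 *: y.
have u0 : 0 <= (u^T *m S *m u) 0 0.
  have [->|un0] := eqVneq u 0; first by rewrite mulmx0 mxE.
  exact/ltW/qS.
have Sy : S *m y = e by rewrite /y mulmxA mulmxV// mul1mx.
have yS : y^T *m S = e^T by rewrite -[LHS]trmxK trmx_mul trmxK tS Sy.
have add00 (A B : 'M[R]_1) : (A - B) 0 0 = A 0 0 - B 0 0 by rewrite !mxE.
have e1 : (e^T *m S *m e) 0 0 = S i i by rewrite /e trmx_delta -rowE -colE !mxE.
have e2 : (e^T *m S *m y) 0 0 = 1 by rewrite -mulmxA Sy /e trmx_delta -rowE !mxE !eqxx.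
have e3 : (y^T *m S *m e) 0 0 = 1 by rewrite yS /e trmx_delta -rowE !mxE !eqxx.
have e4 : (y^T *m S *m y) 0 0 = invmx S i i.
  by rewrite yS /y /e trmx_delta -rowE -colE !mxE.
move: u0; rewrite /u [(_ - _)^T]linearB/= [(_ *: _)^T]linearZ/= !mulmxBl !mulmxBr.
rewrite -!scalemxAr -!scalemxAl !(add00, mx11Z) e1 e2 e3 e4.
set w := invmx S i i in Oi *.
rewrite mulr1 mulVf ?gt_eqF// mulr1 subrr subr0 subr_ge0 => h.
by have := ler_wpM2r (ltW Oi) h; rewrite mulVf// gt_eqF.
Qed.

Lemma spectral_diag_ge i : C^-1 <= S i i.
Proof.
have h := diag_inv_ge1 i; have Si := posdef_diag_gt0 i pS.
rewrite -[C^-1]mul1r ler_pdivrMr//.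
by apply: le_trans h _; rewrite ler_pM2l// spectral_inv_diag_le.
Qed.

(** The bounds on both norms keep the limiting standard deviation away from 0. *)
Lemma pair_scale_ge i j : C^-1 <= pair_scale S i j.
Proof.
have Ci : 0 < C^-1 by rewrite invr_gt0.
rewrite -[leLHS]ger0_norm ?(ltW Ci)// -sqrtr_sqr /pair_scale ler_wsqrtr//.
by apply: pair_arith => //; [exact: sqr_ge0|exact: spectral_diag_ge|exact: spectral_diag_ge].
Qed.

(** If |M - S| is at most 1 / (2 C) and |S^-1| <= C, then |M v| is at least
|v| / (2 C): the perturbation eats up at most half of |S v|. *)
Lemma sqnorm_lower (M : 'M[R]_p) (f : R) v :
  (forall u, sqnorm ((M - S) *m u) <= f * sqnorm u) -> f <= (4 * C ^+ 2)^-1 ->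
  sqnorm v <= 4 * C ^+ 2 * sqnorm (M *m v).
Proof.
move=> Mf fC; have C20 : 0 < C ^+ 2 by rewrite exprn_gt0.
have v0 := sqnorm_ge0 v.
have h1 : sqnorm v <= C ^+ 2 * sqnorm (S *m v).
  rewrite -{1}(mul1mx v) -(mulVmx (posdef_unit pS)) -mulmxA.
  exact: spectral_norm_bound.
have h2 : sqnorm (S *m v) <= 2 * sqnorm (M *m v) + 2 * (f * sqnorm v).
  have -> : S *m v = M *m v + (-1) *: ((M - S) *m v).
    by rewrite mulmxBl scaleN1r opprB addrC subrK.
  apply: le_trans (sqnormD_le _ _) _; rewrite lerD2l ler_pM2l// sqnormZ sqrrN expr1n mul1r.
  exact: Mf.
have h3 : f * sqnorm v * (4 * C ^+ 2) <= sqnorm v.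
  rewrite mulrAC -[leRHS]mul1r ler_wpM2r//.
  by rewrite -ler_pdivlMr ?mulr_gt0// mul1r.
exact: (lower_arith h1 h2 h3).
Qed.

Lemma perturb_unit (M : 'M[R]_p) (f : R) :
  (forall u, sqnorm ((M - S) *m u) <= f * sqnorm u) -> f <= (4 * C ^+ 2)^-1 ->
  M^T = M -> M \in unitmx.
Proof.
move=> Mf fC tM; rewrite unitmxE unitfE; apply/det0P => -[w w0 wM].
move/eqP: w0; apply; rewrite -[w]trmxK; apply/eqP; rewrite trmx_eq0; apply/eqP.
apply: sqnorm_eq0; apply/eqP; rewrite eq_le sqnorm_ge0 andbT.
apply: le_trans (sqnorm_lower _ Mf fC) _.
have -> : M *m w^T = 0 by rewrite -[M]tM -trmx_mul wM trmx0.
by rewrite /sqnorm big1 ?mulr0// => i _; rewrite mxE expr0n.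
Qed.

(** With d = (M^-1 - S^-1) e, M d = - (M - S) S^-1 e, and [sqnorm_lower] bounds d
by M d. *)
Lemma perturb_inv (M : 'M[R]_p) (f : R) i j :
  (forall u, sqnorm ((M - S) *m u) <= f * sqnorm u) -> f <= (4 * C ^+ 2)^-1 ->
  M^T = M -> (invmx M i j - invmx S i j) ^+ 2 <= 4 * C ^+ 4 * f.
Proof.
move=> Mf fC tM; have uM := perturb_unit Mf fC tM; have uS := posdef_unit pS.
pose e : 'cV[R]_p := delta_mx j 0.
pose d := (invmx M - invmx S) *m e.
have -> : invmx M i j - invmx S i j = d i 0 by rewrite /d /e -colE !mxE.
apply: le_trans (entry_le_sqnorm _ _) _.
apply: le_trans (sqnorm_lower _ Mf fC) _.
have -> : M *m d = (-1) *: ((M - S) *m (invmx S *m e)).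
  rewrite /d mulmxA mulmxBr mulmxV// mulmxBl mul1mx -mulmxA.
  by rewrite scaleN1r mulmxBl (mulmxA S) mulmxV// mul1mx opprB.
rewrite sqnormZ sqrrN expr1n mul1r.
have f0 : 0 <= f by have := Mf e; rewrite sqnorm_delta mulr1; apply: le_trans; exact: sqnorm_ge0.
have h : sqnorm ((M - S) *m (invmx S *m e)) <= f * C ^+ 2.
  apply: le_trans (Mf _) _; rewrite ler_wpM2l//.
  by apply: le_trans (spectral_norm_bound _ OC) _; rewrite sqnorm_delta mulr1.
rewrite (_ : 4 * C ^+ 4 * f = 4 * C ^+ 2 * (f * C ^+ 2)); last by ring.
by rewrite ler_wpM2l// mulr_ge0// sqr_ge0.
Qed.

(** Adding t to the diagonal moves the inverse by O(t). With t = 1 / n this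
compares (Shat + 1 / n)^-1 with Shat^-1, where [perturb_inv] would only give
the size of Shat - S. *)
Lemma perturb_inv2 (M : 'M[R]_p) (f t : R) i j :
  (forall u, sqnorm ((M - S) *m u) <= f * sqnorm u) -> f <= (4 * C ^+ 2)^-1 ->
  (forall u, sqnorm ((M + t%:M - S) *m u) <= f * sqnorm u) ->
  M^T = M -> (invmx (M + t%:M) i j - invmx M i j) ^+ 2 <= 16 * C ^+ 4 * t ^+ 2.
Proof.
move=> Mf fC M1f tM; have uM := perturb_unit Mf fC tM.
have tM1 : (M + t%:M)^T = M + t%:M by rewrite linearD/= tr_scalar_mx tM.
have uM1 := perturb_unit M1f fC tM1.
pose e : 'cV[R]_p := delta_mx j 0.
pose d := (invmx (M + t%:M) - invmx M) *m e.
have -> : invmx (M + t%:M) i j - invmx M i j = d i 0 by rewrite /d /e -colE !mxE.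
have C20 : 0 <= 4 * C ^+ 2 by rewrite mulr_ge0// sqr_ge0.
apply: le_trans (entry_le_sqnorm _ _) _.
apply: le_trans (sqnorm_lower _ M1f fC) _.
have -> : (M + t%:M) *m d = (- t) *: (invmx M *m e).
  rewrite /d mulmxA mulmxBr mulmxV// (mulmxDl M) mulmxV// mul_scalar_mx opprD addNKr.
  by rewrite -scaleNr -scalemxAl.
rewrite sqnormZ sqrrN.
have h : sqnorm (invmx M *m e) <= 4 * C ^+ 2.
  apply: le_trans (sqnorm_lower _ Mf fC) _.
  by rewrite mulmxA mulmxV// mul1mx sqnorm_delta mulr1.
rewrite (_ : 16 * C ^+ 4 * t ^+ 2 = 4 * C ^+ 2 * (t ^+ 2 * (4 * C ^+ 2))); last by ring.
by rewrite ler_wpM2l// ler_wpM2l// sqr_ge0.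
Qed.

End spectral.
End norms.

(** * From deviations of the data to the mean gap *)

Section averaging.
Context {R : realType}.

(** The integral of a nonnegative function is a supremum over simple functions
below it, hence monotone without measurability. The Kolmogorov gap, a supremum
over all t, is only known to be bounded. *)
Lemma le_integral_nonmeas d (T : measurableType d) (mu : {measure set T -> \bar R})
  (f g : T -> \bar R) : (forall x, 0 <= f x)%E -> (forall x, f x <= g x)%E ->
  (\int[mu]_x f x <= \int[mu]_x g x)%E.
Proof.
move=> f0 fg; have g0 x : (0 <= g x)%E by exact: le_trans (f0 x) (fg x).
rewrite !ge0_integralTE//; apply: le_ereal_sup => _ [h hf <-].
by exists h => // x; exact: le_trans (hf x) (fg x).
Qed.

Lemma fine_ratio_unit (a b : \bar R) : (0 <= a)%E -> (a <= b)%E ->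
  0 <= fine a / fine b <= 1.
Proof.
move=> a0 ab; have b0 : (0 <= b)%E by exact: le_trans ab.
rewrite divr_ge0 ?fine_ge0//=.
case: b a a0 ab b0 => [b| |] [a| |]//; rewrite ?invr0 ?mulr0 ?ler01//.
rewrite !lee_fin /= => a0 ab b0; have [->|bn] := eqVneq b 0; first by rewrite invr0 mulr0.
by rewrite ler_pdivrMr ?mul1r// lt_neqAle eq_sym bn.
Qed.

(** An evidence equal to 0 or to infinity makes the quotient 0, within the same
bounds. *)
Lemma posterior_unit n p b (x : 'I_n -> p.-tuple R) B : 0 <= posterior b x B <= 1.
Proof.
have g0 v : (0 <= (expR (loglik x (sym_mx v)))%:E)%E by rewrite lee_fin expR_ge0.
apply: fine_ratio_unit; first by apply: integral_ge0.
rewrite integral_mkcond; apply: le_integral_nonmeas => v; rewrite patchE; case: ifP => //.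
Qed.

Lemma kolmogorov_gap_unit n p b (x : 'I_n -> p.-tuple R) f :
  (0 <= kolmogorov_gap b x f <= 1)%E.
Proof.
apply/andP; split.
  apply: le_trans (ereal_sup_ubound _); last by exists 0.
  by rewrite lee_fin.
apply: ge_ereal_sup => _ [t _ <-]; rewrite lee_fin.
have /andP[p0 p1] := posterior_unit b x [set Om | f Om <= t].
have /andP[q0 q1] : 0 <= fine (normal_prob 0 1 `]-oo, t] : \bar R) <= 1.
  rewrite fine_ge0 ?measure_ge0//= -lee_fin fineK ?fin_num_measure//.
  exact: probability_le1.
by rewrite ler_norml; lra.
Qed.

(** Convergence along every sequence of data sets with vanishing deviation is
uniform: otherwise a bad data set could be chosen at each stage l, with
deviation at most 1 / (l + 1). The predicate c selects the stages to which the
sequential statement applies. *)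
Lemma uniform_of_seq (U : nat -> Type) (c : nat -> Prop) (dev : forall k, U k -> R)
  (gap : forall k, U k -> \bar R) : (forall k u, 0 <= dev k u) ->
  (forall (s : nat -> nat) (x : forall l, U (s l)), (forall l, l <= s l)%N ->
    (forall l, c (s l)) -> dev (s l) (x l) @[l --> \oo] --> 0 ->
    forall e, 0 < e -> \forall l \near \oo, (gap (s l) (x l) <= e%:E)%E) ->
  forall e, 0 < e -> exists2 de, 0 < de & exists K : nat, forall k, (K <= k)%N -> c k ->
    forall u : U k, dev k u <= de -> (gap k u <= e%:E)%E.
Proof.
move=> dev0 seqh e e0; apply: contrapT => hn.
have step (l : nat) : exists ku : {k & U k}, [/\ (l <= projT1 ku)%N, c (projT1 ku),
    dev _ (projT2 ku) <= l.+1%:R^-1 & ~ (gap _ (projT2 ku) <= e%:E)%E].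
  apply: contrapT => hl; apply: hn; exists l.+1%:R^-1; first by rewrite invr_gt0.
  exists l => k lk ck u du; apply: contrapT => gu; apply: hl.
  by exists (existT _ k u).
have [f fP] := choice step.
have : \forall l \near \oo, (gap (projT1 (f l)) (projT2 (f l)) <= e%:E)%E.
  apply: (seqh (fun l => projT1 (f l)) (fun l => projT2 (f l))) => //.
  - by move=> l; have [] := fP l.
  - by move=> l; have [] := fP l.
  apply: (@cvg_dist_le _ _ (fun l => l.+1%:R^-1)); last exact: cvg_harmonic.
  by apply: nearW => l; rewrite subr0 ger0_norm//; have [] := fP l.
by move=> [l _ /(_ l (leqnn l))]; have [] := fP l.
Qed.

(** A gap in [0, 1] that is at most e on dev <= de satisfies
gap <= e + dev / de everywhere. *)
Lemma mean_gap_cvg (d : nat -> measure_display) (T : forall k, measurableType (d k))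
  (P : forall k, probability (T k) R) (gap : forall k, T k -> \bar R)
  (dev : forall k, T k -> R) (r : nat -> R) :
  (forall k w, 0 <= gap k w <= 1)%E ->
  (forall k, measurable_fun setT (dev k)) -> (forall k w, 0 <= dev k w) ->
  (\forall k \near \oo, (\int[P k]_w (dev k w)%:E <= (r k)%:E)%E) ->
  r k @[k --> \oo] --> 0 ->
  (forall e, 0 < e -> exists2 de, 0 < de & exists K : nat, forall k, (K <= k)%N ->
    forall w, dev k w <= de -> (gap k w <= e%:E)%E) ->
  (\int[P k]_w gap k w)%E @[k --> \oo] --> (0 : \bar R)%E.
Proof.
move=> gap01 mdev dev0 Edev r0 unif.
have g0 k w : (0 <= gap k w)%E by have /andP[] := gap01 k w.
have g1 k w : (gap k w <= 1)%E by have /andP[] := gap01 k w.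
have I0 k : (0 <= \int[P k]_w gap k w)%E by exact: integral_ge0.
have I1 k : (\int[P k]_w gap k w <= 1)%E.
  apply: (@le_trans _ _ (\int[P k]_w (cst 1%E w))%E); first exact: le_integral_nonmeas.
  rewrite le_eqVlt; apply/orP; left; apply/eqP.
  apply: etrans (integral_cst (P k) measurableT 1%E) _.
  by rewrite mul1e; exact: probability_setT.
have If k : (\int[P k]_w gap k w)%E \is a fin_num.
  by rewrite ge0_fin_numE//; apply: le_lt_trans (I1 k) _; exact: ltry.
apply: cvg_EFin; first exact: nearW.
apply/cvgr0Pnorm_le => e e0; have e20 : 0 < e / 2 by rewrite divr_gt0.
have [de de0 [K KP]] := unif _ e20.
near=> k; rewrite /= ger0_norm ?fine_ge0// -lee_fin fineK//.
have kK : (K <= k)%N by near: k; exact: nbhs_infty_ge.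
have rk : r k <= de * (e / 2).
  by apply: le_trans (ler_norm _) _; near: k; apply: cvgr0_norm_le => //; rewrite mulr_gt0.
have Ek : (\int[P k]_w (dev k w)%:E <= (r k)%:E)%E by near: k; exact: Edev.
apply: (@le_trans _ _ (\int[P k]_w ((cst (e / 2)%:E w) + de^-1%:E * (dev k w)%:E))%E).
  apply: le_integral_nonmeas => // w; rewrite /= -EFinM -EFinD.
  have [dd|dd] := leP (dev k w) de.
    apply: le_trans (KP k kK w dd) _; rewrite lee_fin lerDl mulr_ge0 ?invr_ge0//.
    exact: ltW.
  apply: le_trans (g1 k w) _; rewrite lee_fin mulrC.
  have : 1 <= dev k w / de by rewrite ler_pdivlMr// mul1r ltW.
  by lra.
have md : measurable_fun setT (fun w => (dev k w)%:E) by exact/measurable_EFinP.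
rewrite ge0_integralD; last 5 first.
- exact: measurableT.
- by move=> w _; rewrite lee_fin ltW.
- exact: measurable_cst.
- by move=> w _; rewrite mule_ge0 ?lee_fin ?invr_ge0 ?(ltW de0).
- exact: emeasurable_funM.
rewrite ge0_integralZl; last 4 first.
- exact: measurableT.
- exact: md.
- by move=> w _; rewrite lee_fin.
- by rewrite lee_fin invr_ge0 ltW.
have -> : (\int[P k]_w (cst (e / 2)%:E w) = (e / 2)%:E)%E.
  apply: etrans (integral_cst (P k) measurableT (e / 2)%:E) _.
  by rewrite -[RHS]mule1; congr (_ * _)%E; exact: probability_setT.
apply: (@le_trans _ _ ((e / 2)%:E + de^-1%:E * (r k)%:E)%E).
  by rewrite leeD2l// lee_wpmul2l// lee_fin invr_ge0 ltW.
rewrite -EFinM -EFinD lee_fin.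
have : de^-1 * r k <= de^-1 * (de * (e / 2)) by rewrite ler_wpM2l// invr_ge0 ltW.
rewrite mulrA mulVf ?gt_eqF// mul1r; lra.
Unshelve. all: by end_near. Qed.

End averaging.

(** * The gap along a sequence of data sets *)

Section assembly.
Context {R : realType}.

Lemma cvg_le0 (f g : nat -> R) : (\forall k \near \oo, `|f k| <= g k) ->
  g k @[k --> \oo] --> 0 -> f k @[k --> \oo] --> 0.
Proof.
move=> fg g0; apply: (cvg_dist_le _ g0); apply: filterS fg => k.
by rewrite subr0.
Qed.

Lemma cvg_of_sqr (f g : nat -> R) : (\forall k \near \oo, f k ^+ 2 <= g k) ->
  g k @[k --> \oo] --> 0 -> f k @[k --> \oo] --> 0.
Proof.
move=> fg g0; apply: (@cvg_le0 _ (fun k => Num.sqrt (g k))).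
  apply: filterS fg => k h.
  by rewrite -sqrtr_sqr ler_wsqrtr.
by have := cvg_sqrt g0; rewrite sqrtr0.
Qed.

Lemma cvg_prod_sub (C : R) (f g h k : nat -> R) :
  f l - g l @[l --> \oo] --> 0 -> h l - k l @[l --> \oo] --> 0 ->
  (forall l, `|g l| <= C) -> (forall l, `|k l| <= C) ->
  f l * h l - g l * k l @[l --> \oo] --> 0.
Proof.
move=> fg hk gC kC.
have nfg : `|f l - g l| @[l --> \oo] --> 0 by rewrite -(@normr0 _ R); exact: cvg_norm.
have nhk : `|h l - k l| @[l --> \oo] --> 0 by rewrite -(@normr0 _ R); exact: cvg_norm.
have cC : C @[l --> \oo] --> C by exact: cvg_cst.
have b0 : `|f l - g l| * `|h l - k l| + C * `|h l - k l| + C * `|f l - g l| @[l --> \oo]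
    --> 0 * 0 + C * 0 + C * (0 : R).
  by apply: cvgD; [apply: cvgD|]; apply: cvgM.
rewrite !mulr0 !addr0 in b0; apply: cvg_le0 b0; apply: nearW => l.
have -> : f l * h l - g l * k l =
  (f l - g l) * (h l - k l) + g l * (h l - k l) + k l * (f l - g l) by ring.
apply: le_trans (ler_normD _ _) _; apply: lerD; last by rewrite normrM ler_wpM2r.
apply: le_trans (ler_normD _ _) _; apply: lerD; first by rewrite normrM.
by rewrite normrM ler_wpM2r.
Qed.

(** The true entries s, t, u vary with k; bounds on them and on their scale
replace the convergence of the scale. *)
Lemma ratio_pair_cvg (C : R) (a b c s t u : nat -> R) : 0 < C ->
  a k - s k @[k --> \oo] --> 0 -> b k - t k @[k --> \oo] --> 0 ->
  c k - u k @[k --> \oo] --> 0 ->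
  (forall k, `|s k| <= C) -> (forall k, `|t k| <= C) -> (forall k, `|u k| <= C) ->
  (forall k, C^-1 <= Num.sqrt (s k * u k + t k ^+ 2)) ->
  Num.sqrt (a k * c k + b k ^+ 2) / Num.sqrt (s k * u k + t k ^+ 2) @[k --> \oo] --> (1 : R).
Proof.
move=> C0 as0 bt cu sC tC uC D0.
have ac := cvg_prod_sub as0 cu sC uC; have bb := cvg_prod_sub bt bt tC tC.
pose y k := s k * u k + t k ^+ 2; pose z k := a k * c k + b k ^+ 2.
have Ci : 0 < C^-1 by rewrite invr_gt0.
have sy k : 0 < Num.sqrt (y k) by apply: lt_le_trans (D0 k).
have y0 k : 0 < y k by rewrite -sqrtr_gt0.
have yC k : (y k)^-1 <= C ^+ 2.
  rewrite -[leRHS]invrK lef_pV2 ?posrE ?invr_gt0 ?exprn_gt0//.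
  rewrite -exprVn -[leRHS](sqr_sqrtr (ltW (y0 k))).
  by rewrite ler_pXn2r ?nnegrE ?(ltW Ci) ?(ltW (sy k))//; exact: D0.
have h1 : z k / y k @[k --> \oo] --> (1 : R).
  apply: (@cvg_dist_le _ _ (fun k => C ^+ 2 * (`|a k * c k - s k * u k| + `|b k * b k - t k * t k|))).
    apply: nearW => k; rewrite -[X in _ - X](divff (lt0r_neq0 (y0 k))) -mulrBl normrM.
    rewrite mulrC [`|(y k)^-1|]ger0_norm ?invr_ge0 ?(ltW (y0 k))//.
    apply: ler_pM => //; first by rewrite invr_ge0 ltW.
    rewrite (_ : z k - y k = (a k * c k - s k * u k) + (b k * b k - t k * t k)).
      exact: ler_normD.
    by rewrite /z /y; ring.
  have h : C ^+ 2 * (`|a k * c k - s k * u k| + `|b k * b k - t k * t k|) @[k --> \oo]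
      --> C ^+ 2 * (`|0 : R| + `|0 : R|).
    by apply: cvgM; [exact: cvg_cst|apply: cvgD; exact: cvg_norm].
  by rewrite normr0 addr0 mulr0 in h.
have := cvg_sqrt h1; rewrite sqrtr1.
rewrite (_ : (fun k => Num.sqrt (z k / y k)) = fun k => Num.sqrt (z k) / Num.sqrt (y k))//.
apply/funext => k; rewrite mulrC sqrtrM ?invr_ge0 ?(ltW (y0 k))//.
by rewrite sqrtrV ?(ltW (y0 k))// mulrC.
Qed.

Lemma sqrt_scale (k x : R) : 0 <= k -> k * Num.sqrt x = Num.sqrt (k ^+ 2 * x).
Proof. by move=> k0; rewrite sqrtrM ?sqr_ge0// sqrtr_sqr ger0_norm. Qed.

(** An index different from i, used to study a diagonal entry as part of a
pair. *)
Definition other p (hp : (1 < p)%N) (i : 'I_p) : 'I_p :=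
  if i == Ordinal (ltnW hp) then Ordinal hp else Ordinal (ltnW hp).

Lemma other_neq p (hp : (1 < p)%N) i : other hp i != i.
Proof.
rewrite /other; case: (i =P Ordinal (ltnW hp)) => [->|h]; first by rewrite -val_eqE.
by apply/eqP => e; apply: h.
Qed.

Lemma post_scaleE n p (x : 'I_n -> p.-tuple R) i j :
  post_scale x i j = n%:R * sample_cov x i j + (i == j)%:R.
Proof. by rewrite /post_scale [LHS]mxE [X in X + _]mxE [X in _ + X]mxE. Qed.

Lemma gap_le n p b (x : 'I_n -> p.-tuple R) f e :
  (forall t, `|posterior b x [set Om | f Om <= t] - fine (normal_prob 0 1 `]-oo, t])| <= e) ->
  (kolmogorov_gap b x f <= e%:E)%E.
Proof. by move=> h; apply: ge_ereal_sup => _ [t _ <-]; rewrite lee_fin. Qed.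

Section sequences.
Variables (n p b : nat -> nat) (B : nat) (x : forall k, 'I_(n k) -> (p k).-tuple R).
Variables (S : forall k, 'M[R]_(p k)) (C : R).
Hypotheses (n4 : forall k, (4 <= n k)%N) (noo : n @ \oo --> \oo).
Hypotheses (b0 : forall k, (0 < b k)%N) (bB : forall k, (b k <= B)%N).
Hypotheses (pS : forall k, posdefmx (S k)) (C1 : 1 <= C).
Hypotheses (SC : forall k, spectral_norm (S k) <= C).
Hypotheses (OC : forall k, spectral_norm (invmx (S k)) <= C).
Hypotheses (p2 : forall k, (1 < p k)%N).
Local Notation A k := (post_scale (@x k)).
Local Notation N k := ((n k)%:R : R).
Local Notation V k := (invmx (A k)).
Local Notation Sh k := (sample_cov (@x k)).

Let C0 : 0 < C. Proof. exact: lt_le_trans ltr01 C1. Qed.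
Let N0 k : 0 < N k. Proof. by rewrite ltr0n; apply: leq_trans (n4 k). Qed.
Let Noo : N k @[k --> \oo] --> +oo. Proof. exact: cvg_comp noo (@cvgr_idn R). Qed.

Let VN : (N k)^-1 @[k --> \oo] --> 0.
Proof.
have h : 2 / N k / 2 @[k --> \oo] --> (0 : R) / 2.
  by apply: cvgM; [exact: cvg_2div|exact: cvg_cst].
rewrite mul0r in h; rewrite (_ : (fun k => _) = fun k => 2 / N k / 2)//.
by apply/funext => k; rewrite mulrAC divff ?mul1r.
Qed.

Let entry_cvg (u v : forall k, 'I_(p k)) :
  (Sh k (u k) (v k) - S k (u k) (v k)) ^+ 2 @[k --> \oo] --> (0 : R) ->
  A k (u k) (v k) / N k - S k (u k) (v k) @[k --> \oo] --> (0 : R).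
Proof.
move=> d0; have h1 : Sh k (u k) (v k) - S k (u k) (v k) @[k --> \oo] --> (0 : R).
  by apply: cvg_of_sqr d0; exact: nearW.
have h2 : (u k == v k)%:R / N k @[k --> \oo] --> (0 : R).
  apply: cvg_le0 VN; apply: nearW => k.
  rewrite ger0_norm ?divr_ge0 ?ler0n ?(ltW (N0 k))// ler_piMl ?invr_ge0 ?(ltW (N0 k))//.
  by case: (_ == _).
have h : (Sh k (u k) (v k) - S k (u k) (v k)) + (u k == v k)%:R / N k @[k --> \oo]
    --> (0 + 0 : R) by exact: cvgD.
rewrite addr0 in h; rewrite (_ : (fun k => A k _ _ / _ - _) =
  fun k => (Sh k (u k) (v k) - S k (u k) (v k)) + (u k == v k)%:R / N k)//.
apply/funext => k; rewrite post_scaleE.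
by field; rewrite gt_eqF.
Qed.

Let rho_cov (u v : forall k, 'I_(p k)) :
  (Sh k (u k) (u k) - S k (u k) (u k)) ^+ 2 @[k --> \oo] --> (0 : R) ->
  (Sh k (u k) (v k) - S k (u k) (v k)) ^+ 2 @[k --> \oo] --> (0 : R) ->
  (Sh k (v k) (v k) - S k (v k) (v k)) ^+ 2 @[k --> \oo] --> (0 : R) ->
  pair_scale (A k) (u k) (v k) / N k / pair_scale (S k) (u k) (v k) @[k --> \oo] --> (1 : R).
Proof.
move=> d1 d2 d3.
have := ratio_pair_cvg C0 (entry_cvg d1) (entry_cvg d2) (entry_cvg d3)
  (fun k => spectral_entry_le C1 (SC k) _ _) (fun k => spectral_entry_le C1 (SC k) _ _)
  (fun k => spectral_entry_le C1 (SC k) _ _)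
  (fun k => pair_scale_ge (pS k) C1 (OC k) _ _).
rewrite (_ : (fun k => pair_scale (A k) _ _ / _ / _) = fun k =>
  Num.sqrt (A k (u k) (u k) / N k * (A k (v k) (v k) / N k) + (A k (u k) (v k) / N k) ^+ 2) /
  Num.sqrt (S k (u k) (u k) * S k (v k) (v k) + S k (u k) (v k) ^+ 2))//.
apply/funext => k; congr (_ / _); rewrite mulrC sqrt_scale ?invr_ge0 ?(ltW (N0 k))//.
by congr Num.sqrt; field; rewrite gt_eqF.
Qed.

Lemma cov_gap_seq (i j : forall k, 'I_(p k)) :
  (forall k, i k != j k) ->
  (Sh k (i k) (i k) - S k (i k) (i k)) ^+ 2 + (Sh k (i k) (j k) - S k (i k) (j k)) ^+ 2 +
    (Sh k (j k) (j k) - S k (j k) (j k)) ^+ 2 @[k --> \oo] --> (0 : R) ->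
  forall e : R, 0 < e -> \forall k \near \oo,
  (kolmogorov_gap (b k) (@x k) (fun Om => Num.sqrt (N k) *
      (invmx Om (i k) (j k) - Sh k (i k) (j k)) / pair_scale (S k) (i k) (j k))%R <= e%:E)%E.
Proof.
move=> ij d0 e e0.
have le0 (f : nat -> R) : (forall k, `|f k| <= (Sh k (i k) (i k) - S k (i k) (i k)) ^+ 2 +
    (Sh k (i k) (j k) - S k (i k) (j k)) ^+ 2 + (Sh k (j k) (j k) - S k (j k) (j k)) ^+ 2) ->
    f k @[k --> \oo] --> 0.
  by move=> h; apply: cvg_le0 d0; exact: nearW.
have rho : pair_scale (A k) (i k) (j k) / N k / pair_scale (S k) (i k) (j k)
    @[k --> \oo] --> (1 : R).
  by apply: rho_cov; apply: le0 => k; rewrite ger0_norm ?sqr_ge0//;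
    have := sqr_ge0 (Sh k (i k) (i k) - S k (i k) (i k));
    have := sqr_ge0 (Sh k (i k) (j k) - S k (i k) (j k));
    have := sqr_ge0 (Sh k (j k) (j k) - S k (j k) (j k)); lra.
have D0 k : 0 < pair_scale (S k) (i k) (j k) by exact: pair_scale_gt0.
apply: filterS (posterior_cov_limit n4 noo b0 bB ij D0 rho e0) => k h.
exact: gap_le.
Qed.

Lemma var_gap_seq (j : forall k, 'I_(p k)) :
  (Sh k (j k) (j k) - S k (j k) (j k)) ^+ 2 @[k --> \oo] --> (0 : R) ->
  forall e : R, 0 < e -> \forall k \near \oo,
  (kolmogorov_gap (b k) (@x k) (fun Om => Num.sqrt (N k) *
      (invmx Om (j k) (j k) - Sh k (j k) (j k)) / pair_scale (S k) (j k) (j k))%R <= e%:E)%E.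
Proof.
move=> d0 e e0.
have rho := rho_cov d0 d0 d0.
have D0 k : 0 < pair_scale (S k) (j k) (j k) by exact: pair_scale_gt0.
have ij k : other (p2 k) (j k) != j k by exact: other_neq.
have ga : (Num.sqrt (N k))^-1 / pair_scale (S k) (j k) (j k) @[k --> \oo] --> (0 : R).
  have h : (Num.sqrt (N k))^-1 * C @[k --> \oo] --> (0 * C : R).
    by apply: cvgM; [exact: cvg_Vsqrt|exact: cvg_cst].
  rewrite mul0r in h; apply: cvg_le0 h; apply: nearW => k.
  rewrite ger0_norm ?divr_ge0 ?invr_ge0 ?sqrtr_ge0// ler_wpM2l ?invr_ge0 ?sqrtr_ge0//.
  rewrite -[leRHS]invrK lef_pV2 ?posrE ?invr_gt0//.
  exact: pair_scale_ge (pS k) C1 (OC k) _ _.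
apply: filterS (posterior_var_limit n4 noo b0 bB ij D0 rho ga e0) => k h.
exact: gap_le.
Qed.

(* Bounds the squared operator norm of both Shat - S and Shat + 1 / n - S. *)
Let f k := 2 * frob2 (Sh k - S k) + 2 * (N k)^-1 ^+ 2.

Let f_cvg : frob2 (Sh k - S k) @[k --> \oo] --> (0 : R) -> f k @[k --> \oo] --> 0.
Proof.
move=> d0; have h : f k @[k --> \oo] --> (2 * 0 + 2 * (0 * 0) : R).
  apply: cvgD; apply: cvgM => //; [exact: cvg_cst|exact: cvg_cst|].
  by apply: (cvgM VN VN).
by rewrite !mulr0 addr0 in h.
Qed.

Let frob2_ge0 q (E : 'M[R]_q) : 0 <= frob2 E.
Proof. by apply: sumr_ge0 => i _; apply: sumr_ge0 => j _; exact: sqr_ge0. Qed.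

Let pert1 k u : sqnorm ((Sh k - S k) *m u) <= f k * sqnorm u.
Proof.
apply: le_trans (sqnorm_frob _ _) _; rewrite ler_wpM2r ?sqnorm_ge0// /f.
by have := frob2_ge0 (Sh k - S k); have := sqr_ge0 (N k)^-1; lra.
Qed.

Let pert2 k u : sqnorm ((Sh k + (N k)^-1%:M - S k) *m u) <= f k * sqnorm u.
Proof.
rewrite addrAC mulmxDl mul_scalar_mx; apply: le_trans (sqnormD_le _ _) _.
have -> : f k * sqnorm u = 2 * (frob2 (Sh k - S k) * sqnorm u) + 2 * ((N k)^-1 ^+ 2 * sqnorm u).
  by rewrite /f; ring.
by rewrite sqnormZ lerD2r ler_pM2l// sqnorm_frob.
Qed.

Let VE k : V k = (N k)^-1 *: invmx (Sh k + (N k)^-1%:M).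
Proof.
have AE : A k = N k *: (Sh k + (N k)^-1%:M).
  by rewrite /post_scale scalerDr scale_scalar_mx divff// gt_eqF.
have uM : Sh k + (N k)^-1%:M \in unitmx.
  have := posdef_unit (posdef_post_scale (@x k)).
  by rewrite !unitmxE AE detZ unitrM => /andP[].
apply: invmx_unique; rewrite AE -scalemxAl -scalemxAr scalerA divff ?gt_eqF// scale1r.
by rewrite mulmxV.
Qed.

Let NV k u v : N k * V k u v = invmx (Sh k + (N k)^-1%:M) u v.
Proof. by rewrite VE [X in _ * X]mxE mulrA divff ?mul1r// gt_eqF. Qed.

Let tM k : (Sh k + (N k)^-1%:M)^T = Sh k + (N k)^-1%:M.
Proof. by rewrite linearD/= tr_scalar_mx tr_sample_cov. Qed.

Let f_small : frob2 (Sh k - S k) @[k --> \oo] --> (0 : R) ->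
  \forall k \near \oo, f k <= (4 * C ^+ 2)^-1.
Proof.
move=> d0; have c0 : 0 < (4 * C ^+ 2)^-1 by rewrite invr_gt0 mulr_gt0// exprn_gt0.
have h : \forall k \near \oo, `|f k| <= (4 * C ^+ 2)^-1.
  by apply: cvgr0_norm_le => //; exact: f_cvg.
by apply: filterS h => k; apply: le_trans; exact: ler_norm.
Qed.

Let prec_entry_cvg (u v : forall k, 'I_(p k)) :
  frob2 (Sh k - S k) @[k --> \oo] --> (0 : R) ->
  N k * V k (u k) (v k) - invmx (S k) (u k) (v k) @[k --> \oo] --> (0 : R).
Proof.
move=> d0; apply: (@cvg_of_sqr _ (fun k => 4 * C ^+ 4 * f k)).
  apply: filterS (f_small d0) => k fk; rewrite NV.
  exact: (perturb_inv (pS k) C1 (OC k) _ _ (@pert2 k) fk (tM k)).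
have h : 4 * C ^+ 4 * f k @[k --> \oo] --> (4 * C ^+ 4 * 0 : R).
  by apply: cvgM; [exact: cvg_cst|exact: f_cvg].
by rewrite mulr0 in h.
Qed.

Let pO k : posdefmx (invmx (S k)). Proof. exact: posdef_inv. Qed.
Let OC' k : spectral_norm (invmx (invmx (S k))) <= C. Proof. by rewrite invmxK. Qed.

Let rho_prec (u v : forall k, 'I_(p k)) :
  frob2 (Sh k - S k) @[k --> \oo] --> (0 : R) ->
  N k * pair_scale (V k) (u k) (v k) / pair_scale (invmx (S k)) (u k) (v k)
    @[k --> \oo] --> (1 : R).
Proof.
move=> d0.
have := ratio_pair_cvg C0 (@prec_entry_cvg u u d0) (@prec_entry_cvg u v d0)
  (@prec_entry_cvg v v d0)
  (fun k => spectral_entry_le C1 (OC k) _ _) (fun k => spectral_entry_le C1 (OC k) _ _)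
  (fun k => spectral_entry_le C1 (OC k) _ _)
  (fun k => pair_scale_ge (pO k) C1 (OC' k) _ _).
rewrite (_ : (fun k => N k * pair_scale (V k) _ _ / _) = fun k =>
  Num.sqrt (N k * V k (u k) (u k) * (N k * V k (v k) (v k)) + (N k * V k (u k) (v k)) ^+ 2) /
  Num.sqrt (invmx (S k) (u k) (u k) * invmx (S k) (v k) (v k) + invmx (S k) (u k) (v k) ^+ 2))//.
apply/funext => k; congr (_ / _); rewrite sqrt_scale ?(ltW (N0 k))//.
by congr Num.sqrt; ring.
Qed.

Let gamma_prec (u v : forall k, 'I_(p k)) :
  frob2 (Sh k - S k) @[k --> \oo] --> (0 : R) ->
  Num.sqrt (N k) * (N k * V k (u k) (v k) - invmx (Sh k) (u k) (v k)) /
    pair_scale (invmx (S k)) (u k) (v k) @[k --> \oo] --> (0 : R).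
Proof.
move=> d0; have g0 : 4 * C ^+ 3 * (Num.sqrt (N k))^-1 @[k --> \oo] --> (4 * C ^+ 3 * 0 : R).
  by apply: cvgM; [exact: cvg_cst|exact: cvg_Vsqrt].
rewrite mulr0 in g0; apply: cvg_le0 g0; apply: filterS (f_small d0) => k fk.
have P0 : 0 < pair_scale (invmx (S k)) (u k) (v k) by exact: pair_scale_gt0.
have s0 : 0 < Num.sqrt (N k) by rewrite sqrtr_gt0.
have sN : N k = Num.sqrt (N k) ^+ 2 by rewrite sqr_sqrtr// ltW.
have e1 : `|N k * V k (u k) (v k) - invmx (Sh k) (u k) (v k)| <= 4 * C ^+ 2 * (N k)^-1.
  have r0 : 0 <= 4 * C ^+ 2 * (N k)^-1 by rewrite mulr_ge0 ?invr_ge0 ?(ltW (N0 k))// mulr_ge0// sqr_ge0.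
  rewrite -(@ler_pXn2r _ 2) ?nnegrE// real_normK ?num_real// NV.
  apply: le_trans (perturb_inv2 (pS k) C1 (OC k) _ _ (@pert1 k) fk (@pert2 k)
    (tr_sample_cov _)) _.
  by rewrite le_eqVlt; apply/orP; left; apply/eqP; ring.
rewrite !normrM (gtr0_norm s0) normfV (gtr0_norm P0).
apply: (@le_trans _ _ (Num.sqrt (N k) * (4 * C ^+ 2 * (N k)^-1) * C)).
  apply: ler_pM; rewrite ?mulr_ge0 ?invr_ge0 ?(ltW P0) ?(ltW s0)//.
    by rewrite ler_wpM2l// ltW.
  rewrite -[leRHS]invrK lef_pV2 ?posrE ?invr_gt0//.
  exact: pair_scale_ge (pO k) C1 (OC' k) _ _.
have -> : (N k)^-1 = (Num.sqrt (N k))^-1 ^+ 2 by rewrite [in LHS]sN exprVn.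
set s := Num.sqrt (N k) in s0 *.
by rewrite le_eqVlt; apply/orP; left; apply/eqP; field; rewrite gt_eqF.
Qed.

Hypothesis pN : (p k)%:R / Num.sqrt (N k) @[k --> \oo] --> (0 : R).

Lemma prec_gap_seq (i j : forall k, 'I_(p k)) : (forall k, i k != j k) ->
  frob2 (Sh k - S k) @[k --> \oo] --> (0 : R) ->
  forall e : R, 0 < e -> \forall k \near \oo,
  (kolmogorov_gap (b k) (@x k) (fun Om => Num.sqrt (N k) *
      (Om (i k) (j k) - invmx (Sh k) (i k) (j k)) / pair_scale (invmx (S k)) (i k) (j k))%R <= e%:E)%E.
Proof.
move=> ij d0 e e0.
have D0 k : 0 < pair_scale (invmx (S k)) (i k) (j k) by exact: pair_scale_gt0.
apply: filterS (posterior_prec_limit n4 noo b0 bB ij D0 pN (@rho_prec i j d0)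
  (@gamma_prec i j d0) e0) => k h.
exact: gap_le.
Qed.

Lemma prec_diag_gap_seq (i : forall k, 'I_(p k)) :
  frob2 (Sh k - S k) @[k --> \oo] --> (0 : R) ->
  forall e : R, 0 < e -> \forall k \near \oo,
  (kolmogorov_gap (b k) (@x k) (fun Om => Num.sqrt (N k) *
      (Om (i k) (i k) - invmx (Sh k) (i k) (i k)) / pair_scale (invmx (S k)) (i k) (i k))%R <= e%:E)%E.
Proof.
move=> d0 e e0.
have D0 k : 0 < pair_scale (invmx (S k)) (i k) (i k) by exact: pair_scale_gt0.
have ij k : i k != other (p2 k) (i k) by rewrite eq_sym; exact: other_neq.
apply: filterS (posterior_prec_diag_limit n4 noo b0 bB ij D0 pN (@rho_prec i i d0)
  (@gamma_prec i i d0) e0) => k h.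
exact: gap_le.
Qed.

End sequences.
End assembly.

(** * Mean deviation of the data, and the theorem *)

Section deviations.
Context {R : realType}.

(** The entries of Shat that the scale of sigma_ij depends on. *)
Definition cov_dev n p (S : 'M[R]_p) i j (x : 'I_n -> p.-tuple R) : R :=
  (sample_cov x i i - S i i) ^+ 2 + (sample_cov x i j - S i j) ^+ 2 +
  (sample_cov x j j - S j j) ^+ 2.

Lemma cov_dev_ge0 n p (S : 'M[R]_p) i j (x : 'I_n -> p.-tuple R) : 0 <= cov_dev S i j x.
Proof. by rewrite !addr_ge0// sqr_ge0. Qed.

Definition frob_dev n p (S : 'M[R]_p) (x : 'I_n -> p.-tuple R) : R := frob2 (sample_cov x - S).

Lemma frob_dev_ge0 n p (S : 'M[R]_p) (x : 'I_n -> p.-tuple R) : 0 <= frob_dev S x.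
Proof. by apply: sumr_ge0 => i _; apply: sumr_ge0 => j _; exact: sqr_ge0. Qed.

Section one_sample.
Context d (T : measurableType d) (P : probability T R).
Variables (n p : nat) (X : 'I_n -> {RV P >-> p.-tuple R}) (S : 'M[R]_p) (c : R).

Let m1 i j : measurable_fun setT
  (fun w => (sample_cov (fun l => X l w) i j - S i j) ^+ 2).
Proof.
apply: measurable_funX; apply: measurable_funB => //; exact: measurable_sample_cov.
Qed.

Let m1E i j : measurable_fun setT
  (fun w => ((sample_cov (fun l => X l w) i j - S i j) ^+ 2)%:E : \bar R).
Proof. by apply/measurable_EFinP; exact: m1. Qed.

Let e0 i j w : (0 <= ((sample_cov (fun l => X l w) i j - S i j) ^+ 2)%:E)%E.
Proof. by rewrite lee_fin sqr_ge0. Qed.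

Lemma measurable_cov_dev i j : measurable_fun setT (fun w => cov_dev S i j (fun l => X l w)).
Proof. by apply: measurable_funD; [apply: measurable_funD|]; exact: m1. Qed.

Let frob_devE w : frob_dev S (fun l => X l w) =
  \sum_i \sum_j (sample_cov (fun l => X l w) i j - S i j) ^+ 2.
Proof.
apply: eq_bigr => i _; apply: eq_bigr => j _.
by rewrite [X in X ^+ 2]mxE [X in _ + X]mxE.
Qed.

Lemma measurable_frob_dev : measurable_fun setT (fun w => frob_dev S (fun l => X l w)).
Proof.
under eq_fun do rewrite frob_devE.
by apply: measurable_sum => i; apply: measurable_sum => j; exact: m1.
Qed.

Hypotheses (n0 : (0 < n)%N) (pS : posdefmx S) (gX : gaussian_sample X S).
Hypothesis Sc : forall k, S k k <= c.

Lemma mean_cov_dev i j :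
  (\int[P]_w (cov_dev S i j (fun l => X l w))%:E <= (768 * c ^+ 2 / n%:R)%:E)%E.
Proof.
have -> : (\int[P]_w (cov_dev S i j (fun l => X l w))%:E =
    \int[P]_w (((sample_cov (fun l => X l w) i i - S i i) ^+ 2)%:E +
      ((sample_cov (fun l => X l w) i j - S i j) ^+ 2)%:E +
      ((sample_cov (fun l => X l w) j j - S j j) ^+ 2)%:E))%E.
  by apply: eq_integral => w _; rewrite -!EFinD.
rewrite ge0_integralD; last 5 first.
- exact: measurableT.
- by move=> w _; rewrite adde_ge0// e0.
- by apply: emeasurable_funD; exact: m1E.
- by move=> w _; exact: e0.
- exact: m1E.
rewrite ge0_integralD; last 5 first.
- exact: measurableT.
- by move=> w _; exact: e0.
- exact: m1E.
- by move=> w _; exact: e0.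
- exact: m1E.
have -> : 768 * c ^+ 2 / n%:R = 256 * c ^+ 2 / n%:R + 256 * c ^+ 2 / n%:R + 256 * c ^+ 2 / n%:R.
  by ring.
rewrite !EFinD.
by apply: leeD; [apply: leeD|]; exact: sample_cov_mse.
Qed.

Lemma mean_frob_dev :
  (\int[P]_w (frob_dev S (fun l => X l w))%:E <= (256 * c ^+ 2 * (p%:R ^+ 2 / n%:R))%:E)%E.
Proof.
have -> : (\int[P]_w (frob_dev S (fun l => X l w))%:E = \int[P]_w (\sum_(i < p) \sum_(j < p)
    ((sample_cov (fun l => X l w) i j - S i j) ^+ 2)%:E))%E.
  apply: eq_integral => w _; rewrite frob_devE -sumEFin; apply: eq_bigr => i _.
  by rewrite sumEFin.
rewrite ge0_integral_sum; last 3 first.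
- exact: measurableT.
- by move=> i; apply: emeasurable_sum => j; exact: m1E.
- by move=> i w _; apply: sume_ge0 => j _; exact: e0.
apply: (@le_trans _ _ (\sum_(i < p) \sum_(j < p) (256 * c ^+ 2 / n%:R)%:E)%E).
  apply: lee_sum => i _; rewrite ge0_integral_sum; last 3 first.
  - exact: measurableT.
  - by move=> j; exact: m1E.
  - by move=> j w _; exact: e0.
  by apply: lee_sum => j _; exact: sample_cov_mse.
rewrite (eq_bigr (fun _ => (p%:R * (256 * c ^+ 2 / n%:R))%:E)); last first.
  by move=> i _; rewrite sumEFin sumr_const card_ord (mulr_natl _ p).
rewrite sumEFin sumr_const card_ord -(mulr_natl _ p) lee_fin.
by rewrite le_eqVlt; apply/orP; left; apply/eqP; ring.
Qed.

End one_sample.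

Lemma cvg_subseq (n s : nat -> nat) : n @ \oo --> \oo -> (forall l, l <= s l)%N ->
  (fun l => n (s l)) @ \oo --> \oo.
Proof.
move=> noo sl; apply: cvg_comp noo; apply/cvgnyPge => A.
by exists A => // l /= Al; exact: leq_trans Al (sl l).
Qed.

Lemma cvg_subseqr (f : nat -> R) (s : nat -> nat) (l : R) : f @ \oo --> l ->
  (forall l, l <= s l)%N -> f (s k) @[k --> \oo] --> l.
Proof.
move=> fl sl; apply: cvg_comp fl; apply/cvgnyPge => A.
by exists A => // k /= Ak; exact: leq_trans Ak (sl k).
Qed.

End deviations.

Theorem corollary3p1 (R : realType) (n p b : nat -> nat)
    (d : nat -> measure_display) (T : forall k, measurableType (d k))
    (P : forall k, probability (T k) R)
    (Sigma : forall k, 'M[R]_(p k))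
    (X : forall k, 'I_(n k) -> {RV (P k) >-> (p k).-tuple R})
    (i j : forall k, 'I_(p k)) :
  n @ \oo --> \oo -> p @ \oo --> \oo ->
  (forall k, (1 <= b k)%N) ->
  (exists B : nat, forall k, (b k <= B)%N) ->
  (forall k, posdefmx (Sigma k)) ->
  (exists C : R, forall k,
     Num.max (spectral_norm (Sigma k)) (spectral_norm (invmx (Sigma k))) <= C) ->
  (forall k, gaussian_sample (X k) (Sigma k)) ->
  (p k)%:R / (n k)%:R @[k --> \oo] --> (0 : R) ->
  (\int[P k]_w
     (let x := fun l => X k l w in
      let S := Sigma k in
      kolmogorov_gap (b k) x (fun Om =>
        Num.sqrt (n k)%:R * (invmx Om (i k) (j k) - sample_cov x (i k) (j k))
        / Num.sqrt (S (i k) (i k) * S (j k) (j k) + S (i k) (j k) ^+ 2)))%R)%E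
    @[k --> \oo] --> (0 : \bar R)%E
  /\
  ((p k)%:R ^+ 2 / (n k)%:R @[k --> \oo] --> (0 : R) ->
   (\int[P k]_w
     (let x := fun l => X k l w in
      let Omega := invmx (Sigma k) in
      kolmogorov_gap (b k) x (fun Om =>
        Num.sqrt (n k)%:R * (Om (i k) (j k) - invmx (sample_cov x) (i k) (j k))
        / Num.sqrt (Omega (i k) (i k) * Omega (j k) (j k)
                    + Omega (i k) (j k) ^+ 2)))%R)%E
    @[k --> \oo] --> (0 : \bar R)%E).
Proof.
move=> noo poo b0 [B bB] pS [C' hC] gX _.
(* A bound at least 1 serves as a bound on entries and their inverses alike. *)
pose C := Num.max 1 C'.
have C1 : 1 <= C by rewrite le_max lexx.
have C'C : C' <= C by rewrite le_max lexx orbT.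
have SC k : spectral_norm (Sigma k) <= C.
  by have := hC k; rewrite ge_max => /andP[h _]; exact: le_trans C'C.
have OC k : spectral_norm (invmx (Sigma k)) <= C.
  by have := hC k; rewrite ge_max => /andP[_ h]; exact: le_trans C'C.
have Sc k l : Sigma k l l <= C.
  by apply: le_trans (ler_norm _) _; exact: spectral_entry_le.
have [K0 K0P] : exists K : nat, forall k, (K <= k)%N -> (4 <= n k)%N /\ (1 < p k)%N.
  have [Kn _ hn] : \forall k \near \oo, (4 <= n k)%N by move/cvgnyPge : noo; apply.
  have [Kp _ hp] : \forall k \near \oo, (2 <= p k)%N by move/cvgnyPge : poo; apply.
  exists (maxn Kn Kp) => k; rewrite geq_max => /andP[? ?].
  by split; [exact: hn|exact: hp].
have n0 : \forall k \near \oo, (0 < n k)%N.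
  by exists K0 => // k /= /K0P[h _]; exact: leq_trans h.
have Vn0 : ((n k)%:R : R)^-1 @[k --> \oo] --> 0.
  have Noo : ((n k)%:R : R) @[k --> \oo] --> +oo by exact: cvg_comp noo (@cvgr_idn R).
  have h : 2 / (n k)%:R / 2 @[k --> \oo] --> (0 / 2 : R).
    by apply: cvgM; [exact: cvg_2div|exact: cvg_cst].
  rewrite mul0r in h; rewrite (_ : (fun k => _) = fun k => 2 / (n k)%:R / 2)//.
  by apply/funext => k; rewrite mulrAC divff ?mul1r.
pose U k := 'I_(n k) -> (p k).-tuple R.
split.
- pose gap k (x : U k) := kolmogorov_gap (b k) x (fun Om => (Num.sqrt (n k)%:R *
    (invmx Om (i k) (j k) - sample_cov x (i k) (j k)) / pair_scale (Sigma k) (i k) (j k))%R).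
  pose dev k (x : U k) := cov_dev (Sigma k) (i k) (j k) x.
  apply: (@mean_gap_cvg _ d T P (fun k w => gap k (fun l => X k l w))
    (fun k w => dev k (fun l => X k l w)) (fun k => 768 * C ^+ 2 / (n k)%:R)).
  + by move=> k w; exact: kolmogorov_gap_unit.
  + by move=> k; exact: measurable_cov_dev.
  + by move=> k w; exact: cov_dev_ge0.
  + by apply: filterS n0 => k nk; exact: mean_cov_dev.
  + have h : 768 * C ^+ 2 / (n k)%:R @[k --> \oo] --> (768 * C ^+ 2 * 0 : R).
      by apply: cvgM => //; exact: cvg_cst.
    by rewrite mulr0 in h.
  move=> e e0.
  (* Off-diagonal stages and diagonal stages are treated by separate limit lemmas. *)
  have seq1 (s : nat -> nat) (x : forall l, U (s l)) : (forall l, l <= s l)%N ->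
      (forall l, [/\ i (s l) != j (s l), 4 <= n (s l) & 1 < p (s l)]%N) ->
      dev (s l) (x l) @[l --> \oo] --> 0 ->
      forall e, 0 < e -> \forall l \near \oo, (gap (s l) (x l) <= e%:E)%E.
    move=> sl c0 dv e' e'0.
    have ij l : i (s l) != j (s l) by have [] := c0 l.
    have n4 l : (4 <= n (s l))%N by have [] := c0 l.
    exact: (@cov_gap_seq R (fun l => n (s l)) (fun l => p (s l)) (fun l => b (s l)) B x
       (fun l => Sigma (s l)) C n4 (cvg_subseq noo sl)
       (fun l => b0 (s l)) (fun l => bB (s l)) (fun l => pS (s l)) C1 (fun l => SC (s l))
       (fun l => OC (s l)) (fun l => i (s l)) (fun l => j (s l)) ij dv e' e'0).
  have [d1 d10 [K1 H1]] := @uniform_of_seq R U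
    (fun k => [/\ i k != j k, 4 <= n k & 1 < p k]%N) dev gap
    (fun k u => cov_dev_ge0 _ _ _ _) seq1 e e0.
  have seq2 (s : nat -> nat) (x : forall l, U (s l)) : (forall l, l <= s l)%N ->
      (forall l, [/\ i (s l) = j (s l), 4 <= n (s l) & 1 < p (s l)]%N) ->
      dev (s l) (x l) @[l --> \oo] --> 0 ->
      forall e, 0 < e -> \forall l \near \oo, (gap (s l) (x l) <= e%:E)%E.
    move=> sl c0 dv e' e'0.
    have n4 l : (4 <= n (s l))%N by have [] := c0 l.
    have p2 l : (1 < p (s l))%N by have [] := c0 l.
    have dj : (sample_cov (@x l) (j (s l)) (j (s l)) - Sigma (s l) (j (s l)) (j (s l))) ^+ 2
        @[l --> \oo] --> (0 : R).
      apply: (cvg_le0 _ dv); apply: nearW => l.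
      by rewrite ger0_norm ?sqr_ge0// /dev /cov_dev lerDr addr_ge0// sqr_ge0.
    have := @var_gap_seq R (fun l => n (s l)) (fun l => p (s l)) (fun l => b (s l)) B x
       (fun l => Sigma (s l)) C n4 (cvg_subseq noo sl)
       (fun l => b0 (s l)) (fun l => bB (s l)) (fun l => pS (s l)) C1 (fun l => SC (s l))
       (fun l => OC (s l)) p2 (fun l => j (s l)) dj e' e'0.
    apply: filterS => l; rewrite /gap.
    by have [-> _ _] := c0 l.
  have [d2 d20 [K2 H2]] := @uniform_of_seq R U
    (fun k => [/\ i k = j k, 4 <= n k & 1 < p k]%N) dev gap
    (fun k u => cov_dev_ge0 _ _ _ _) seq2 e e0.
  exists (Num.min d1 d2); first by rewrite lt_min d10.
  exists (maxn K0 (maxn K1 K2)) => k; rewrite !geq_max => /and3P[kK0 kK1 kK2] w.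
  rewrite le_min => /andP[w1 w2]; have [n4 p2] := K0P k kK0.
  have [ij|ij] := eqVneq (i k) (j k); first by apply: (H2 k kK2 _ _ w2); split.
  by apply: (H1 k kK1 _ _ w1); split.
- move=> p2n.
  pose gap k (x : U k) := kolmogorov_gap (b k) x (fun Om => (Num.sqrt (n k)%:R *
    (Om (i k) (j k) - invmx (sample_cov x) (i k) (j k)) /
     pair_scale (invmx (Sigma k)) (i k) (j k))%R).
  pose dev k (x : U k) := frob_dev (Sigma k) x.
  have pN : (p k)%:R / Num.sqrt (n k)%:R @[k --> \oo] --> (0 : R).
    apply: cvg_of_sqr p2n; apply: nearW => k.
    by rewrite expr_div_n sqr_sqrtr// ler0n.
  apply: (@mean_gap_cvg _ d T P (fun k w => gap k (fun l => X k l w))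
    (fun k w => dev k (fun l => X k l w))
    (fun k => 256 * C ^+ 2 * ((p k)%:R ^+ 2 / (n k)%:R))).
  + by move=> k w; exact: kolmogorov_gap_unit.
  + by move=> k; exact: measurable_frob_dev.
  + by move=> k w; exact: frob_dev_ge0.
  + by apply: filterS n0 => k nk; exact: mean_frob_dev.
  + have h : 256 * C ^+ 2 * ((p k)%:R ^+ 2 / (n k)%:R) @[k --> \oo] --> (256 * C ^+ 2 * 0 : R).
      by apply: cvgM => //; exact: cvg_cst.
    by rewrite mulr0 in h.
  move=> e e0.
  have seq1 (s : nat -> nat) (x : forall l, U (s l)) : (forall l, l <= s l)%N ->
      (forall l, [/\ i (s l) != j (s l), 4 <= n (s l) & 1 < p (s l)]%N) ->
      dev (s l) (x l) @[l --> \oo] --> 0 ->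
      forall e, 0 < e -> \forall l \near \oo, (gap (s l) (x l) <= e%:E)%E.
    move=> sl c0 dv e' e'0.
    have ij l : i (s l) != j (s l) by have [] := c0 l.
    have n4 l : (4 <= n (s l))%N by have [] := c0 l.
    exact: (@prec_gap_seq R (fun l => n (s l)) (fun l => p (s l)) (fun l => b (s l)) B x
       (fun l => Sigma (s l)) C n4 (cvg_subseq noo sl)
       (fun l => b0 (s l)) (fun l => bB (s l)) (fun l => pS (s l)) C1 (fun l => SC (s l))
       (fun l => OC (s l)) (cvg_subseqr pN sl) (fun l => i (s l)) (fun l => j (s l)) ij dv e' e'0).
  have seq2 (s : nat -> nat) (x : forall l, U (s l)) : (forall l, l <= s l)%N ->
      (forall l, [/\ i (s l) = j (s l), 4 <= n (s l) & 1 < p (s l)]%N) ->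
      dev (s l) (x l) @[l --> \oo] --> 0 ->
      forall e, 0 < e -> \forall l \near \oo, (gap (s l) (x l) <= e%:E)%E.
    move=> sl c0 dv e' e'0.
    have n4 l : (4 <= n (s l))%N by have [] := c0 l.
    have p2 l : (1 < p (s l))%N by have [] := c0 l.
    have := @prec_diag_gap_seq R (fun l => n (s l)) (fun l => p (s l)) (fun l => b (s l)) B x
       (fun l => Sigma (s l)) C n4 (cvg_subseq noo sl)
       (fun l => b0 (s l)) (fun l => bB (s l)) (fun l => pS (s l)) C1 (fun l => SC (s l))
       (fun l => OC (s l)) p2 (cvg_subseqr pN sl) (fun l => j (s l)) dv e' e'0.
    apply: filterS => l; rewrite /gap.
    by have [-> _ _] := c0 l.
  have [d1 d10 [K1 H1]] := @uniform_of_seq R U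
    (fun k => [/\ i k != j k, 4 <= n k & 1 < p k]%N) dev gap
    (fun k u => frob_dev_ge0 _ _) seq1 e e0.
  have [d2 d20 [K2 H2]] := @uniform_of_seq R U
    (fun k => [/\ i k = j k, 4 <= n k & 1 < p k]%N) dev gap
    (fun k u => frob_dev_ge0 _ _) seq2 e e0.
  exists (Num.min d1 d2); first by rewrite lt_min d10.
  exists (maxn K0 (maxn K1 K2)) => k; rewrite !geq_max => /and3P[kK0 kK1 kK2] w.
  rewrite le_min => /andP[w1 w2]; have [n4 p2] := K0P k kK0.
  have [ij|ij] := eqVneq (i k) (j k); first by apply: (H2 k kK2 _ _ w2); split.
  by apply: (H1 k kK1 _ _ w1); split.
Qed.
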